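(* Let $\nu_1,\nu_2,\lambda,\mu$ be smooth real functions on a domain $\mathcal D\subset\mathbb R^2$ with $\mu\neq 0$ and $\nu_1+\nu_2>0$ on $\mathcal D$, such that the function $\Theta$ (the common denominator in the definition of $f_1,\dots,f_4$ given in the context) has no zeros on $\mathcal D$. Let $f_1,f_2,f_3,f_4:\mathcal D\to\mathbb R$ be the functions associated with $\nu_1,\nu_2,\lambda,\mu$ by the formulas in the context. Let $(u_0,v_0)\in\mathcal D$, let $c_1,c_2\in\mathbb R$, put $c=e^{c_2-c_1}$, let $U=I\times J\subset\mathcal D$ be an open rectangle ($I,J$ open intervals) containing $(u_0,v_0)$, and put $$g_1(u)=\exp\Big(\int_{u_0}^u (c f_3+f_4)(s,v_0)\,ds-c_1\Big),\quad u\in I,\qquad g_2(v)=\exp\Big(\int_{v_0}^v \big(f_1+\tfrac1c f_2\big)(u_0,t)\,dt-c_2\Big),\quad v\in J.$$ Let $\varphi,\psi:U\to\mathbb R$ be nowhere vanishing smooth functions solving the Cauchy problem $$\varphi_v=f_1\varphi+f_2\psi,\qquad \psi_u=f_3\varphi+f_4\psi,\qquad \varphi(u,v_0)=g_1(u),\qquad \psi(u_0,v)=g_2(v).$$ Suppose that on $U$ the following two equations are satisfied: $$\nu_1\nu_2-(\lambda^2+\mu^2)=-\frac1{\varphi\psi}\left(\Big(f_1\frac{\varphi}{\psi}+f_2\Big)_v+\Big(f_3+f_4\frac{\psi}{\varphi}\Big)_u\right),$$ $$\varphi\psi(\nu_1-\nu_2)\mu=\left(2\frac{\lambda}{\mu}\frac{\psi_u}{\psi}-\frac{\nu_1-\nu_2}{\mu}\frac{\varphi_v}{\psi}+\frac{\lambda_u}{\mu}-\frac{(\nu_1)_v}{\mu}\frac{\varphi}{\psi}\right)_v-\left(2\frac{\lambda}{\mu}\frac{\varphi_v}{\varphi}+\frac{\nu_1-\nu_2}{\mu}\frac{\psi_u}{\varphi}-\frac{(\nu_2)_u}{\mu}\frac{\psi}{\varphi}+\frac{\lambda_v}{\mu}\right)_u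 .$$ Then there exists a surface $z:U\to\mathbb R^4$, unique up to a motion (orientation-preserving isometry) of $\mathbb R^4$, for which $(u,v)$ are canonical principal parameters (with respect to $(u_0,v_0)$, $c_1$, $c_2$) and whose geometric functions are $\nu_1(u,v),\nu_2(u,v),\lambda(u,v),\mu(u,v)$.
   Context: All objects are smooth; subscripts $u,v$ denote partial derivatives. $\mathbb R^4$ carries the standard Euclidean metric and orientation. Surfaces and principal parameters. A surface is an immersion $z=z(u,v)$ of a plane domain into $\mathbb R^4$; $E,F,G$ are the coefficients of its first fundamental form and $\sigma$ its second fundamental tensor (normal part of the second derivatives). With $\{n_1,n_2\}$ an orthonormal frame of the normal bundle and $c_{11}^k,c_{12}^k,c_{22}^k$ the $n_k$-components of $\sigma(z_u,z_u),\sigma(z_u,z_v),\sigma(z_v,z_v)$, put $L=\frac{2}{\sqrt{EG-F^2}}(c_{11}^1c_{12}^2-c_{11}^2c_{12}^1)$, $M=\frac{1}{\sqrt{EG-F^2}}(c_{11}^1c_{22}^2-c_{11}^2c_{22}^1)$, $N=\frac{2}{\sqrt{EG-F^2}}(c_{12}^1c_{22}^2-c_{12}^2c_{22}^1)$, and $k=\frac{LN-M^2}{EG-F^2}$, $\varkappa=\frac{EN-2FM+GL}{2(EG-F^2)}$. The surface is free of minimal points if $\varkappa^2-k>0$ everywhere; then its mean curvature vector $H$ is nowhere zero. The parameters $(u,v)$ are principal if $F=M=0$. Geometric functions. For a surface free of minimal points in principal parameters, let $x=z_u/\sqrt E$, $y=z_v/\sqrt G$, $b=H/\|H\|$, and let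 $l$ be the unit normal field such that $\{x,y,b,l\}$ is a positively oriented orthonormal frame. Then $\sigma(x,x)=\nu_1 b$, $\sigma(x,y)=\lambda b+\mu l$, $\sigma(y,y)=\nu_2 b$ for smooth functions $\nu_1,\nu_2,\lambda,\mu$ (with $\mu\ne0$), called here the geometric functions of the surface. The functions $f_i$. Given $\nu_1,\nu_2,\lambda,\mu$, put $$\Theta=4(\lambda^2+\mu^2)^2+(\lambda^2-2\mu^2-\nu_1\nu_2)(\nu_1-\nu_2)^2-4\lambda^2\nu_1\nu_2$$ and, where $\Theta\neq0$, $$f_1=-\tfrac1\Theta\Big[\tfrac12\big((\lambda^2+\mu^2)^2\big)_v-(\lambda^2)_v\nu_1\nu_2+2\mu^2\nu_2(\nu_1)_v+\big(\lambda^2(\nu_1)_v-\tfrac12(\mu^2)_v\nu_1-\tfrac12(\nu_1^2)_v\nu_2\big)(\nu_1-\nu_2)\Big],$$ $$f_2=\tfrac1\Theta\Big[\lambda_u(\lambda^2-\nu_1\nu_2)(\nu_1-\nu_2)+2\lambda_u\mu^2\nu_2+2\lambda^3(\nu_2)_u+\tfrac12\lambda(\mu^2)_u(\nu_1-3\nu_2)+2\lambda\mu^2(\nu_2)_u-\lambda\nu_1(\nu_2^2)_u\Big],$$ $$f_3=\tfrac1\Theta\Big[\lambda_v(\lambda^2-\nu_1\nu_2)(\nu_2-\nu_1)+2\lambda_v\mu^2\nu_1+2\lambda^3(\nu_1)_v+\tfrac12\lambda(\mu^2)_v(\nu_2-3\nu_1)+2\lambda\mu^2(\nu_1)_v-\lambda(\nu_1^2)_v\nu_2\Big],$$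 $$f_4=-\tfrac1\Theta\Big[\tfrac12\big((\lambda^2+\mu^2)^2\big)_u-(\lambda^2)_u\nu_1\nu_2+2\mu^2\nu_1(\nu_2)_u+\big(\lambda^2(\nu_2)_u-\tfrac12(\mu^2)_u\nu_2-\tfrac12\nu_1(\nu_2^2)_u\big)(\nu_2-\nu_1)\Big].$$ Canonical principal parameters. Let $z:U\to\mathbb R^4$ be a surface free of minimal points in principal parameters on an open rectangle $U$, with $\Theta\ne0$, let $(u_0,v_0)\in U$ and $c_1,c_2\in\mathbb R$. The expressions $$\Phi=\sqrt{E(u,v)}\,\exp\Big(-\int_{v_0}^v\big(f_1+f_2\tfrac{\sqrt G}{\sqrt E}\big)(u,t)\,dt-\int_{u_0}^u\big(f_3\tfrac{\sqrt E}{\sqrt G}+f_4\big)(s,v_0)\,ds+c_1\Big),$$ $$\Psi=\sqrt{G(u,v)}\,\exp\Big(-\int_{u_0}^u\big(f_3\tfrac{\sqrt E}{\sqrt G}+f_4\big)(s,v)\,ds-\int_{v_0}^v\big(f_1+f_2\tfrac{\sqrt G}{\sqrt E}\big)(u_0,t)\,dt+c_2\Big),$$ where the $f_i$ are computed from the geometric functions of the surface, depend only on $u$ and only on $v$, respectively. The parameters $(u,v)$ are called canonical principal parameters (with respect to $(u_0,v_0),c_1,c_2$) if $\Phi\equiv1$ and $\Psi\equiv1$. *)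

(* Defs.v *)
(* Standard library real numbers with Coquelicot. *)
From Stdlib Require Export Reals.
From Coquelicot Require Export Coquelicot.
Open Scope R_scope.

(* Fields of two variables are total functions [R -> R -> _]; only their values
   on the plane set under consideration matter.  All plane sets on which a
   derivative is used are open, so that derivatives depend on these values
   only. *)

Definition open_plane (D : R -> R -> Prop) : Prop :=
  open (fun p : R * R => D (fst p) (snd p)).

Definition connected_plane (D : R -> R -> Prop) : Prop :=
  forall A B : R -> R -> Prop,
    open_plane A -> open_plane B ->
    (forall u v, D u v -> A u v \/ B u v) ->
    (exists u v, D u v /\ A u v) ->
    (exists u v, D u v /\ B u v) ->
    exists u v, D u v /\ A u v /\ B u v.

Definition plane_domain (D : R -> R -> Prop) : Prop :=
  open_plane D /\ connected_plane D /\ (exists u v, D u v).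

(* The end points may be infinite. *)
Definition is_open_interval (I : R -> Prop) : Prop :=
  exists a b : Rbar, forall x, I x <-> Rbar_lt a x /\ Rbar_lt x b.

Definition rect (I J : R -> Prop) : R -> R -> Prop := fun u v => I u /\ J v.

Definition du (f : R -> R -> R) (u v : R) : R := Derive (fun s => f s v) u.
Definition dv (f : R -> R -> R) (u v : R) : R := Derive (fun t => f u t) v.

(* Class C^n on D: continuous, with all iterated partial derivatives up to
   order n existing and jointly continuous. *)
Fixpoint Cn_on (n : nat) (D : R -> R -> Prop) (f : R -> R -> R) : Prop :=
  (forall u v, D u v ->
     continuous (fun p : R * R => f (fst p) (snd p)) (u, v)) /\
  match n with
  | O => True
  | S m =>
      (forall u v, D u v ->
         ex_derive (fun s => f s v) u /\ ex_derive (fun t => f u t) v) /\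
      Cn_on m D (du f) /\ Cn_on m D (dv f)
  end.

Definition smooth_on (D : R -> R -> Prop) (f : R -> R -> R) : Prop :=
  forall n, Cn_on n D f.

(* R^4 carries the vector space operations [plus], [minus], [scal], [zero] that
   Coquelicot puts on products; Coquelicot's own norm on it is not used, the
   Euclidean structure is [dot]. *)
Definition R4 : Type := (R * R * R * R)%type.

Definition X1 (p : R4) : R := fst (fst (fst p)).
Definition X2 (p : R4) : R := snd (fst (fst p)).
Definition X3 (p : R4) : R := snd (fst p).
Definition X4 (p : R4) : R := snd p.

Definition dot (p q : R4) : R :=
  X1 p * X1 q + X2 p * X2 q + X3 p * X3 q + X4 p * X4 q.

Definition enorm (p : R4) : R := sqrt (dot p p).

Definition det2 (a b c d : R) : R := a * d - b * c.

(* Determinant of the matrix with rows p, q, r, s: Laplace expansion along the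
   first two rows. *)
Definition det4 (p q r s : R4) : R :=
    det2 (X1 p) (X2 p) (X1 q) (X2 q) * det2 (X3 r) (X4 r) (X3 s) (X4 s)
  - det2 (X1 p) (X3 p) (X1 q) (X3 q) * det2 (X2 r) (X4 r) (X2 s) (X4 s)
  + det2 (X1 p) (X4 p) (X1 q) (X4 q) * det2 (X2 r) (X3 r) (X2 s) (X3 s)
  + det2 (X2 p) (X3 p) (X2 q) (X3 q) * det2 (X1 r) (X4 r) (X1 s) (X4 s)
  - det2 (X2 p) (X4 p) (X2 q) (X4 q) * det2 (X1 r) (X3 r) (X1 s) (X3 s)
  + det2 (X3 p) (X4 p) (X3 q) (X4 q) * det2 (X1 r) (X2 r) (X1 s) (X2 s).

Definition positive_orthonormal_frame (p q r s : R4) : Prop :=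
  dot p p = 1 /\ dot q q = 1 /\ dot r r = 1 /\ dot s s = 1 /\
  dot p q = 0 /\ dot p r = 0 /\ dot p s = 0 /\
  dot q r = 0 /\ dot q s = 0 /\ dot r s = 0 /\
  0 < det4 p q r s.

(* Orientation-preserving isometry: preserves distances and sends positively
   oriented quadruples of vectors, attached at any point, to positively
   oriented ones. *)
Definition motion (T : R4 -> R4) : Prop :=
  (forall p q, enorm (minus (T p) (T q)) = enorm (minus p q)) /\
  (forall o p q r s : R4,
     0 < det4 p q r s ->
     0 < det4 (minus (T (plus o p)) (T o)) (minus (T (plus o q)) (T o))
              (minus (T (plus o r)) (T o)) (minus (T (plus o s)) (T o))).

Definition smooth4_on (D : R -> R -> Prop) (z : R -> R -> R4) : Prop :=
  smooth_on D (fun u v => X1 (z u v)) /\ smooth_on D (fun u v => X2 (z u v)) /\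
  smooth_on D (fun u v => X3 (z u v)) /\ smooth_on D (fun u v => X4 (z u v)).

Definition du4 (z : R -> R -> R4) (u v : R) : R4 :=
  (du (fun s t => X1 (z s t)) u v, du (fun s t => X2 (z s t)) u v,
   du (fun s t => X3 (z s t)) u v, du (fun s t => X4 (z s t)) u v).

Definition dv4 (z : R -> R -> R4) (u v : R) : R4 :=
  (dv (fun s t => X1 (z s t)) u v, dv (fun s t => X2 (z s t)) u v,
   dv (fun s t => X3 (z s t)) u v, dv (fun s t => X4 (z s t)) u v).

Definition is_surface (D : R -> R -> Prop) (z : R -> R -> R4) : Prop :=
  smooth4_on D z /\
  (forall u v, D u v -> forall a b : R,
     plus (scal a (du4 z u v)) (scal b (dv4 z u v)) = (zero : R4) ->
     a = 0 /\ b = 0).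

Definition formE (z : R -> R -> R4) u v : R := dot (du4 z u v) (du4 z u v).
Definition formF (z : R -> R -> R4) u v : R := dot (du4 z u v) (dv4 z u v).
Definition formG (z : R -> R -> R4) u v : R := dot (dv4 z u v) (dv4 z u v).
Definition formW (z : R -> R -> R4) u v : R :=
  formE z u v * formG z u v - formF z u v ^ 2.

(* [w] minus its orthogonal projection to the span of z_u and z_v. *)
Definition normal_part (z : R -> R -> R4) (u v : R) (w : R4) : R4 :=
  let wu := dot w (du4 z u v) in
  let wv := dot w (dv4 z u v) in
  minus w
    (plus
      (scal ((formG z u v * wu - formF z u v * wv) / formW z u v) (du4 z u v))
      (scal ((formE z u v * wv - formF z u v * wu) / formW z u v) (dv4 z u v))).

(* Second fundamental tensor; the tangent vector a z_u + b z_v is given by its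
   coordinates (a, b). *)
Definition sff (z : R -> R -> R4) (u v : R) (X Y : R * R) : R4 :=
  normal_part z u v
    (plus
      (plus (scal (fst X * fst Y) (du4 (du4 z) u v))
            (scal (fst X * snd Y + snd X * fst Y) (dv4 (du4 z) u v)))
      (scal (snd X * snd Y) (dv4 (dv4 z) u v))).

Definition e_u : R * R := (1, 0).
Definition e_v : R * R := (0, 1).

Definition normal_frame (D : R -> R -> Prop) (z n1 n2 : R -> R -> R4) : Prop :=
  smooth4_on D n1 /\ smooth4_on D n2 /\
  (forall u v, D u v ->
     dot (n1 u v) (du4 z u v) = 0 /\ dot (n1 u v) (dv4 z u v) = 0 /\
     dot (n2 u v) (du4 z u v) = 0 /\ dot (n2 u v) (dv4 z u v) = 0 /\
     dot (n1 u v) (n1 u v) = 1 /\ dot (n2 u v) (n2 u v) = 1 /\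
     dot (n1 u v) (n2 u v) = 0).

Definition formL (z n1 n2 : R -> R -> R4) (u v : R) : R :=
  let c11 n := dot (sff z u v e_u e_u) (n u v) in
  let c12 n := dot (sff z u v e_u e_v) (n u v) in
  2 / sqrt (formW z u v) * (c11 n1 * c12 n2 - c11 n2 * c12 n1).

Definition formM (z n1 n2 : R -> R -> R4) (u v : R) : R :=
  let c11 n := dot (sff z u v e_u e_u) (n u v) in
  let c22 n := dot (sff z u v e_v e_v) (n u v) in
  1 / sqrt (formW z u v) * (c11 n1 * c22 n2 - c11 n2 * c22 n1).

Definition formN (z n1 n2 : R -> R -> R4) (u v : R) : R :=
  let c12 n := dot (sff z u v e_u e_v) (n u v) in
  let c22 n := dot (sff z u v e_v e_v) (n u v) in
  2 / sqrt (formW z u v) * (c12 n1 * c22 n2 - c12 n2 * c22 n1).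

Definition inv_k (z n1 n2 : R -> R -> R4) (u v : R) : R :=
  (formL z n1 n2 u v * formN z n1 n2 u v - formM z n1 n2 u v ^ 2)
  / formW z u v.

Definition inv_kappa (z n1 n2 : R -> R -> R4) (u v : R) : R :=
  (formE z u v * formN z n1 n2 u v - 2 * formF z u v * formM z n1 n2 u v
   + formG z u v * formL z n1 n2 u v)
  / (2 * formW z u v).

(* L, M, N only depend on the frame through a common sign, so neither of the
   next two predicates depends on the choice of the frame. *)
Definition free_of_minimal_points
    (D : R -> R -> Prop) (z : R -> R -> R4) : Prop :=
  exists n1 n2, normal_frame D z n1 n2 /\
    forall u v, D u v -> inv_kappa z n1 n2 u v ^ 2 - inv_k z n1 n2 u v > 0.

Definition principal_parameters
    (D : R -> R -> Prop) (z : R -> R -> R4) : Prop :=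
  exists n1 n2, normal_frame D z n1 n2 /\
    forall u v, D u v -> formF z u v = 0 /\ formM z n1 n2 u v = 0.

(* Half of the trace of sff with respect to the first fundamental form. *)
Definition mean_curvature (z : R -> R -> R4) (u v : R) : R4 :=
  scal (/ (2 * formW z u v))
    (plus
      (minus (scal (formG z u v) (sff z u v e_u e_u))
             (scal (2 * formF z u v) (sff z u v e_u e_v)))
      (scal (formE z u v) (sff z u v e_v e_v))).

Definition has_geometric_functions (D : R -> R -> Prop) (z : R -> R -> R4)
    (nu1 nu2 lam mu : R -> R -> R) : Prop :=
  is_surface D z /\ free_of_minimal_points D z /\ principal_parameters D z /\
  exists l : R -> R -> R4, smooth4_on D l /\
    forall u v, D u v ->
      let x : R * R := (/ sqrt (formE z u v), 0) in
      let y : R * R := (0, / sqrt (formG z u v)) in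
      let H := mean_curvature z u v in
      let b : R4 := scal (/ enorm H) H in
      positive_orthonormal_frame
        (scal (/ sqrt (formE z u v)) (du4 z u v))
        (scal (/ sqrt (formG z u v)) (dv4 z u v)) b (l u v) /\
      sff z u v x x = scal (nu1 u v) b /\
      sff z u v x y = plus (scal (lam u v) b) (scal (mu u v) (l u v)) /\
      sff z u v y y = scal (nu2 u v) b.

Definition Theta (nu1 nu2 lam mu : R -> R -> R) (u v : R) : R :=
  4 * (lam u v ^ 2 + mu u v ^ 2) ^ 2
  + (lam u v ^ 2 - 2 * mu u v ^ 2 - nu1 u v * nu2 u v)
    * (nu1 u v - nu2 u v) ^ 2
  - 4 * lam u v ^ 2 * nu1 u v * nu2 u v.

Definition sq (f : R -> R -> R) (u v : R) : R := f u v ^ 2.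

Definition f1 (nu1 nu2 lam mu : R -> R -> R) (u v : R) : R :=
  - (1 / Theta nu1 nu2 lam mu u v) *
  (1 / 2 * dv (fun s t => (lam s t ^ 2 + mu s t ^ 2) ^ 2) u v
   - dv (sq lam) u v * nu1 u v * nu2 u v
   + 2 * mu u v ^ 2 * nu2 u v * dv nu1 u v
   + (lam u v ^ 2 * dv nu1 u v - 1 / 2 * dv (sq mu) u v * nu1 u v
      - 1 / 2 * dv (sq nu1) u v * nu2 u v)
     * (nu1 u v - nu2 u v)).

Definition f2 (nu1 nu2 lam mu : R -> R -> R) (u v : R) : R :=
  1 / Theta nu1 nu2 lam mu u v *
  (du lam u v * (lam u v ^ 2 - nu1 u v * nu2 u v) * (nu1 u v - nu2 u v)
   + 2 * du lam u v * mu u v ^ 2 * nu2 u v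
   + 2 * lam u v ^ 3 * du nu2 u v
   + 1 / 2 * lam u v * du (sq mu) u v * (nu1 u v - 3 * nu2 u v)
   + 2 * lam u v * mu u v ^ 2 * du nu2 u v
   - lam u v * nu1 u v * du (sq nu2) u v).

Definition f3 (nu1 nu2 lam mu : R -> R -> R) (u v : R) : R :=
  1 / Theta nu1 nu2 lam mu u v *
  (dv lam u v * (lam u v ^ 2 - nu1 u v * nu2 u v) * (nu2 u v - nu1 u v)
   + 2 * dv lam u v * mu u v ^ 2 * nu1 u v
   + 2 * lam u v ^ 3 * dv nu1 u v
   + 1 / 2 * lam u v * dv (sq mu) u v * (nu2 u v - 3 * nu1 u v)
   + 2 * lam u v * mu u v ^ 2 * dv nu1 u v
   - lam u v * dv (sq nu1) u v * nu2 u v).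

Definition f4 (nu1 nu2 lam mu : R -> R -> R) (u v : R) : R :=
  - (1 / Theta nu1 nu2 lam mu u v) *
  (1 / 2 * du (fun s t => (lam s t ^ 2 + mu s t ^ 2) ^ 2) u v
   - du (sq lam) u v * nu1 u v * nu2 u v
   + 2 * mu u v ^ 2 * nu1 u v * du nu2 u v
   + (lam u v ^ 2 * du nu2 u v - 1 / 2 * du (sq mu) u v * nu2 u v
      - 1 / 2 * nu1 u v * du (sq nu2) u v)
     * (nu2 u v - nu1 u v)).

Definition f12 (z : R -> R -> R4) (nu1 nu2 lam mu : R -> R -> R) (u v : R) : R :=
  f1 nu1 nu2 lam mu u v
  + f2 nu1 nu2 lam mu u v * (sqrt (formG z u v) / sqrt (formE z u v)).

Definition f34 (z : R -> R -> R4) (nu1 nu2 lam mu : R -> R -> R) (u v : R) : R :=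
  f3 nu1 nu2 lam mu u v * (sqrt (formE z u v) / sqrt (formG z u v))
  + f4 nu1 nu2 lam mu u v.

Definition Phi (z : R -> R -> R4) (nu1 nu2 lam mu : R -> R -> R)
    (u0 v0 c1 : R) (u v : R) : R :=
  sqrt (formE z u v) *
  exp (- RInt (fun t => f12 z nu1 nu2 lam mu u t) v0 v
       - RInt (fun s => f34 z nu1 nu2 lam mu s v0) u0 u + c1).

Definition Psi (z : R -> R -> R4) (nu1 nu2 lam mu : R -> R -> R)
    (u0 v0 c2 : R) (u v : R) : R :=
  sqrt (formG z u v) *
  exp (- RInt (fun s => f34 z nu1 nu2 lam mu s v) u0 u
       - RInt (fun t => f12 z nu1 nu2 lam mu u0 t) v0 v + c2).

(* The geometric functions of the surface are an argument because Phi and Psi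
   are computed from them; they are determined by [z] on [D]. *)
Definition canonical_principal_parameters
    (D : R -> R -> Prop) (z : R -> R -> R4) (nu1 nu2 lam mu : R -> R -> R)
    (u0 v0 c1 c2 : R) : Prop :=
  has_geometric_functions D z nu1 nu2 lam mu /\
  forall u v, D u v ->
    Theta nu1 nu2 lam mu u v <> 0 /\
    Phi z nu1 nu2 lam mu u0 v0 c1 u v = 1 /\
    Psi z nu1 nu2 lam mu u0 v0 c2 u v = 1.

(* Main.v *)
Require Import Defs.
From Stdlib Require Import Reals Ranalysis5 Lra Lia.
From Coquelicot Require Import Coquelicot.
Open Scope R_scope.

(** The theorem is of Bonnet type: a surface without minimal points is determined
    by its moving frame, and the frame solves a linear system whose coefficients
    are built from [nu1, nu2, lam, mu] and from [phi = sqrt E], [psi = sqrt G].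

    The frame.  Write [x, y, b, l] for the frame of a surface.  From
    [z_u = phi x], [z_v = psi y] and the prescribed second fundamental tensor, all
    coefficients of the derivatives of the frame are determined except the two
    normal connection coefficients [b_u . l] and [b_v . l].  The equality of the
    mixed derivatives of [x] and of [y], taken in the direction of [b], gives these
    two as well, because [mu] does not vanish ([normal_connection]).  So the frame
    solves [W_u = A W], [W_v = B W] with skew matrices [A] ([conn_u]) and [B]
    ([conn_v]) that do not depend on the surface.

    Existence.  Such a pair of systems is solvable when
    [A_v + A B = B_u + B A] ([flat_solution_derive_u]).  Of the six independent
    entries of this equation two are the definition of the normal connection, two
    are the hypotheses of Gauss and Ricci type, and the remaining two Codazzi
    equations are linear in [phi_v], [psi_u]; the functions [f_1, ..., f_4] are
    exactly their solution ([codazzi_algebra], [conn_flat]).  The solution is built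
    by Picard iteration along the line [v = v0] and then along every vertical line;
    that it solves the equation in [u] everywhere follows from Gronwall's inequality
    for the defect of the first-order expansion in [u], which by flatness satisfies
    the equation in [v] up to a source of higher order.  Skewness keeps the frame
    orthonormal and positively oriented, and the closed form [phi x du + psi y dv]
    integrates to the surface ([surface_of_moving_frame]).

    The parameters are canonical because the integrands in [Phi] and [Psi] are the
    logarithmic derivatives of [phi] and [psi], the initial data having been chosen
    so that [phi = c psi] on both lines [u = u0] and [v = v0]
    ([solution_canonical]).

    Uniqueness.  For any surface with these canonical parameters [sqrt E] and
    [sqrt G] solve the same Cauchy problem as [phi] and [psi]
    ([canonical_solution]), and the solution of this Goursat problem is unique
    ([goursat_unique]).  Hence two such surfaces have frames [W], [W'] with the same
    coefficients; then [W^T W'] is constant, which means that a fixed rotation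
    carries one frame to the other, and the corresponding motion carries one
    surface to the other ([congruent_surfaces]). *)

(** * Smooth functions on open plane sets *)

Lemma derive_plus (f g : R -> R) x (a b : R) :
  is_derive f x a -> is_derive g x b -> is_derive (fun t => f t + g t) x (a + b).
Proof. exact (is_derive_plus (K := R_AbsRing) (V := R_NormedModule) f g x a b). Qed.

Lemma derive_minus (f g : R -> R) x (a b : R) :
  is_derive f x a -> is_derive g x b -> is_derive (fun t => f t - g t) x (a - b).
Proof. exact (is_derive_minus (K := R_AbsRing) (V := R_NormedModule) f g x a b). Qed.

Lemma derive_mult (f g : R -> R) x (a b : R) :
  is_derive f x a -> is_derive g x b ->
  is_derive (fun t => f t * g t) x (a * g x + f x * b).
Proof.
  intros Hf Hg. exact (is_derive_mult (K := R_AbsRing) f g x a b Hf Hg Rmult_comm).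
Qed.

Lemma derive_const (c x : R) : is_derive (fun _ : R => c) x 0.
Proof. exact (is_derive_const (K := R_AbsRing) (V := R_NormedModule) c x). Qed.

Definition cont2_on (D : R -> R -> Prop) (f : R -> R -> R) : Prop :=
  forall u v, D u v -> continuous (fun p : R * R => f (fst p) (snd p)) (u, v).

Lemma open_plane_locally_2d D u v :
  open_plane D -> D u v -> locally_2d D u v.
Proof.
  intros HD Huv. apply locally_2d_locally. exact (HD (u, v) Huv).
Qed.

Lemma open_plane_locally_u D u v :
  open_plane D -> D u v -> locally u (fun s => D s v).
Proof.
  intros HD Huv.
  apply (locally_2d_1d_const_y D). now apply open_plane_locally_2d.
Qed.

Lemma open_plane_locally_v D u v :
  open_plane D -> D u v -> locally v (fun t => D u t).
Proof.
  intros HD Huv.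
  apply (locally_2d_1d_const_x D). now apply open_plane_locally_2d.
Qed.

Lemma cont2_continuity_2d_pt D f u v :
  cont2_on D f -> D u v -> continuity_2d_pt f u v.
Proof.
  intros Hf Huv. apply continuity_2d_pt_filterlim. exact (Hf u v Huv).
Qed.

Lemma cont2_continuous_u D f u v :
  cont2_on D f -> D u v -> continuous (fun s => f s v) u.
Proof.
  intros Hf Huv.
  apply (continuous_comp_2 (fun s : R => s) (fun _ : R => v) f).
  - apply continuous_id.
  - apply continuous_const.
  - exact (Hf u v Huv).
Qed.

Lemma cont2_continuous_v D f u v :
  cont2_on D f -> D u v -> continuous (fun t => f u t) v.
Proof.
  intros Hf Huv.
  apply (continuous_comp_2 (fun _ : R => u) (fun t : R => t) f).
  - apply continuous_const.
  - apply continuous_id.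
  - exact (Hf u v Huv).
Qed.

Lemma cont2_plus D f g :
  cont2_on D f -> cont2_on D g -> cont2_on D (fun u v => f u v + g u v).
Proof.
  intros Hf Hg u v Huv.
  exact (continuous_plus (V := R_NormedModule) _ _ _ (Hf u v Huv) (Hg u v Huv)).
Qed.

Lemma cont2_mult D f g :
  cont2_on D f -> cont2_on D g -> cont2_on D (fun u v => f u v * g u v).
Proof.
  intros Hf Hg u v Huv.
  exact (continuous_mult (K := R_AbsRing) _ _ _ (Hf u v Huv) (Hg u v Huv)).
Qed.

Lemma cont2_inv D f :
  (forall u v, D u v -> f u v <> 0) ->
  cont2_on D f -> cont2_on D (fun u v => / f u v).
Proof.
  intros H0 Hf u v Huv.
  apply (continuous_comp (fun p : R * R => f (fst p) (snd p)) Rinv).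
  - exact (Hf u v Huv).
  - apply continuous_Rinv. exact (H0 u v Huv).
Qed.

Lemma cont2_const D c : cont2_on D (fun _ _ => c).
Proof. intros u v _. apply continuous_const. Qed.

Lemma cont2_ext D f g :
  open_plane D -> (forall u v, D u v -> f u v = g u v) ->
  cont2_on D f -> cont2_on D g.
Proof.
  intros HD Hfg Hf u v Huv.
  apply (continuous_ext_loc _ (fun p : R * R => f (fst p) (snd p))).
  - generalize (HD (u, v) Huv). apply filter_imp.
    intros [s t] Hst. exact (Hfg s t Hst).
  - exact (Hf u v Huv).
Qed.

Lemma du_ext D f g u v :
  open_plane D -> (forall s t, D s t -> f s t = g s t) -> D u v ->
  du f u v = du g u v.
Proof.
  intros HD Hfg Huv. apply Derive_ext_loc.
  generalize (open_plane_locally_u D u v HD Huv). apply filter_imp.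
  intros s Hs. now apply Hfg.
Qed.

Lemma dv_ext D f g u v :
  open_plane D -> (forall s t, D s t -> f s t = g s t) -> D u v ->
  dv f u v = dv g u v.
Proof.
  intros HD Hfg Huv. apply Derive_ext_loc.
  generalize (open_plane_locally_v D u v HD Huv). apply filter_imp.
  intros t Ht. now apply Hfg.
Qed.

Lemma is_derive_u_ext D f g u v (l : R) :
  open_plane D -> (forall s t, D s t -> f s t = g s t) -> D u v ->
  is_derive (fun s => f s v) u l -> is_derive (fun s => g s v) u l.
Proof.
  intros HD Hfg Huv. apply is_derive_ext_loc.
  generalize (open_plane_locally_u D u v HD Huv). apply filter_imp.
  intros s Hs. now apply Hfg.
Qed.

Lemma is_derive_v_ext D f g u v (l : R) :
  open_plane D -> (forall s t, D s t -> f s t = g s t) -> D u v ->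
  is_derive (fun t => f u t) v l -> is_derive (fun t => g u t) v l.
Proof.
  intros HD Hfg Huv. apply is_derive_ext_loc.
  generalize (open_plane_locally_v D u v HD Huv). apply filter_imp.
  intros t Ht. now apply Hfg.
Qed.

Lemma Cn_cont2 n D f : Cn_on n D f -> cont2_on D f.
Proof. destruct n; intros H; exact (proj1 H). Qed.

Lemma Cn_ext n D : open_plane D -> forall f g,
  (forall u v, D u v -> f u v = g u v) -> Cn_on n D f -> Cn_on n D g.
Proof.
  intros HD. induction n as [|n IH]; intros f g Hfg [Hc H].
  - split; [|exact I]. exact (cont2_ext D f g HD Hfg Hc).
  - destruct H as (He & Hu & Hv). split; [|split; [|split]].
    + exact (cont2_ext D f g HD Hfg Hc).
    + intros u v Huv. destruct (He u v Huv) as [[lu Hlu] [lv Hlv]]. split.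
      * exists lu. now apply (is_derive_u_ext D f g).
      * exists lv. now apply (is_derive_v_ext D f g).
    + apply (IH (du f)); [|exact Hu].
      intros u v Huv. now apply (du_ext D).
    + apply (IH (dv f)); [|exact Hv].
      intros u v Huv. now apply (dv_ext D).
Qed.

(** Regularity is proved below by exhibiting the partial derivatives and by
    induction on [n], so that iterated derivatives are never computed. *)
Lemma Cn_intro n D f fu fv :
  open_plane D -> cont2_on D f ->
  (forall u v, D u v -> is_derive (fun s => f s v) u (fu u v)) ->
  (forall u v, D u v -> is_derive (fun t => f u t) v (fv u v)) ->
  Cn_on n D fu -> Cn_on n D fv -> Cn_on (S n) D f.
Proof.
  intros HD Hc Hu Hv Hfu Hfv. split; [|split; [|split]].
  - exact Hc.
  - intros u v Huv. split.
    + exists (fu u v). exact (Hu u v Huv).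
    + exists (fv u v). exact (Hv u v Huv).
  - apply (Cn_ext n D HD fu); [|exact Hfu].
    intros u v Huv. symmetry. apply is_derive_unique. exact (Hu u v Huv).
  - apply (Cn_ext n D HD fv); [|exact Hfv].
    intros u v Huv. symmetry. apply is_derive_unique. exact (Hv u v Huv).
Qed.

Lemma Cn_is_derive_u n D f u v :
  Cn_on (S n) D f -> D u v -> is_derive (fun s => f s v) u (du f u v).
Proof.
  intros (_ & He & _) Huv. apply Derive_correct. exact (proj1 (He u v Huv)).
Qed.

Lemma Cn_is_derive_v n D f u v :
  Cn_on (S n) D f -> D u v -> is_derive (fun t => f u t) v (dv f u v).
Proof.
  intros (_ & He & _) Huv. apply Derive_correct. exact (proj2 (He u v Huv)).
Qed.

Lemma Cn_S n D f : Cn_on (S n) D f -> Cn_on n D f.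
Proof.
  revert f. induction n as [|n IH]; intros f (Hc & He & Hu & Hv).
  - now split.
  - split; [exact Hc|]. split; [exact He|]. split; now apply IH.
Qed.

Lemma Cn_const n D c : open_plane D -> Cn_on n D (fun _ _ => c).
Proof.
  intros HD. revert c. induction n as [|n IH]; intros c.
  - split; [|exact I]. apply cont2_const.
  - apply (Cn_intro n D _ (fun _ _ => 0) (fun _ _ => 0)); trivial.
    + apply cont2_const.
    + intros u v _. apply (derive_const c u).
    + intros u v _. apply (derive_const c v).
Qed.

Lemma Cn_plus n D f g : open_plane D ->
  Cn_on n D f -> Cn_on n D g -> Cn_on n D (fun u v => f u v + g u v).
Proof.
  intros HD. revert f g. induction n as [|n IH]; intros f g Hf Hg.
  - split; [|exact I]. apply cont2_plus; [exact (proj1 Hf)|exact (proj1 Hg)].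
  - apply (Cn_intro n D _ (fun u v => du f u v + du g u v)
             (fun u v => dv f u v + dv g u v)); trivial.
    + apply cont2_plus; [exact (proj1 Hf)|exact (proj1 Hg)].
    + intros u v Huv.
      apply (derive_plus);
        now apply (Cn_is_derive_u n D).
    + intros u v Huv.
      apply (derive_plus);
        now apply (Cn_is_derive_v n D).
    + apply IH; [apply Hf|apply Hg].
    + apply IH; [apply Hf|apply Hg].
Qed.

Lemma Cn_mult n D f g : open_plane D ->
  Cn_on n D f -> Cn_on n D g -> Cn_on n D (fun u v => f u v * g u v).
Proof.
  intros HD. revert f g. induction n as [|n IH]; intros f g Hf Hg.
  - split; [|exact I]. apply cont2_mult; [exact (proj1 Hf)|exact (proj1 Hg)].
  - apply (Cn_intro n D _ (fun u v => du f u v * g u v + f u v * du g u v)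
             (fun u v => dv f u v * g u v + f u v * dv g u v)); trivial.
    + apply cont2_mult; [exact (proj1 Hf)|exact (proj1 Hg)].
    + intros u v Huv.
      apply (derive_mult (fun s => f s v) (fun s => g s v)).
      * now apply (Cn_is_derive_u n D).
      * now apply (Cn_is_derive_u n D).
    + intros u v Huv.
      apply (derive_mult (fun t => f u t) (fun t => g u t)).
      * now apply (Cn_is_derive_v n D).
      * now apply (Cn_is_derive_v n D).
    + apply Cn_plus; trivial; apply IH;
        (apply Cn_S; assumption) || apply Hf || apply Hg.
    + apply Cn_plus; trivial; apply IH;
        (apply Cn_S; assumption) || apply Hf || apply Hg.
Qed.

Lemma Cn_inv n D f : open_plane D -> (forall u v, D u v -> f u v <> 0) ->
  Cn_on n D f -> Cn_on n D (fun u v => / f u v).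
Proof.
  intros HD H0. induction n as [|n IH]; intros Hf.
  - split; [|exact I]. apply cont2_inv; [exact H0|exact (proj1 Hf)].
  - assert (Hi := IH (Cn_S _ _ _ Hf)).
    apply (Cn_intro n D _
             (fun u v => (- 1) * (du f u v * (/ f u v * / f u v)))
             (fun u v => (- 1) * (dv f u v * (/ f u v * / f u v)))); trivial.
    + apply cont2_inv; [exact H0|exact (proj1 Hf)].
    + intros u v Huv.
      evar_last.
      { apply (is_derive_inv (fun s => f s v) u).
        - now apply (Cn_is_derive_u n D).
        - now apply H0. }
      cbv beta. specialize (H0 u v Huv). field. exact H0.
    + intros u v Huv.
      evar_last.
      { apply (is_derive_inv (fun t => f u t) v).
        - now apply (Cn_is_derive_v n D).
        - now apply H0. }
      cbv beta. specialize (H0 u v Huv). field. exact H0.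
    + repeat (apply Cn_mult; trivial).
      * now apply Cn_const.
      * apply Hf.
    + repeat (apply Cn_mult; trivial).
      * now apply Cn_const.
      * apply Hf.
Qed.

Lemma smooth_cont2 D f : smooth_on D f -> cont2_on D f.
Proof. intros H. exact (Cn_cont2 0 D f (H 0%nat)). Qed.

Lemma smooth_du D f : smooth_on D f -> smooth_on D (du f).
Proof. intros H n. apply (H (S n)). Qed.

Lemma smooth_dv D f : smooth_on D f -> smooth_on D (dv f).
Proof. intros H n. apply (H (S n)). Qed.

Lemma smooth_is_derive_u D f u v :
  smooth_on D f -> D u v -> is_derive (fun s => f s v) u (du f u v).
Proof. intros H. exact (Cn_is_derive_u 0 D f u v (H 1%nat)). Qed.

Lemma smooth_is_derive_v D f u v :
  smooth_on D f -> D u v -> is_derive (fun t => f u t) v (dv f u v).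
Proof. intros H. exact (Cn_is_derive_v 0 D f u v (H 1%nat)). Qed.

Lemma smooth_ext D f g : open_plane D ->
  (forall u v, D u v -> f u v = g u v) -> smooth_on D f -> smooth_on D g.
Proof. intros HD Hfg Hf n. now apply (Cn_ext n D HD f). Qed.

Lemma smooth_sub (D U : R -> R -> Prop) f :
  (forall u v, U u v -> D u v) -> smooth_on D f -> smooth_on U f.
Proof.
  intros HU Hf n. generalize (Hf n). clear Hf. revert f.
  induction n as [|n IH]; intros f.
  - intros [Hc _]. split; [|exact I]. intros u v Huv. apply Hc. now apply HU.
  - intros (Hc & He & Hu & Hv). split; [|split; [|split]].
    + intros u v Huv. apply Hc. now apply HU.
    + intros u v Huv. apply He. now apply HU.
    + now apply IH.
    + now apply IH.
Qed.

Lemma smooth_const D c : open_plane D -> smooth_on D (fun _ _ => c).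
Proof. intros HD n. now apply Cn_const. Qed.

Lemma smooth_plus D f g : open_plane D ->
  smooth_on D f -> smooth_on D g -> smooth_on D (fun u v => f u v + g u v).
Proof. intros HD Hf Hg n. now apply Cn_plus. Qed.

Lemma smooth_mult D f g : open_plane D ->
  smooth_on D f -> smooth_on D g -> smooth_on D (fun u v => f u v * g u v).
Proof. intros HD Hf Hg n. now apply Cn_mult. Qed.

Lemma smooth_opp D f : open_plane D ->
  smooth_on D f -> smooth_on D (fun u v => - f u v).
Proof.
  intros HD Hf. apply (smooth_ext D (fun u v => (- 1) * f u v)); trivial.
  - intros u v _. ring.
  - apply smooth_mult; trivial. now apply smooth_const.
Qed.

Lemma smooth_minus D f g : open_plane D ->
  smooth_on D f -> smooth_on D g -> smooth_on D (fun u v => f u v - g u v).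
Proof.
  intros HD Hf Hg. apply (smooth_plus D f (fun u v => - g u v)); trivial.
  now apply smooth_opp.
Qed.

Lemma smooth_inv D f : open_plane D -> (forall u v, D u v -> f u v <> 0) ->
  smooth_on D f -> smooth_on D (fun u v => / f u v).
Proof. intros HD H0 Hf n. now apply Cn_inv. Qed.

Lemma smooth_div D f g : open_plane D -> (forall u v, D u v -> g u v <> 0) ->
  smooth_on D f -> smooth_on D g -> smooth_on D (fun u v => f u v / g u v).
Proof.
  intros HD H0 Hf Hg. apply (smooth_mult D f (fun u v => / g u v)); trivial.
  now apply smooth_inv.
Qed.

Lemma smooth_pow D f k : open_plane D ->
  smooth_on D f -> smooth_on D (fun u v => f u v ^ k).
Proof.
  intros HD Hf. induction k as [|k IH].
  - apply (smooth_const D 1 HD).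
  - apply (smooth_mult D f (fun u v => f u v ^ k)); trivial.
Qed.

Ltac smooth :=
  repeat match goal with
  | H : smooth_on ?D ?f |- smooth_on ?D ?f => exact H
  | |- smooth_on _ (fun u v => ?f u v) => change (smooth_on _ f); try assumption
  | |- smooth_on _ (fun u v => _ + _) => apply smooth_plus; [assumption| |]
  | |- smooth_on _ (fun u v => _ - _) => apply smooth_minus; [assumption| |]
  | |- smooth_on _ (fun u v => _ * _) => apply smooth_mult; [assumption| |]
  | |- smooth_on _ (fun u v => - _) => apply smooth_opp; [assumption|]
  | |- smooth_on _ (fun u v => _ / _) => apply smooth_div; [assumption| | |]
  | |- smooth_on _ (fun u v => / _) => apply smooth_inv; [assumption| |]
  | |- smooth_on _ (fun u v => _ ^ _) => apply smooth_pow; [assumption|]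
  | |- smooth_on _ (fun u v => ?c) => apply smooth_const; assumption
  | |- smooth_on _ (du _) => apply smooth_du
  | |- smooth_on _ (dv _) => apply smooth_dv
  | |- smooth_on _ (sq _) => unfold sq
  end.

Lemma smooth_schwarz D f u v : open_plane D -> smooth_on D f -> D u v ->
  dv (du f) u v = du (dv f) u v.
Proof.
  intros HD Hf Huv. symmetry.
  apply (Schwarz f u v).
  - generalize (open_plane_locally_2d D u v HD Huv).
    intros [d Hd]. exists d. intros s t Hs Ht. specialize (Hd s t Hs Ht).
    split; [|split; [|split]].
    + exists (du f s t). now apply (smooth_is_derive_u D).
    + exists (dv f s t). now apply (smooth_is_derive_v D).
    + exists (du (dv f) s t). apply (smooth_is_derive_u D (dv f)); trivial.
      now apply smooth_dv.
    + exists (dv (du f) s t). apply (smooth_is_derive_v D (du f)); trivial.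
      now apply smooth_du.
  - apply (cont2_continuity_2d_pt D (du (dv f))); trivial.
    apply smooth_cont2. smooth.
  - apply (cont2_continuity_2d_pt D (dv (du f))); trivial.
    apply smooth_cont2. smooth.
Qed.

(** * Differential inequalities on an interval *)

Definition between (a x t : R) : Prop := Rmin a x <= t <= Rmax a x.

Lemma between_start a x : between a x a.
Proof. split; [apply Rmin_l|apply Rmax_l]. Qed.

Lemma between_end a x : between a x x.
Proof. split; [apply Rmin_r|apply Rmax_r]. Qed.

Lemma between_trans a x t s : between a x t -> between a t s -> between a x s.
Proof.
  unfold between, Rmin, Rmax.
  destruct (Rle_dec a x); destruct (Rle_dec a t); lra.
Qed.

Lemma between_le a x t : a <= x -> between a x t -> a <= t <= x.
Proof. intros H. unfold between. rewrite Rmin_left, Rmax_right; trivial. Qed.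

Lemma between_ge a x t : x <= a -> between a x t -> x <= t <= a.
Proof. intros H. unfold between. rewrite Rmin_right, Rmax_left; trivial. Qed.

Lemma between_abs a x t : between a x t -> Rabs (t - a) <= Rabs (x - a).
Proof.
  destruct (Rle_or_lt a x) as [H|H]; intros Ht.
  - apply between_le in Ht; trivial. rewrite !Rabs_right; lra.
  - apply between_ge in Ht; [|lra]. rewrite !Rabs_left1; lra.
Qed.

Lemma open_interval_between I a x t :
  is_open_interval I -> I a -> I x -> between a x t -> I t.
Proof.
  intros (l & r & H) Ha Hx Ht. apply H. apply H in Ha. apply H in Hx.
  destruct (Rle_or_lt a x) as [L|L].
  - apply between_le in Ht; trivial. split.
    + apply Rbar_lt_le_trans with a; [apply Ha|]. simpl; lra.
    + apply Rbar_le_lt_trans with x; [simpl; lra|apply Hx].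
  - apply between_ge in Ht; [|lra]. split.
    + apply Rbar_lt_le_trans with x; [apply Hx|]. simpl; lra.
    + apply Rbar_le_lt_trans with a; [simpl; lra|apply Ha].
Qed.

Lemma open_interval_open I x : is_open_interval I -> I x -> locally x I.
Proof.
  intros (l & r & H) Hx. apply H in Hx.
  apply (locally_interval _ _ l r); try apply Hx.
  intros y Hl Hr. now apply H.
Qed.

Lemma rect_open I J :
  is_open_interval I -> is_open_interval J -> open_plane (rect I J).
Proof.
  intros HI HJ [u v] [Hu Hv].
  apply (locally_2d_locally (rect I J)).
  destruct (open_interval_open I u HI Hu) as [d1 H1].
  destruct (open_interval_open J v HJ Hv) as [d2 H2].
  assert (Hd : 0 < Rmin d1 d2) by (apply Rmin_pos; apply cond_pos).
  exists (mkposreal _ Hd). simpl. intros s t Hs Ht. split.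
  - apply H1. apply Rlt_le_trans with (1 := Hs). apply Rmin_l.
  - apply H2. apply Rlt_le_trans with (1 := Ht). apply Rmin_r.
Qed.

Lemma derive_continuity_pt (f : R -> R) t (l : R) :
  is_derive f t l -> continuity_pt f t.
Proof.
  intros H. apply continuity_pt_filterlim.
  apply (ex_derive_continuous (K := R_AbsRing) (V := R_NormedModule)).
  now exists l.
Qed.

Lemma derive_nonneg_le (h h' : R -> R) a x : a <= x ->
  (forall t, a <= t <= x -> is_derive h t (h' t)) ->
  (forall t, a <= t <= x -> 0 <= h' t) -> h a <= h x.
Proof.
  intros Hax Hd Hp.
  destruct (MVT_gen h a x h') as (c & Hc & He).
  - intros t. rewrite Rmin_left, Rmax_right by trivial.
    intros Ht. apply Hd. lra.
  - intros t. rewrite Rmin_left, Rmax_right by trivial.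
    intros Ht. apply (derive_continuity_pt h t (h' t)). now apply Hd.
  - rewrite Rmin_left, Rmax_right in Hc by trivial.
    specialize (Hp c Hc).
    assert (0 <= h' c * (x - a)) by (apply Rmult_le_pos; lra). lra.
Qed.

Lemma derive_zero_const (f : R -> R) a x :
  (forall t, between a x t -> is_derive f t 0) -> f x = f a.
Proof.
  intros Hd. destruct (MVT_gen f a x (fun _ => 0)) as (c & _ & He).
  - intros t Ht. apply Hd. unfold between. lra.
  - intros t Ht. apply (derive_continuity_pt f t 0). now apply Hd.
  - lra.
Qed.

Lemma is_derive_reflect (f : R -> R) a t (l : R) :
  is_derive f (2 * a - t) l -> is_derive (fun s => f (2 * a - s)) t (- l).
Proof.
  intros H.
  assert (Hr : is_derive (fun s : R => 2 * a - s) t (- 1)).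
  { auto_derive; trivial; lra. }
  evar_last.
  - exact (is_derive_comp (K := R_AbsRing) (V := R_NormedModule) f
             (fun s => 2 * a - s) t l (- 1) H Hr).
  - change (@eq R (- 1 * l) (- l)). ring.
Qed.

Lemma is_derive_exp_weight k a C t :
  is_derive (fun s => C * exp (k * (s - a))) t (k * C * exp (k * (t - a))).
Proof. auto_derive; trivial. unfold Rminus. ring. Qed.

(** A derivative of exponential size [C e^(k|t-a|)] integrates to a function
    that is smaller by the factor [k]; with [k] large this makes the integral
    operators below contractions, on intervals of any length. *)
Lemma exp_weight_integral (f f' : R -> R) a x k C :
  0 < k -> f a = 0 ->
  (forall t, between a x t -> is_derive f t (f' t)) ->
  (forall t, between a x t -> Rabs (f' t) <= C * exp (k * Rabs (t - a))) ->
  Rabs (f x) <= C / k * exp (k * Rabs (x - a)).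
Proof.
  assert (right : forall (f f' : R -> R) x, a <= x -> 0 < k -> f a = 0 ->
    (forall t, a <= t <= x -> is_derive f t (f' t)) ->
    (forall t, a <= t <= x -> f' t <= C * exp (k * (t - a))) ->
    0 <= C -> f x <= C / k * exp (k * (x - a))).
  { clear. intros f f' x Hax Hk H0 Hd Hb HC.
    assert (H : C / k * exp (k * (a - a)) - f a
                <= C / k * exp (k * (x - a)) - f x).
    { apply (derive_nonneg_le (fun t => C / k * exp (k * (t - a)) - f t)
               (fun t => k * (C / k) * exp (k * (t - a)) - f' t)); trivial.
      - intros t Ht.
        apply (derive_minus).
        + apply is_derive_exp_weight.
        + now apply Hd.
      - intros t Ht. specialize (Hb t Ht).
        replace (k * (C / k)) with C by (field; lra). lra. }
    rewrite H0, Rminus_diag, Rmult_0_r, exp_0 in H.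
    assert (0 <= C / k) by (apply Rdiv_le_0_compat; lra). lra. }
  intros Hk H0 Hd Hb.
  assert (HC : 0 <= C).
  { specialize (Hb a (between_start a x)).
    rewrite Rminus_diag, Rabs_R0, Rmult_0_r, exp_0 in Hb.
    generalize (Rabs_pos (f' a)). lra. }
  assert (opp : forall (g : R -> R) (t l : R), is_derive g t l ->
                is_derive (fun s => - g s) t (- l)).
  { intros g t l. apply (is_derive_opp (K := R_AbsRing) (V := R_NormedModule)). }
  destruct (Rle_or_lt a x) as [L|L].
  - assert (B : forall t, a <= t <= x -> between a x t).
    { intros t. unfold between. now rewrite Rmin_left, Rmax_right. }
    rewrite (Rabs_right (x - a)) by lra.
    assert (B' : forall t, a <= t <= x -> Rabs (f' t) <= C * exp (k * (t - a))).
    { intros t Ht. specialize (Hb t (B t Ht)).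
      now rewrite (Rabs_right (t - a)) in Hb by lra. }
    apply Rabs_le. split.
    + apply Ropp_le_cancel. rewrite Ropp_involutive.
      apply (right (fun t => - f t) (fun t => - f' t)); auto.
      * rewrite H0. ring.
      * intros t Ht. apply Rle_trans with (2 := B' t Ht).
        rewrite <- Rabs_Ropp. apply Rle_abs.
    + apply (right f f'); auto.
      intros t Ht. apply Rle_trans with (2 := B' t Ht). apply Rle_abs.
  - assert (B : forall t, a <= t <= 2 * a - x -> between a x (2 * a - t)).
    { intros t Ht. unfold between. rewrite Rmin_right, Rmax_left; lra. }
    rewrite (Rabs_left (x - a)) by lra.
    replace (- (x - a)) with ((2 * a - x) - a) by ring.
    replace (f x) with (f (2 * a - (2 * a - x))) by (f_equal; ring).
    assert (B' : forall t, a <= t <= 2 * a - x ->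
              Rabs (f' (2 * a - t)) <= C * exp (k * (t - a))).
    { intros t Ht. specialize (Hb _ (B t Ht)).
      replace (2 * a - t - a) with (- (t - a)) in Hb by ring.
      now rewrite Rabs_Ropp, (Rabs_right (t - a)) in Hb by lra. }
    apply Rabs_le. split.
    + apply Ropp_le_cancel. rewrite Ropp_involutive.
      apply (right (fun t => - f (2 * a - t)) (fun t => - - f' (2 * a - t)));
        auto; try lra.
      * replace (2 * a - a) with a by ring. lra.
      * intros t Ht. apply opp. apply is_derive_reflect. now apply Hd, B.
      * intros t Ht. rewrite Ropp_involutive.
        apply Rle_trans with (2 := B' t Ht). apply Rle_abs.
    + apply (right (fun t => f (2 * a - t)) (fun t => - f' (2 * a - t)));
        auto; try lra.
      * replace (2 * a - a) with a by ring. trivial.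
      * intros t Ht. apply is_derive_reflect. now apply Hd, B.
      * intros t Ht. apply Rle_trans with (2 := B' t Ht).
        rewrite <- Rabs_Ropp. apply Rle_abs.
Qed.

(** Gronwall's inequality: to the right of [a] the function
    [(w + r) e^(-c(t-a))] does not increase, and reflection in [a] gives the left
    side. *)
Lemma gronwall (w w' : R -> R) a x c r :
  (forall t, between a x t -> is_derive w t (w' t)) ->
  (forall t, between a x t -> Rabs (w' t) <= c * (w t + r)) ->
  w x + r <= (w a + r) * exp (c * Rabs (x - a)).
Proof.
  assert (right : forall (w w' : R -> R) x, a <= x ->
    (forall t, a <= t <= x -> is_derive w t (w' t)) ->
    (forall t, a <= t <= x -> w' t <= c * (w t + r)) ->
    w x + r <= (w a + r) * exp (c * (x - a))).
  { clear. intros w w' x Hax Hd Hb.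
    assert (H : - ((w a + r) * exp (- c * (a - a)))
                <= - ((w x + r) * exp (- c * (x - a)))).
    { apply (derive_nonneg_le (fun t => - ((w t + r) * exp (- c * (t - a))))
               (fun t => (c * (w t + r) - w' t) * exp (- c * (t - a)))); trivial.
      - intros t Ht. specialize (Hd t Ht). auto_derive.
        + exists (w' t). exact Hd.
        + replace (Derive (fun x0 : R => w x0) t) with (w' t)
            by (symmetry; exact (is_derive_unique _ _ _ Hd)).
          unfold Rminus. ring.
      - intros t Ht. specialize (Hb t Ht).
        apply Rmult_le_pos; [lra|]. left. apply exp_pos. }
    rewrite Rminus_diag, Rmult_0_r, exp_0 in H.
    assert (E : exp (- c * (x - a)) * exp (c * (x - a)) = 1).
    { rewrite <- exp_plus. replace (_ + _) with 0 by ring. apply exp_0. }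
    assert (P := exp_pos (c * (x - a))).
    replace (w x + r)
      with ((w x + r) * exp (- c * (x - a)) * exp (c * (x - a)))
      by (rewrite Rmult_assoc, E; ring).
    apply Rmult_le_compat_r; lra. }
  intros Hd Hb.
  destruct (Rle_or_lt a x) as [L|L].
  - assert (B : forall t, a <= t <= x -> between a x t).
    { intros t. unfold between. now rewrite Rmin_left, Rmax_right. }
    rewrite (Rabs_right (x - a)) by lra.
    apply (right w w' x); auto.
    intros t Ht. apply Rle_trans with (2 := Hb t (B t Ht)). apply Rle_abs.
  - assert (B : forall t, a <= t <= 2 * a - x -> between a x (2 * a - t)).
    { intros t Ht. unfold between. rewrite Rmin_right, Rmax_left; lra. }
    rewrite (Rabs_left (x - a)) by lra.
    replace (- (x - a)) with ((2 * a - x) - a) by ring.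
    replace (w x) with (w (2 * a - (2 * a - x))) by (f_equal; ring).
    replace (w a) with (w (2 * a - a)) by (f_equal; ring).
    apply (right (fun t => w (2 * a - t)) (fun t => - w' (2 * a - t))); try lra.
    + intros t Ht. apply is_derive_reflect. now apply Hd, B.
    + intros t Ht. apply Rle_trans with (2 := Hb _ (B t Ht)).
      rewrite <- Rabs_Ropp. apply Rle_abs.
Qed.

Lemma continuous_bounded_between (f : R -> R) a x :
  (forall t, between a x t -> continuous f t) ->
  exists M, 0 < M /\ forall t, between a x t -> Rabs (f t) <= M.
Proof.
  intros Hc.
  destruct (bounded_continuity (K := R_AbsRing) (V := R_NormedModule) f
              (Rmin a x) (Rmax a x)) as [M HM].
  { intros t Ht. exact (Hc t Ht). }
  exists (Rmax M 1). split.
  - apply Rlt_le_trans with 1; [lra|apply Rmax_r].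
  - intros t Ht. apply Rle_trans with M; [|apply Rmax_l].
    left. exact (HM t Ht).
Qed.

(** The box is crossed in finitely many steps, each shorter than the modulus of
    uniform continuity. *)
Lemma cont2_bounded_box D f a x b y :
  cont2_on D f -> (forall s t, between a x s -> between b y t -> D s t) ->
  exists M, 0 < M /\
    forall s t, between a x s -> between b y t -> Rabs (f s t) <= M.
Proof.
  intros Hc Hbox.
  destruct (uniform_continuity_2d f (Rmin a x) (Rmax a x) (Rmin b y) (Rmax b y))
    with (eps := mkposreal 1 Rlt_0_1) as [d Hd].
  { intros s t Hs Ht. apply (cont2_continuity_2d_pt D); auto. }
  simpl in Hd.
  set (L := Rabs (x - a) + Rabs (y - b)).
  destruct (nfloor_ex (L / d)) as [N [_ HN]].
  { apply Rdiv_le_0_compat; [|apply cond_pos].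
    unfold L. generalize (Rabs_pos (x - a)) (Rabs_pos (y - b)). lra. }
  assert (HN0 : 0 < INR N + 1) by (generalize (pos_INR N); lra).
  assert (HL : L / (INR N + 1) < d).
  { apply (Rmult_lt_reg_r (INR N + 1)); trivial.
    replace (L / (INR N + 1) * (INR N + 1)) with (L / d * d)
      by (field; assert (Hd0 := cond_pos d); lra).
    rewrite (Rmult_comm d). apply Rmult_lt_compat_r; trivial. apply cond_pos. }
  exists (Rabs (f a b) + INR (S N)). split.
  { rewrite S_INR. generalize (Rabs_pos (f a b)). lra. }
  intros s t Hs Ht.
  (* position after [k] of the [N+1] steps from (a, b) to (s, t) *)
  set (P k := a + INR k / (INR N + 1) * (s - a)).
  set (Q k := b + INR k / (INR N + 1) * (t - b)).
  assert (conv : forall a x s r, between a x s -> 0 <= r <= 1 ->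
                 between a x (a + r * (s - a))).
  { clear. intros a x s r Hs Hr. destruct (Rle_or_lt a x) as [L|L].
    - apply between_le in Hs; trivial.
      unfold between; rewrite Rmin_left, Rmax_right by trivial. nra.
    - apply between_ge in Hs; [|lra].
      unfold between; rewrite Rmin_right, Rmax_left by lra. nra. }
  assert (fr : forall k, (k <= S N)%nat -> 0 <= INR k / (INR N + 1) <= 1).
  { intros k Hk. apply le_INR in Hk. rewrite S_INR in Hk. split.
    - apply Rdiv_le_0_compat; trivial. apply pos_INR.
    - apply (Rmult_le_reg_r (INR N + 1)); trivial.
      replace (INR k / (INR N + 1) * (INR N + 1)) with (INR k) by (field; lra).
      lra. }
  assert (step : forall k, (k <= S N)%nat ->
            Rabs (f (P k) (Q k)) <= Rabs (f a b) + INR k).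
  { induction k as [|k IH]; intros Hk.
    - replace (P 0%nat) with a by (unfold P; simpl; field; lra).
      replace (Q 0%nat) with b by (unfold Q; simpl; field; lra).
      simpl. lra.
    - assert (Hk' : (k <= S N)%nat) by lia. specialize (IH Hk').
      assert (close : Rabs (f (P (S k)) (Q (S k)) - f (P k) (Q k)) < 1).
      { assert (small : forall r, Rabs r <= L ->
                  Rabs ((INR k + 1) / (INR N + 1) * r
                        - INR k / (INR N + 1) * r) < d).
        { intros r Hr.
          replace (_ - _) with (r * / (INR N + 1)) by (field; lra).
          rewrite Rabs_mult, (Rabs_right (/ _))
            by (apply Rle_ge; left; now apply Rinv_0_lt_compat).
          apply Rle_lt_trans with (2 := HL). apply Rmult_le_compat_r; trivial.
          left; now apply Rinv_0_lt_compat. }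
        apply Hd; try (apply conv; auto).
        - unfold P. rewrite S_INR.
          replace (_ - _) with ((INR k + 1) / (INR N + 1) * (s - a)
                        - INR k / (INR N + 1) * (s - a)) by ring.
          apply small. apply between_abs in Hs. unfold L.
          generalize (Rabs_pos (y - b)). lra.
        - unfold Q. rewrite S_INR.
          replace (_ - _) with ((INR k + 1) / (INR N + 1) * (t - b)
                        - INR k / (INR N + 1) * (t - b)) by ring.
          apply small. apply between_abs in Ht. unfold L.
          generalize (Rabs_pos (x - a)). lra. }
      rewrite S_INR.
      replace (f (P (S k)) (Q (S k)))
        with (f (P k) (Q k) + (f (P (S k)) (Q (S k)) - f (P k) (Q k))) by ring.
      apply Rle_trans with (1 := Rabs_triang _ _). lra. }
  specialize (step (S N) (le_n _)).
  replace (P (S N)) with s in step by (unfold P; rewrite S_INR; field; lra).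
  replace (Q (S N)) with t in step by (unfold Q; rewrite S_INR; field; lra).
  exact step.
Qed.

(** * Linear differential equations *)

(** Four-element index type for frame vectors and for coordinates: case analysis
    splits a matrix equation into its entries, without bounds to carry along. *)
Inductive idx : Set := i1 | i2 | i3 | i4.

Definition sum4 (f : idx -> R) : R := f i1 + f i2 + f i3 + f i4.

Lemma sum4_ext f g : (forall j, f j = g j) -> sum4 f = sum4 g.
Proof. intros H. unfold sum4. now rewrite !H. Qed.

Lemma sum4_abs_le f M : (forall j, Rabs (f j) <= M) -> Rabs (sum4 f) <= 4 * M.
Proof.
  intros H. unfold sum4.
  assert (H1 := H i1). assert (H2 := H i2).
  assert (H3 := H i3). assert (H4 := H i4).
  apply Rle_trans with (1 := Rabs_triang _ _).
  assert (T := Rabs_triang (f i1 + f i2) (f i3)).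
  assert (T' := Rabs_triang (f i1) (f i2)). lra.
Qed.

Lemma sum4_le_pos f i : (forall j, 0 <= f j) -> f i <= sum4 f.
Proof.
  intros H. unfold sum4.
  assert (H1 := H i1). assert (H2 := H i2).
  assert (H3 := H i3). assert (H4 := H i4).
  destruct i; lra.
Qed.

Lemma idx_uniform_bound {T : Type} (Q : T -> Prop) (f : idx -> T -> R) :
  (forall i, exists K, 0 < K /\ forall t, Q t -> Rabs (f i t) <= K) ->
  exists K, 0 < K /\ forall i t, Q t -> Rabs (f i t) <= K.
Proof.
  intros H.
  destruct (H i1) as (K1 & P1 & B1). destruct (H i2) as (K2 & P2 & B2).
  destruct (H i3) as (K3 & P3 & B3). destruct (H i4) as (K4 & P4 & B4).
  exists (K1 + K2 + K3 + K4). split; [lra|].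
  intros [] t Ht; [specialize (B1 t Ht)|specialize (B2 t Ht)
                  |specialize (B3 t Ht)|specialize (B4 t Ht)]; lra.
Qed.

Lemma is_derive_sum4 (f : idx -> R -> R) (l : idx -> R) t :
  (forall j, is_derive (f j) t (l j)) ->
  is_derive (fun s => sum4 (fun j => f j s)) t (sum4 l).
Proof.
  intros H. unfold sum4.
  repeat apply (derive_plus); apply H.
Qed.

Lemma continuous_sum4 {T : UniformSpace} (f : idx -> T -> R) t :
  (forall j, continuous (f j) t) -> continuous (fun s => sum4 (fun j => f j s)) t.
Proof.
  intros H. unfold sum4.
  apply (continuous_plus (V := R_NormedModule)
           (fun s => f i1 s + f i2 s + f i3 s) (f i4)); [|apply H].
  apply (continuous_plus (V := R_NormedModule)
           (fun s => f i1 s + f i2 s) (f i3)); [|apply H].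
  apply (continuous_plus (V := R_NormedModule) (f i1) (f i2)); apply H.
Qed.

(** Successive corrections of Picard's iteration for [y' = A y], [y t0 = y0]:
    the solution is their sum. *)
Fixpoint picard (A : idx -> idx -> R -> R) (t0 : R) (y0 : idx -> R)
    (n : nat) (i : idx) (t : R) : R :=
  match n with
  | O => y0 i
  | S m => RInt (fun s => sum4 (fun j => A i j s * picard A t0 y0 m j s)) t0 t
  end.

Definition flow A t0 y0 i t : R := Series (fun n => picard A t0 y0 n i t).

Lemma is_derive_RInt_interval J (f : R -> R) t0 t :
  is_open_interval J -> (forall s, J s -> continuous f s) -> J t0 -> J t ->
  is_derive (fun x => RInt f t0 x) t (f t).
Proof.
  intros HJ Hf H0 Ht.
  apply (is_derive_RInt f (fun x => RInt f t0 x) t0); [|now apply Hf].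
  generalize (open_interval_open J t HJ Ht). apply filter_imp.
  intros x Hx. apply (RInt_correct (V := R_CompleteNormedModule)).
  apply (ex_RInt_continuous (V := R_CompleteNormedModule)).
  intros s Hs. apply Hf. now apply (open_interval_between J t0 x).
Qed.

Lemma continuous_sum4_mult {T : UniformSpace} (A y : idx -> T -> R) t :
  (forall j, continuous (A j) t) -> (forall j, continuous (y j) t) ->
  continuous (fun s => sum4 (fun j => A j s * y j s)) t.
Proof.
  intros HA Hy. apply (continuous_sum4 (fun j s => A j s * y j s)).
  intros j. exact (continuous_mult (K := R_AbsRing) _ _ _ (HA j) (Hy j)).
Qed.

Lemma continuity_pt_continuous (f : R -> R) t : continuous f t -> continuity_pt f t.
Proof. intros H. apply continuity_pt_filterlim. exact H. Qed.

Lemma is_derive_continuous (f : R -> R) t (l : R) : is_derive f t l -> continuous f t.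
Proof.
  intros H. apply (ex_derive_continuous (K := R_AbsRing) (V := R_NormedModule)).
  now exists l.
Qed.

Lemma exp_le_exp x y : x <= y -> exp x <= exp y.
Proof.
  intros [H|H].
  - left. now apply exp_increasing.
  - right. now rewrite H.
Qed.

Section Picard.

Variables (J : R -> Prop) (A : idx -> idx -> R -> R) (t0 : R) (y0 : idx -> R).
Hypothesis HJ : is_open_interval J.
Hypothesis HA : forall i j t, J t -> continuous (A i j) t.
Hypothesis H0 : J t0.

Let Y := picard A t0 y0.

Lemma picard_continuous n i t : J t -> continuous (Y n i) t.
Proof.
  revert i t. induction n as [|n IH]; intros i t Ht.
  - apply (continuous_const (U := R_UniformSpace)).
  - apply (is_derive_continuous _ _ (sum4 (fun j => A i j t * Y n j t))).
    apply (is_derive_RInt_interval J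
             (fun s => sum4 (fun j => A i j s * Y n j s)) t0 t); trivial.
    intros s Hs. apply continuous_sum4_mult; intros j; auto.
Qed.

Lemma picard_derive n i t : J t ->
  is_derive (Y (S n) i) t (sum4 (fun j => A i j t * Y n j t)).
Proof.
  intros Ht.
  apply (is_derive_RInt_interval J
             (fun s => sum4 (fun j => A i j s * Y n j s)) t0 t); trivial.
  intros s Hs. apply continuous_sum4_mult; intros j; auto.
  now apply picard_continuous.
Qed.

Lemma picard_S_start n i : Y (S n) i t0 = 0.
Proof. unfold Y. simpl. apply (RInt_point (V := R_CompleteNormedModule)). Qed.

Lemma interval_margin t : J t -> exists a b, J a /\ J b /\
  a < t0 < b /\ a < t < b.
Proof.
  intros Ht.
  assert (right : forall x, J x -> exists y, J y /\ x < y).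
  { intros x Hx. destruct (open_interval_open J x HJ Hx) as [d Hd].
    assert (Hd0 := cond_pos d). exists (x + d / 2). split; [|lra].
    apply Hd. change (Rabs (x + d / 2 - x) < d).
    rewrite Rabs_right; lra. }
  assert (left : forall x, J x -> exists y, J y /\ y < x).
  { intros x Hx. destruct (open_interval_open J x HJ Hx) as [d Hd].
    assert (Hd0 := cond_pos d). exists (x - d / 2). split; [|lra].
    apply Hd. change (Rabs (x - d / 2 - x) < d).
    rewrite Rabs_left; lra. }
  destruct (right t0 H0) as (b1 & Jb1 & L1). destruct (right t Ht) as (b2 & Jb2 & L2).
  destruct (left t0 H0) as (a1 & Ja1 & L3). destruct (left t Ht) as (a2 & Ja2 & L4).
  exists (Rmin a1 a2), (Rmax b1 b2).
  assert (Rmin a1 a2 <= a1) by apply Rmin_l.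
  assert (Rmin a1 a2 <= a2) by apply Rmin_r.
  assert (b1 <= Rmax b1 b2) by apply Rmax_l.
  assert (b2 <= Rmax b1 b2) by apply Rmax_r.
  split; [unfold Rmin; destruct (Rle_dec a1 a2); trivial|].
  split; [unfold Rmax; destruct (Rle_dec b1 b2); trivial|]. lra.
Qed.

(** Each integration halves the bound in the weight [e^(8K|t-t0|)], where [K]
    bounds the coefficients on the compact interval. *)
Lemma picard_geometric a b : J a -> J b -> a <= t0 <= b ->
  exists M, 0 <= M /\
  forall n i t, a <= t <= b -> Rabs (Y n i t) <= M * (1 / 2) ^ n.
Proof.
  intros Ha Hb Hab.
  assert (Hbound : exists K, 0 < K /\
            forall i j t, a <= t <= b -> Rabs (A i j t) <= K).
  { destruct (idx_uniform_bound (fun p : idx * R => a <= snd p <= b)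
                (fun i p => A i (fst p) (snd p))) as (K & HK & B).
    - intros i.
      destruct (idx_uniform_bound (fun t => a <= t <= b) (A i)) as (K & HK & B).
      + intros j.
        destruct (continuous_bounded_between (A i j) a b) as (K & HK & B).
        * intros t Ht. apply HA. now apply (open_interval_between J a b).
        * exists K. split; trivial. intros t Ht. apply B.
          unfold between. rewrite Rmin_left, Rmax_right; lra.
      + exists K. split; trivial. intros [j t] Ht. now apply B.
    - exists K. split; trivial. intros i j t Ht. exact (B i (j, t) Ht). }
  destruct Hbound as (K & HK & BK).
  set (M := sum4 (fun i => Rabs (y0 i))).
  assert (HM : 0 <= M).
  { unfold M, sum4. generalize (Rabs_pos (y0 i1)) (Rabs_pos (y0 i2))
      (Rabs_pos (y0 i3)) (Rabs_pos (y0 i4)). lra. }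
  assert (weighted : forall n i t, a <= t <= b ->
    Rabs (Y n i t) <= M * (1 / 2) ^ n * exp (8 * K * Rabs (t - t0))).
  { induction n as [|n IH]; intros i t Ht.
    - assert (Rabs (y0 i) <= M).
      { apply (sum4_le_pos (fun i => Rabs (y0 i))). intros j. apply Rabs_pos. }
      assert (1 <= exp (8 * K * Rabs (t - t0))).
      { rewrite <- exp_0 at 1. apply exp_le_exp. apply Rmult_le_pos; [lra|].
        apply Rabs_pos. }
      change (Y 0 i t) with (y0 i). simpl. nra.
    - assert (B : forall s, between t0 t s -> a <= s <= b).
      { intros s. unfold between, Rmin, Rmax. destruct (Rle_dec t0 t); lra. }
      replace (M * (1 / 2) ^ S n) with (4 * (K * (M * (1 / 2) ^ n)) / (8 * K))
        by (simpl; field; lra).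
      apply (exp_weight_integral _ (fun s => sum4 (fun j => A i j s * Y n j s))).
      + lra.
      + apply picard_S_start.
      + intros s Hs. apply picard_derive.
        apply (open_interval_between J a b); trivial.
        unfold between. rewrite Rmin_left, Rmax_right; try lra. now apply B.
      + intros s Hs. rewrite Rmult_assoc. apply sum4_abs_le. intros j.
        rewrite Rabs_mult, Rmult_assoc. specialize (B s Hs).
        apply Rmult_le_compat; auto using Rabs_pos. }
  exists (M * exp (8 * K * (b - a))). split.
  { apply Rmult_le_pos; trivial. left. apply exp_pos. }
  intros n i t Ht. apply Rle_trans with (1 := weighted n i t Ht).
  rewrite Rmult_assoc, (Rmult_comm (_ ^ _)), <- Rmult_assoc.
  apply Rmult_le_compat_r; [apply pow_le; lra|].
  apply Rmult_le_compat_l; trivial.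
  apply exp_le_exp. apply Rmult_le_compat_l; [lra|].
  apply Rabs_le. lra.
Qed.

Lemma geometric_tail (u : nat -> R) M :
  (forall n, Rabs (u n) <= M * (1 / 2) ^ n) ->
  ex_series u /\
  forall n, Rabs (Series u - sum_f_R0 u n) <= M * (1 / 2) ^ n.
Proof.
  intros Hu.
  assert (Hq : Rabs (1 / 2) < 1) by (rewrite Rabs_right; lra).
  assert (G : forall c, is_series (fun n => c * (1 / 2) ^ n) (c * 2)).
  { intros c.
    replace (c * 2) with (scal c (/ (1 - 1 / 2)))
      by (change (c * (/ (1 - 1 / 2)) = c * 2); field).
    apply (is_series_scal (K := R_AbsRing) (V := R_NormedModule) c).
    now apply is_series_geom. }
  assert (E : ex_series u).
  { apply (ex_series_le (K := R_AbsRing) (V := R_CompleteNormedModule) u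
             (fun n => M * (1 / 2) ^ n)).
    - exact Hu.
    - exists (M * 2). apply G. }
  split; trivial. intros n.
  rewrite (Series_incr_n u (S n)) by (trivial; lia). simpl pred.
  replace (_ - _) with (Series (fun k => u (S n + k)%nat)) by ring.
  assert (Hk : forall k, Rabs (u (S n + k)%nat)
                 <= M * (1 / 2) ^ S n * (1 / 2) ^ k).
  { intros k. rewrite Rmult_assoc, <- pow_add. apply Hu. }
  apply Rle_trans with (Series (fun k => Rabs (u (S n + k)%nat))).
  { apply Series_Rabs.
    apply (ex_series_le (K := R_AbsRing) (V := R_CompleteNormedModule) _
             (fun k => M * (1 / 2) ^ S n * (1 / 2) ^ k)).
    - intros k. change (Rabs (Rabs (u (S n + k)%nat))
                 <= M * (1 / 2) ^ S n * (1 / 2) ^ k).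
      rewrite Rabs_Rabsolu. apply Hk.
    - eexists. apply G. }
  apply Rle_trans with (Series (fun k => M * (1 / 2) ^ S n * (1 / 2) ^ k)).
  { apply Series_le.
    - intros k. split; [apply Rabs_pos|apply Hk].
    - eexists. apply G. }
  rewrite (is_series_unique _ _ (G _)). simpl. right. field.
Qed.

Lemma flow_start i : flow A t0 y0 i t0 = y0 i.
Proof.
  destruct (interval_margin t0 H0) as (a & b & Ha & Hb & Hab & _).
  destruct (picard_geometric a b Ha Hb) as (M & HM & B); [lra|].
  destruct (geometric_tail (fun n => Y n i t0) M) as [E _].
  { intros n. apply B. lra. }
  unfold flow. change (Series (fun n => Y n i t0) = y0 i).
  rewrite Series_incr_1 by trivial.
  rewrite (Series_ext _ (fun k => 0 * 0)).
  - rewrite Series_scal_l. unfold Y. simpl. ring.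
  - intros k. rewrite picard_S_start. ring.
Qed.

Lemma flow_derive i t : J t ->
  is_derive (flow A t0 y0 i) t (sum4 (fun j => A i j t * flow A t0 y0 j t)).
Proof.
  intros Ht.
  destruct (interval_margin t Ht) as (a & b & Ha & Hb & Hab & Hat).
  destruct (picard_geometric a b Ha Hb) as (M & HM & B); [lra|].
  assert (tail : forall j s, a <= s <= b -> forall n,
    Rabs (flow A t0 y0 j s - sum_f_R0 (fun k => Y k j s) n) <= M * (1 / 2) ^ n).
  { intros j s Hs. apply geometric_tail. intros n. now apply B. }
  assert (small : forall C eps, 0 <= C -> 0 < eps ->
            exists N, forall n, (N <= n)%nat -> C * (1 / 2) ^ n < eps).
  { intros C eps HC He.
    destruct (pow_lt_1_zero (1 / 2)) with (y := eps / (C + 1)) as [N HN].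
    - rewrite Rabs_right; lra.
    - apply Rdiv_lt_0_compat; lra.
    - exists N. intros n Hn. specialize (HN n Hn).
      rewrite Rabs_right in HN by (apply Rle_ge, pow_le; lra).
      apply (Rmult_lt_compat_l (C + 1)) in HN; [|lra].
      replace ((C + 1) * (eps / (C + 1))) with eps in HN by (field; lra).
      assert (0 <= (1 / 2) ^ n) by (apply pow_le; lra). lra. }
  assert (Jab : forall s, a <= s <= b -> J s).
  { intros s Hs. apply (open_interval_between J a b); trivial.
    unfold between. rewrite Rmin_left, Rmax_right; lra. }
  destruct (idx_uniform_bound (fun s => a <= s <= b) (A i)) as (K & K0 & BK).
  { intros j. destruct (continuous_bounded_between (A i j) a b) as (K & HK & BK).
    - intros s Hs. apply HA. now apply (open_interval_between J a b).
    - exists K. split; trivial. intros s Hs. apply BK.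
      unfold between. rewrite Rmin_left, Rmax_right; lra. }
  assert (Hr : 0 < (b - a) / 2) by lra.
  set (c := (a + b) / 2). set (r := mkposreal _ Hr).
  assert (ball_in : forall s, Boule c r s -> a <= s <= b).
  { intros s Hs. unfold Boule, c in Hs. simpl in Hs.
    apply Rabs_def2 in Hs. lra. }
  set (fn n s := sum_f_R0 (fun k => Y k i s) (S n)).
  set (fn' n s := sum4 (fun j => A i j s * sum_f_R0 (fun k => Y k j s) n)).
  set (g s := sum4 (fun j => A i j s * flow A t0 y0 j s)).
  assert (unif : CVU fn' g c r).
  { intros eps He.
    destruct (small (4 * (K * M)) eps) as [N HN]; trivial.
    { apply Rmult_le_pos; [lra|]. apply Rmult_le_pos; lra. }
    exists N. intros n s Hn Hs. apply ball_in in Hs.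
    apply Rle_lt_trans with (2 := HN n Hn).
    unfold g, fn'.
    replace (sum4 _ - sum4 _) with
      (sum4 (fun j => A i j s *
                (flow A t0 y0 j s - sum_f_R0 (fun k => Y k j s) n)))
      by (unfold sum4; ring).
    rewrite Rmult_assoc. apply sum4_abs_le. intros j.
    rewrite Rabs_mult, Rmult_assoc.
    apply Rmult_le_compat; auto using Rabs_pos. }
  assert (psum_cont : forall n j s, J s ->
            continuous (fun s => sum_f_R0 (fun k => Y k j s) n) s).
  { induction n as [|n IH]; intros j s Hs.
    - now apply (picard_continuous 0).
    - simpl. apply (continuous_plus (V := R_NormedModule)); auto.
      now apply (picard_continuous (S n)). }
  apply is_derive_Reals.
  apply (derivable_pt_lim_CVU fn fn' (flow A t0 y0 i) g t c r); trivial.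
  - unfold Boule, c; simpl. apply Rabs_def1; lra.
  - intros s n Hs. apply ball_in, Jab in Hs. apply is_derive_Reals.
    induction n as [|n IH].
    + unfold fn, fn'. simpl. evar_last.
      * apply (derive_plus
                 (fun s => Y 0 i s) (Y 1%nat i)).
        -- apply (derive_const (y0 i) s).
        -- now apply picard_derive.
      * change (@eq R (0 + sum4 (fun j => A i j s * Y 0 j s))
                  (sum4 (fun j => A i j s * Y 0 j s))). ring.
    + unfold fn. simpl sum_f_R0 in *. evar_last.
      * apply (derive_plus (fn n)
                 (Y (S (S n)) i)).
        -- exact IH.
        -- now apply picard_derive.
      * unfold fn'. change (@eq R
          (sum4 (fun j => A i j s * sum_f_R0 (fun k => Y k j s) n) +
           sum4 (fun j => A i j s * Y (S n) j s))
          (sum4 (fun j => A i j s * sum_f_R0 (fun k => Y k j s) (S n)))).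
        simpl sum_f_R0. unfold sum4. ring.
  - intros s Hs. apply ball_in in Hs. intros eps He.
    destruct (small M eps HM He) as [N HN].
    exists N. intros n Hn. unfold R_dist, fn.
    rewrite Rabs_minus_sym.
    apply Rle_lt_trans with (1 := tail i s Hs (S n)). apply HN. lia.
  - apply (CVU_continuity fn' g c r unif).
    intros n s Hs. apply ball_in, Jab in Hs. apply continuity_pt_continuous.
    apply continuous_sum4_mult; intros j; auto.
Qed.

End Picard.

(** * Flat pairs of linear systems in the plane *)

Lemma is_derive_iff_small (f : R -> R) x l :
  is_derive f x l <->
  forall eps, 0 < eps ->
    locally x (fun s => Rabs (f s - f x - (s - x) * l) <= eps * Rabs (s - x)).
Proof.
  split.
  - intros [_ H] eps He.
    exact (H x (fun P HP => HP) (mkposreal eps He)).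
  - intros H. split.
    + apply (is_linear_scal_l (K := R_AbsRing) (V := R_NormedModule)).
    + intros y Hy eps.
      apply (is_filter_lim_locally_unique (K := R_AbsRing) (V := R_NormedModule))
        in Hy. rewrite <- Hy.
      exact (H eps (cond_pos eps)).
Qed.

Lemma locally_idx x (P : idx -> R -> Prop) :
  (forall i, locally x (P i)) -> locally x (fun s => forall i, P i s).
Proof.
  intros H.
  generalize (filter_and _ _ (filter_and _ _ (H i1) (H i2))
                (filter_and _ _ (H i3) (H i4))).
  apply filter_imp. intros s [[] []] []; trivial.
Qed.

(** The energy [sum D_i^2] of a linear system with a bounded source satisfies
    the hypothesis of Gronwall's inequality. *)
Lemma linear_system_energy (B : idx -> idx -> R -> R) (D r : idx -> R -> R)
    a x K rho :
  (forall i t, between a x t ->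
     is_derive (D i) t (sum4 (fun j => B i j t * D j t) + r i t)) ->
  (forall i j t, between a x t -> Rabs (B i j t) <= K) ->
  (forall i t, between a x t -> Rabs (r i t) <= rho) ->
  sum4 (fun i => D i x ^ 2) + rho ^ 2
  <= (sum4 (fun i => D i a ^ 2) + rho ^ 2) * exp ((8 * K + 4) * Rabs (x - a)).
Proof.
  intros HD HB Hr.
  apply (gronwall (fun t => sum4 (fun i => D i t ^ 2))
    (fun t => sum4 (fun i =>
       2 * D i t * (sum4 (fun j => B i j t * D j t) + r i t)))).
  - intros t Ht. apply (is_derive_sum4 (fun i t => D i t ^ 2)).
    intros i. evar_last.
    + apply (is_derive_pow (D i) 2 t). now apply HD.
    + simpl. ring.
  - intros t Ht.
    set (s := sum4 (fun j => Rabs (D j t))).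
    assert (HK : 0 <= K).
    { apply Rle_trans with (2 := HB i1 i1 t Ht). apply Rabs_pos. }
    assert (Hrho : 0 <= rho).
    { apply Rle_trans with (2 := Hr i1 t Ht). apply Rabs_pos. }
    assert (term : forall i,
      Rabs (2 * D i t * (sum4 (fun j => B i j t * D j t) + r i t))
      <= 2 * Rabs (D i t) * (K * s + rho)).
    { intros i. rewrite !Rabs_mult, (Rabs_right 2) by lra.
      apply Rmult_le_compat_l; [generalize (Rabs_pos (D i t)); lra|].
      apply Rle_trans with (1 := Rabs_triang _ _).
      apply Rplus_le_compat; [|now apply Hr].
      assert (Hj : forall j, Rabs (B i j t * D j t) <= K * Rabs (D j t)).
      { intros j. rewrite Rabs_mult. apply Rmult_le_compat_r; auto using Rabs_pos. }
      unfold s, sum4.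
      apply Rle_trans with (1 := Rabs_triang _ _).
      assert (T := Rabs_triang (B i i1 t * D i1 t + B i i2 t * D i2 t)
                     (B i i3 t * D i3 t)).
      assert (T' := Rabs_triang (B i i1 t * D i1 t) (B i i2 t * D i2 t)).
      generalize (Hj i1) (Hj i2) (Hj i3) (Hj i4). lra. }
    apply Rle_trans with (2 * s * (K * s + rho)).
    { unfold s at 1. unfold sum4 at 1 3.
      apply Rle_trans with (1 := Rabs_triang _ _).
      match goal with |- Rabs (?a + ?b + ?c) + _ <= _ =>
        assert (T := Rabs_triang (a + b) c); assert (T' := Rabs_triang a b) end.
      generalize (term i1) (term i2) (term i3) (term i4). lra. }
    assert (Hs : s ^ 2 <= 4 * sum4 (fun i => D i t ^ 2)).
    { unfold s, sum4.
      rewrite <- (pow2_abs (D i1 t)), <- (pow2_abs (D i2 t)),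
        <- (pow2_abs (D i3 t)), <- (pow2_abs (D i4 t)).
      generalize (Rabs (D i1 t)) (Rabs (D i2 t)) (Rabs (D i3 t)) (Rabs (D i4 t)).
      intros p q m n.
      assert (H1 := pow2_ge_0 (p - q)). assert (H2 := pow2_ge_0 (p - m)).
      assert (H3 := pow2_ge_0 (p - n)). assert (H4 := pow2_ge_0 (q - m)).
      assert (H5 := pow2_ge_0 (q - n)). assert (H6 := pow2_ge_0 (m - n)).
      nra. }
    assert (Hsr := pow2_ge_0 (s - rho)).
    assert (K * s ^ 2 <= K * (4 * sum4 (fun i => D i t ^ 2)))
      by now apply Rmult_le_compat_l.
    assert (0 <= rho ^ 2) by apply pow2_ge_0.
    assert (0 <= K * rho ^ 2) by now apply Rmult_le_pos.
    nra.
Qed.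

Section UniformBounds.

Variables (I J : R -> Prop).
Hypotheses (HI : is_open_interval I) (HJ : is_open_interval J).

Lemma cont2_uniform_u f u a b eps : cont2_on (rect I J) f ->
  I u -> J a -> J b -> 0 < eps ->
  locally u (fun s => forall t, between a b t -> Rabs (f s t - f u t) <= eps).
Proof.
  intros Hf Hu Ha Hb He.
  destruct (uniform_continuity_2d_1d' f (Rmin a b) (Rmax a b) u) with
    (eps := mkposreal eps He) as [d Hd].
  { intros t Ht. apply (cont2_continuity_2d_pt (rect I J)); trivial.
    split; trivial. now apply (open_interval_between J a b). }
  exists d. intros s Hs t Ht. apply Rabs_def2 in Hs.
  change (s - u < d /\ - d < s - u) in Hs. left.
  assert (Hd0 := cond_pos d).
  apply (Hd t u t s Ht); try exact Ht; try lra.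
  now rewrite Rminus_diag, Rabs_R0.
Qed.

Lemma smooth_uniform_derive_u f u a b eps : smooth_on (rect I J) f ->
  I u -> J a -> J b -> 0 < eps ->
  locally u (fun s => forall t, between a b t ->
    Rabs (f s t - f u t - (s - u) * du f u t) <= eps * Rabs (s - u)).
Proof.
  intros Hf Hu Ha Hb He.
  destruct (cont2_uniform_u (du f) u a b eps) as [d Hd]; trivial.
  { apply smooth_cont2. now apply smooth_du. }
  destruct (open_interval_open I u HI Hu) as [d' Hd'].
  exists (mkposreal (Rmin d d') (Rmin_pos _ _ (cond_pos d) (cond_pos d'))).
  intros s Hs t Ht. change (Rabs (s - u) < Rmin d d') in Hs.
  assert (Hs1 : Rabs (s - u) < d)
    by (apply Rlt_le_trans with (1 := Hs); apply Rmin_l).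
  assert (Hs2 : Rabs (s - u) < d')
    by (apply Rlt_le_trans with (1 := Hs); apply Rmin_r).
  assert (Is : I s) by now apply Hd'.
  assert (Jt : J t) by now apply (open_interval_between J a b).
  assert (Hx : forall x, between u s x ->
            is_derive (fun x => f x t) x (du f x t)).
  { intros x Hx. apply (smooth_is_derive_u (rect I J)); trivial.
    split; trivial. now apply (open_interval_between I u s). }
  destruct (MVT_gen (fun x => f x t) u s (fun x => du f x t)) as (c & Hc & E).
  - intros x H. apply Hx. unfold between. lra.
  - intros x H. apply (derive_continuity_pt _ x (du f x t)). now apply Hx.
  - rewrite E.
    replace (du f c t * (s - u) - (s - u) * du f u t)
      with ((du f c t - du f u t) * (s - u)) by ring.
    rewrite Rabs_mult. apply Rmult_le_compat_r; [apply Rabs_pos|].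
    apply Hd; trivial.
    apply Rle_lt_trans with (2 := Hs1). now apply between_abs.
Qed.

End UniformBounds.

Section Flat.

Variables (I J : R -> Prop) (A B : idx -> idx -> R -> R -> R) (u0 v0 : R).
Hypotheses (HI : is_open_interval I) (HJ : is_open_interval J).
Hypotheses (HA : forall i j, smooth_on (rect I J) (A i j))
           (HB : forall i j, smooth_on (rect I J) (B i j)).
Hypothesis flat : forall i j u v, rect I J u v ->
  dv (A i j) u v + sum4 (fun k => A i k u v * B k j u v)
  = du (B i j) u v + sum4 (fun k => B i k u v * A k j u v).
Hypothesis H0 : rect I J u0 v0.

(** Transport of the initial value along the broken line from [(u0, v0)]
    through [(u, v0)] to [(u, v)]. *)
Definition flat_solution (y0 : idx -> R) (i : idx) (u v : R) : R :=
  flow (fun i j t => B i j u t) v0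
    (fun i => flow (fun i j s => A i j s v0) u0 y0 i u) i v.

Variable y0 : idx -> R.
Let w := flat_solution y0.

Lemma flat_solution_v0 i u : I u ->
  w i u v0 = flow (fun i j s => A i j s v0) u0 y0 i u.
Proof.
  intros Hu. unfold w, flat_solution.
  rewrite (flow_start J); trivial; [|apply H0].
  intros k l t Ht. apply (cont2_continuous_v (rect I J)).
  - now apply smooth_cont2.
  - now split.
Qed.

Lemma flat_solution_start i : w i u0 v0 = y0 i.
Proof.
  rewrite flat_solution_v0 by apply H0.
  apply (flow_start I); trivial; [|apply H0].
  intros k l t Ht. apply (cont2_continuous_u (rect I J) (A k l)).
  - now apply smooth_cont2.
  - split; trivial. apply H0.
Qed.

Lemma flat_solution_derive_v i u v : rect I J u v ->
  is_derive (fun t => w i u t) v (sum4 (fun j => B i j u v * w j u v)).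
Proof.
  intros [Hu Hv].
  apply (flow_derive J (fun i j t => B i j u t)); trivial; [|apply H0].
  intros k l t Ht. apply (cont2_continuous_v (rect I J)).
  - now apply smooth_cont2.
  - now split.
Qed.

Lemma flat_solution_derive_u_v0 i u : I u ->
  is_derive (fun s => w i s v0) u (sum4 (fun j => A i j u v0 * w j u v0)).
Proof.
  intros Hu.
  apply (is_derive_ext_loc (fun s => flow (fun i j s => A i j s v0) u0 y0 i s)).
  - generalize (open_interval_open I u HI Hu). apply filter_imp.
    intros s Hs. symmetry. now apply flat_solution_v0.
  - rewrite (sum4_ext _ (fun j => A i j u v0 *
              flow (fun i j s => A i j s v0) u0 y0 j u))
      by (intros j; now rewrite flat_solution_v0).
    apply (flow_derive I (fun i j s => A i j s v0)); trivial; [|apply H0].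
    intros k l t Ht. apply (cont2_continuous_u (rect I J) (A k l)).
    + now apply smooth_cont2.
    + split; trivial. apply H0.
Qed.

Lemma coefficients_bounded_near u a b : I u -> J a -> J b ->
  exists K, 0 < K /\ locally u (fun s => I s /\
    forall t, between a b t -> forall i j, Rabs (B i j s t) <= K).
Proof.
  intros Hu Ha Hb.
  destruct (open_interval_open I u HI Hu) as [d Hd].
  assert (Hd0 := cond_pos d).
  assert (Hin : forall x, Rabs (x - u) < d -> I x) by exact Hd.
  assert (I1 : I (u - d / 2)).
  { apply Hin. apply Rabs_def1; lra. }
  assert (I2 : I (u + d / 2)).
  { apply Hin. apply Rabs_def1; lra. }
  destruct (idx_uniform_bound
    (fun p : idx * (R * R) => between (u - d / 2) (u + d / 2) (fst (snd p)) /\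
                              between a b (snd (snd p)))
    (fun i p => B i (fst p) (fst (snd p)) (snd (snd p)))) as (K & HK & BK).
  { intros i.
    destruct (idx_uniform_bound
      (fun p : R * R => between (u - d / 2) (u + d / 2) (fst p) /\
                        between a b (snd p))
      (fun j p => B i j (fst p) (snd p))) as (K & HK & BK).
    - intros j.
      destruct (cont2_bounded_box (rect I J) (B i j) (u - d / 2) (u + d / 2) a b)
        as (K & HK & BK).
      + now apply smooth_cont2.
      + intros s t Hs Ht. split.
        * now apply (open_interval_between I (u - d / 2) (u + d / 2)).
        * now apply (open_interval_between J a b).
      + exists K. split; trivial. intros [s t] []. now apply BK.
    - exists K. split; trivial. intros [j p] Hp. now apply BK. }
  exists K. split; trivial.
  assert (Hd2 : 0 < d / 2) by lra.
  exists (mkposreal _ Hd2). intros s Hs. change (Rabs (s - u) < d / 2) in Hs.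
  apply Rabs_def2 in Hs.
  assert (Hbs : between (u - d / 2) (u + d / 2) s).
  { unfold between. rewrite Rmin_left, Rmax_right; lra. }
  split.
  - now apply (open_interval_between I (u - d / 2) (u + d / 2)).
  - intros t Ht i j. exact (BK i (j, (s, t)) (conj Hbs Ht)).
Qed.

(** As a function of [t], the defect
    [w(s,t) - w(u,t) - (s-u) (A w)(u,t)] of the expected first-order expansion
    solves, by flatness, the linear system with matrix [B(s,t)] up to a source
    of size [o(s-u)]; since it is [o(s-u)] at [t = v0], it stays so. *)
Lemma flat_solution_derive_u i u v : rect I J u v ->
  is_derive (fun s => w i s v) u (sum4 (fun j => A i j u v * w j u v)).
Proof.
  intros Huv. assert (Huv' := Huv). destruct Huv' as [Hu Hv].
  assert (Hv0 : J v0) by apply H0.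
  assert (HR := rect_open I J HI HJ).
  destruct (coefficients_bounded_near u v0 v Hu Hv0 Hv) as (K & HK & BK).
  assert (Rt : forall t, between v0 v t -> rect I J u t).
  { intros t Ht. split; trivial. now apply (open_interval_between J v0 v). }
  assert (wc : forall j t, between v0 v t -> continuous (fun t => w j u t) t).
  { intros j t Ht. eapply is_derive_continuous.
    apply flat_solution_derive_v. now apply Rt. }
  assert (HM1 : exists M, 0 < M /\
    forall j t, between v0 v t -> Rabs (w j u t) <= M).
  { apply (idx_uniform_bound (between v0 v) (fun j t => w j u t)).
    intros j. apply continuous_bounded_between. now apply wc. }
  assert (HM2 : exists M, 0 < M /\ forall j t, between v0 v t ->
                  Rabs (sum4 (fun k => A j k u t * w k u t)) <= M).
  { apply (idx_uniform_bound (between v0 v)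
      (fun j t => sum4 (fun k => A j k u t * w k u t))).
    intros j. apply continuous_bounded_between. intros t Ht.
    apply (continuous_sum4_mult (fun k t => A j k u t) (fun k t => w k u t)).
    - intros k. apply (cont2_continuous_v (rect I J)).
      + now apply smooth_cont2.
      + now apply Rt.
    - intros k. now apply wc. }
  destruct HM1 as (M1 & PM1 & BM1). destruct HM2 as (M2 & PM2 & BM2).
  set (c := (8 * K + 4) * Rabs (v - v0)).
  assert (Hc : 0 <= c) by (apply Rmult_le_pos; [lra|apply Rabs_pos]).
  apply is_derive_iff_small. intros eps He.
  set (eta := eps * exp (- c) / 3).
  assert (Heta : 0 < eta).
  { unfold eta. assert (0 < eps * exp (- c)).
    { apply Rmult_lt_0_compat; trivial. apply exp_pos. } lra. }
  set (th := eta / (4 * (M1 + M2))).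
  assert (Hth : 0 < th) by (apply Rdiv_lt_0_compat; lra).
  assert (L1 : locally u (fun s => forall i j t, between v0 v t ->
            Rabs (B i j s t - B i j u t) <= th)).
  { apply (locally_idx u (fun i s => forall j t, between v0 v t ->
            Rabs (B i j s t - B i j u t) <= th)). intros k.
    apply (locally_idx u (fun j s => forall t, between v0 v t ->
            Rabs (B k j s t - B k j u t) <= th)). intros l.
    apply (cont2_uniform_u I J HJ); trivial. now apply smooth_cont2. }
  assert (L2 : locally u (fun s => forall i j t, between v0 v t ->
      Rabs (B i j s t - B i j u t - (s - u) * du (B i j) u t)
      <= th * Rabs (s - u))).
  { apply (locally_idx u (fun i s => forall j t, between v0 v t ->
      Rabs (B i j s t - B i j u t - (s - u) * du (B i j) u t)
      <= th * Rabs (s - u))). intros k.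
    apply (locally_idx u (fun j s => forall t, between v0 v t ->
      Rabs (B k j s t - B k j u t - (s - u) * du (B k j) u t)
      <= th * Rabs (s - u))). intros l.
    now apply (smooth_uniform_derive_u I J HI HJ). }
  assert (L3 : locally u (fun s => forall i,
      Rabs (w i s v0 - w i u v0 - (s - u) * sum4 (fun j => A i j u v0 * w j u v0))
      <= eta * Rabs (s - u))).
  { apply (locally_idx u (fun i s =>
      Rabs (w i s v0 - w i u v0 - (s - u) * sum4 (fun j => A i j u v0 * w j u v0))
      <= eta * Rabs (s - u))). intros k.
    apply (is_derive_iff_small (fun s => w k s v0)); trivial.
    now apply flat_solution_derive_u_v0. }
  generalize (filter_and _ _ (filter_and _ _ L1 L2) (filter_and _ _ L3 BK)).
  apply filter_imp. clear L1 L2 L3 BK.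
  intros s [[L1 L2] [L3 [Is BK]]].
  set (D k t := w k s t - w k u t
                - (s - u) * sum4 (fun j => A k j u t * w j u t)).
  set (r k t :=
    sum4 (fun j => (B k j s t - B k j u t - (s - u) * du (B k j) u t) * w j u t
      + (s - u) * (B k j s t - B k j u t)
        * sum4 (fun l => A j l u t * w l u t))).
  assert (E : sum4 (fun k => D k v ^ 2) + (eta * Rabs (s - u)) ^ 2
    <= (sum4 (fun k => D k v0 ^ 2) + (eta * Rabs (s - u)) ^ 2) * exp c).
  { apply (linear_system_energy (fun k j t => B k j s t) D r).
    - intros k t Ht.
      assert (Jt : J t) by apply (Rt t Ht).
      evar_last.
      + apply (derive_minus
          (fun t => w k s t - w k u t)
          (fun t => (s - u) * sum4 (fun j => A k j u t * w j u t))).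
        * apply (derive_minus
            (fun t => w k s t) (fun t => w k u t)).
          -- apply flat_solution_derive_v. now split.
          -- apply flat_solution_derive_v. now split.
        * apply (is_derive_scal
            (fun t => sum4 (fun j => A k j u t * w j u t)) t (s - u)).
          apply (is_derive_sum4 (fun j t => A k j u t * w j u t)). intros j.
          apply (derive_mult (fun t => A k j u t)
            (fun t => w j u t)).
          -- apply (smooth_is_derive_v (rect I J)); trivial. now split.
          -- apply flat_solution_derive_v. now split.
      + unfold D, r.
        assert (F := fun j => flat k j u t (Rt t Ht)).
        assert (F' : forall j, dv (A k j) u t
          = du (B k j) u t + sum4 (fun l => B k l u t * A l j u t)
            - sum4 (fun l => A k l u t * B l j u t)).
        { intros j. specialize (F j). lra. }
        change (@eq R
          (sum4 (fun j => B k j s t * w j s t) - sum4 (fun j => B k j u t * w j u t)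
           - (s - u) * sum4 (fun j => dv (A k j) u t * w j u t
               + A k j u t * sum4 (fun l => B j l u t * w l u t)))
          (sum4 (fun j => B k j s t * (w j s t - w j u t
                - (s - u) * sum4 (fun l => A j l u t * w l u t)))
           + sum4 (fun j =>
              (B k j s t - B k j u t - (s - u) * du (B k j) u t) * w j u t
              + (s - u) * (B k j s t - B k j u t)
                * sum4 (fun l => A j l u t * w l u t)))).
        unfold sum4 in *. rewrite !F'. ring.
    - intros k j t Ht. now apply BK.
    - intros k t Ht. unfold r.
      replace (eta * Rabs (s - u)) with (4 * (th * (M1 + M2) * Rabs (s - u)))
        by (unfold th; field; lra).
      apply sum4_abs_le. intros j.
      apply Rle_trans with (1 := Rabs_triang _ _). rewrite !Rabs_mult.
      apply Rle_trans with
        (th * Rabs (s - u) * M1 + Rabs (s - u) * th * M2); [|right; ring].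
      apply Rplus_le_compat.
      + apply Rmult_le_compat; auto using Rabs_pos.
      + apply Rmult_le_compat; auto using Rabs_pos.
        * apply Rmult_le_pos; apply Rabs_pos.
        * apply Rmult_le_compat_l; auto using Rabs_pos. }
  assert (E0 : sum4 (fun k => D k v0 ^ 2) <= 4 * (eta * Rabs (s - u)) ^ 2).
  { apply Rle_trans with (1 := Rle_abs _). apply sum4_abs_le. intros k.
    rewrite Rabs_right by (apply Rle_ge, pow2_ge_0).
    rewrite <- pow2_abs. apply pow_incr. split; [apply Rabs_pos|]. apply L3. }
  assert (Ei : D i v ^ 2 <= sum4 (fun k => D k v ^ 2)).
  { apply (sum4_le_pos (fun k => D k v ^ 2)). intros k. apply pow2_ge_0. }
  change (Rabs (D i v) <= eps * Rabs (s - u)).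
  apply Rsqr_incr_0_var.
  2:{ apply Rmult_le_pos; [lra|apply Rabs_pos]. }
  rewrite <- Rsqr_abs, !Rsqr_pow2.
  assert (Pe := exp_pos c).
  assert (exp c * exp (- c) = 1).
  { rewrite <- exp_plus. replace (c + - c) with 0 by ring. apply exp_0. }
  assert (exp (- c) <= 1).
  { rewrite <- exp_0. apply exp_le_exp. lra. }
  assert (Q := pow2_ge_0 (eta * Rabs (s - u))).
  apply Rle_trans with (5 * (eta * Rabs (s - u)) ^ 2 * exp c).
  { apply (Rmult_le_compat_r (exp c)) in E0; [|lra]. lra. }
  replace (5 * (eta * Rabs (s - u)) ^ 2 * exp c)
    with (5 / 9 * (eps * Rabs (s - u)) ^ 2 * exp (- c) * (exp c * exp (- c)))
    by (unfold eta; field).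
  rewrite H, Rmult_1_r.
  assert (Q' := pow2_ge_0 (eps * Rabs (s - u))).
  assert (0 < exp (- c)) by apply exp_pos. nra.
Qed.

(** Along vertical lines the increments of [w] are controlled by the energy
    estimate, uniformly in [u], so that separate continuity gives joint
    continuity. *)
Lemma flat_solution_cont2 i : cont2_on (rect I J) (w i).
Proof.
  intros u v [Hu Hv].
  destruct (open_interval_open J v HJ Hv) as [d Hd].
  assert (Hd0 := cond_pos d).
  assert (Hin : forall t, Rabs (t - v) < d -> J t) by exact Hd.
  assert (J1 : J (v - d / 2)) by (apply Hin, Rabs_def1; lra).
  assert (J2 : J (v + d / 2)) by (apply Hin, Rabs_def1; lra).
  destruct (coefficients_bounded_near u _ _ Hu J1 J2) as (K & HK & BK).
  set (c := 8 * K + 4).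
  set (rho := 4 * (K * sum4 (fun j => Rabs (w j u v)))).
  set (S s := sum4 (fun j => (w j s v - w j u v) ^ 2)).
  set (G := fun p : R * R =>
    (S (fst p) + rho ^ 2) * exp (c * Rabs (snd p - v))).
  (* the energy estimate bounds the increment of [w] by this function *)
  assert (HG : continuous G (u, v)).
  { apply (continuous_mult (K := R_AbsRing)).
    - apply (continuous_comp fst (fun s => S s + rho ^ 2)).
      + apply continuous_fst.
      + apply (continuous_plus (V := R_NormedModule)); [|apply continuous_const].
        apply (continuous_sum4 (fun j s => (w j s v - w j u v) ^ 2)). intros j.
        apply (continuous_comp (fun s => w j s v - w j u v) (fun y => y ^ 2)).
        * apply (continuous_minus (V := R_NormedModule) (fun s => w j s v)).
          -- eapply is_derive_continuous. apply flat_solution_derive_u. now split.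
          -- apply continuous_const.
        * apply (ex_derive_continuous (K := R_AbsRing) (V := R_NormedModule)).
          auto_derive. trivial.
    - apply (continuous_comp snd (fun t => exp (c * Rabs (t - v)))).
      + apply continuous_snd.
      + apply (continuous_comp (fun t => c * Rabs (t - v)) exp).
        * apply (continuous_mult (K := R_AbsRing) (fun _ : R => c)
                   (fun t => Rabs (t - v))); [apply continuous_const|].
          apply (continuous_comp (fun t => t - v) Rabs).
          -- apply (continuous_minus (V := R_NormedModule) (fun t => t)).
             ++ apply continuous_id.
             ++ apply continuous_const.
          -- apply continuous_Rabs.
        * apply continuous_exp. }
  apply (continuity_2d_pt_filterlim (w i)). intros eps.
  apply locally_2d_locally.
  assert (He : 0 < eps ^ 2) by (apply pow_lt, cond_pos).
  apply filterlim_locally with (eps := mkposreal _ He) in HG.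
  destruct BK as [d1 BK].
  assert (Hd2 : 0 < d / 2) by lra.
  assert (LB : locally (u, v) (fun p : R * R =>
            ball u d1 (fst p) /\ ball v (mkposreal _ Hd2) (snd p))).
  { apply (locally_2d_locally (fun s t => ball u d1 s /\ ball v (mkposreal _ Hd2) t)).
    exists (mkposreal _ (Rmin_pos _ _ (cond_pos d1) Hd2)). simpl.
    intros s t Hs Ht. split.
    - apply Rlt_le_trans with (1 := Hs). apply Rmin_l.
    - apply Rlt_le_trans with (1 := Ht). apply Rmin_r. }
  generalize (filter_and _ _ HG LB). apply filter_imp. clear HG LB.
  intros [s t] [HG [Hs Ht]]. simpl fst in *. simpl snd in *.
  change (Rabs (G (s, t) - G (u, v)) < eps ^ 2) in HG.
  change (Rabs (t - v) < d / 2) in Ht.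
  destruct (BK s Hs) as [Is Bs]. clear BK.
  replace (G (u, v)) with (rho ^ 2) in HG.
  2:{ unfold G, S, sum4. simpl fst. simpl snd.
      rewrite !Rminus_diag, Rabs_R0, Rmult_0_r, exp_0. ring. }
  assert (Bt : forall y, between v t y -> between (v - d / 2) (v + d / 2) y).
  { intros y Hy. apply between_abs in Hy.
    assert (Hy' : Rabs (y - v) < d / 2) by lra.
    apply Rabs_def2 in Hy'.
    unfold between. rewrite Rmin_left, Rmax_right; lra. }
  assert (E : sum4 (fun j => (w j s t - w j u v) ^ 2) + rho ^ 2 <= G (s, t)).
  { refine (linear_system_energy (fun i j t => B i j s t)
      (fun j t => w j s t - w j u v)
      (fun i t => sum4 (fun j => B i j s t * w j u v)) v t K rho _ _ _).
    - intros k y Hy. specialize (Bt y Hy).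
      assert (Jy : J y) by now apply (open_interval_between J _ _ y HJ J1 J2).
      evar_last.
      + apply (derive_minus
                 (fun t => w k s t) (fun _ => w k u v)).
        * apply flat_solution_derive_v. now split.
        * apply (derive_const).
      + change (@eq R (sum4 (fun j => B k j s y * w j s y) - 0)
          (sum4 (fun j => B k j s y * (w j s y - w j u v)) +
           sum4 (fun j => B k j s y * w j u v))).
        unfold sum4. ring.
    - intros k l y Hy. now apply Bs, Bt.
    - intros k y Hy. apply sum4_abs_le. intros j. rewrite Rabs_mult.
      apply Rmult_le_compat; auto using Rabs_pos.
      apply (sum4_le_pos (fun j => Rabs (w j u v))). intros l. apply Rabs_pos. }
  assert (Ei : (w i s t - w i u v) ^ 2
               <= sum4 (fun j => (w j s t - w j u v) ^ 2)).
  { apply (sum4_le_pos (fun j => (w j s t - w j u v) ^ 2)).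
    intros j. apply pow2_ge_0. }
  apply Rabs_def2 in HG.
  apply Rsqr_incrst_0; [|apply Rabs_pos|left; apply cond_pos].
  rewrite <- Rsqr_abs, !Rsqr_pow2. lra.
Qed.

(** Bootstrapping: the partial derivatives of [w] are [A w] and [B w], hence as
    regular as [w] itself. *)
Lemma flat_solution_smooth i : smooth_on (rect I J) (w i).
Proof.
  assert (HR := rect_open I J HI HJ).
  intros n. revert i. induction n as [|n IH]; intros i.
  - split; [|exact Logic.I]. apply flat_solution_cont2.
  - assert (S : forall C : idx -> idx -> R -> R -> R,
      (forall i j, smooth_on (rect I J) (C i j)) ->
      Cn_on n (rect I J) (fun u v => sum4 (fun j => C i j u v * w j u v))).
    { intros C HC. unfold sum4.
      repeat apply Cn_plus; trivial; apply Cn_mult; trivial; apply HC. }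
    apply (Cn_intro n _ _ (fun u v => sum4 (fun j => A i j u v * w j u v))
             (fun u v => sum4 (fun j => B i j u v * w j u v))); auto.
    + apply flat_solution_cont2.
    + intros u v. apply flat_solution_derive_u.
    + intros u v. apply flat_solution_derive_v.
Qed.

End Flat.

(** * Functions on a rectangle determined by their partial derivatives *)

Lemma rect_constant I J f u0 v0 u v :
  is_open_interval I -> is_open_interval J ->
  (forall u v, rect I J u v ->
     is_derive (fun s => f s v) u 0 /\ is_derive (fun t => f u t) v 0) ->
  rect I J u0 v0 -> rect I J u v -> f u v = f u0 v0.
Proof.
  intros HI HJ Hf [Hu0 Hv0] [Hu Hv].
  transitivity (f u v0).
  - apply (derive_zero_const (fun t => f u t)). intros t Ht. apply Hf.
    split; trivial. now apply (open_interval_between J v0 v).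
  - apply (derive_zero_const (fun s => f s v0)). intros s Hs. apply (Hf s v0).
    split; trivial. now apply (open_interval_between I u0 u).
Qed.

Lemma cont2_of_partials D f fu fv : open_plane D ->
  (forall u v, D u v -> is_derive (fun s => f s v) u (fu u v)) ->
  (forall u v, D u v -> is_derive (fun t => f u t) v (fv u v)) ->
  cont2_on D fu -> cont2_on D f.
Proof.
  intros HD Hu Hv Hc u v Huv.
  apply (filterdiff_continuous (K := R_AbsRing)
           (fun p : R * R => f (fst p) (snd p)) (u, v)).
  eexists. apply (is_derive_filterdiff f u v fu (fv u v)).
  - generalize (HD (u, v) Huv). apply filter_imp. intros [s t] H. now apply Hu.
  - now apply Hv.
  - now apply Hc.
Qed.

(** The primitive of the closed form [P du + Q dv] along the broken line from
    [(u0, v0)] through [(u, v0)] to [(u, v)]. *)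
Definition path_primitive (P Q : R -> R -> R) (u0 v0 u v : R) : R :=
  RInt (fun s => P s v0) u0 u + RInt (fun t => Q u t) v0 v.

Section Primitive.

Variables (I J : R -> Prop) (P Q : R -> R -> R) (u0 v0 : R).
Hypotheses (HI : is_open_interval I) (HJ : is_open_interval J).
Hypotheses (HP : smooth_on (rect I J) P) (HQ : smooth_on (rect I J) Q).
Hypothesis closed_form : forall u v, rect I J u v -> dv P u v = du Q u v.
Hypothesis H0 : rect I J u0 v0.

Lemma path_primitive_derive_v u v : rect I J u v ->
  is_derive (fun t => path_primitive P Q u0 v0 u t) v (Q u v).
Proof.
  intros [Hu Hv]. evar_last.
  - apply (derive_plus
             (fun _ => RInt (fun s => P s v0) u0 u)).
    + apply (derive_const).
    + apply (is_derive_RInt_interval J (fun t => Q u t)); trivial; [|apply H0].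
      intros t Ht. apply (cont2_continuous_v (rect I J)).
      * now apply smooth_cont2.
      * now split.
  - apply Rplus_0_l.
Qed.

Lemma path_primitive_derive_u u v : rect I J u v ->
  is_derive (fun s => path_primitive P Q u0 v0 s v) u (P u v).
Proof.
  intros [Hu Hv].
  assert (HR := rect_open I J HI HJ).
  destruct H0 as [Hu0 Hv0].
  assert (Jt : forall t, between v0 v t -> J t).
  { intros t. now apply (open_interval_between J v0 v). }
  evar_last.
  - apply (derive_plus
             (fun s => RInt (fun s => P s v0) u0 s)
             (fun s => RInt (fun t => Q s t) v0 v)).
    + apply (is_derive_RInt_interval I (fun s => P s v0)); trivial.
      intros s Hs. apply (cont2_continuous_u (rect I J) P).
      * now apply smooth_cont2.
      * now split.
    + apply (is_derive_RInt_param (fun s t => Q s t)).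
      * generalize (open_interval_open I u HI Hu). apply filter_imp.
        intros s Hs t Ht. exists (du Q s t).
        apply (smooth_is_derive_u (rect I J)); trivial. split; auto.
      * intros t Ht. apply (cont2_continuity_2d_pt (rect I J) (du Q)).
        -- apply smooth_cont2. now apply smooth_du.
        -- split; auto.
      * generalize (open_interval_open I u HI Hu). apply filter_imp.
        intros s Hs. apply (ex_RInt_continuous (V := R_CompleteNormedModule)).
        intros t Ht. apply (cont2_continuous_v (rect I J)).
        -- now apply smooth_cont2.
        -- split; auto.
  - change (@eq R (P u v0 + RInt (fun t => du Q u t) v0 v) (P u v)).
    rewrite (RInt_ext _ (Derive (fun t => P u t))).
    + rewrite RInt_Derive.
      * ring.
      * intros t Ht. exists (dv P u t).
        apply (smooth_is_derive_v (rect I J)); trivial. split; auto.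
      * intros t Ht.
        apply (cont2_continuous_v (rect I J) (dv P)).
        -- apply smooth_cont2. now apply smooth_dv.
        -- split; auto.
    + intros t Ht. symmetry. apply (closed_form u t). split; trivial.
      apply Jt. unfold between. lra.
Qed.

Lemma path_primitive_smooth : smooth_on (rect I J) (path_primitive P Q u0 v0).
Proof.
  assert (HR := rect_open I J HI HJ).
  assert (Hc : cont2_on (rect I J) (path_primitive P Q u0 v0)).
  { apply (cont2_of_partials _ _ P Q); trivial.
    - intros u v. apply path_primitive_derive_u.
    - intros u v. apply path_primitive_derive_v.
    - now apply smooth_cont2. }
  intros [|n].
  - split; [exact Hc|exact Logic.I].
  - apply (Cn_intro n _ _ P Q); trivial.
    + intros u v. apply path_primitive_derive_u.
    + intros u v. apply path_primitive_derive_v.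
Qed.

End Primitive.

(** Uniqueness for the Goursat problem [p_v = a p + b q], [q_u = c p + d q] with
    [p] given on a horizontal and [q] on a vertical line.  In the weight
    [e^(4K(|u-u0|+|v-v0|))], with [K] a bound of the coefficients, the
    integrations along [v] and [u] halve the bound of the difference of two
    solutions. *)
Lemma goursat_unique I J a b c d p q u0 v0 :
  is_open_interval I -> is_open_interval J -> rect I J u0 v0 ->
  cont2_on (rect I J) a -> cont2_on (rect I J) b ->
  cont2_on (rect I J) c -> cont2_on (rect I J) d ->
  cont2_on (rect I J) p -> cont2_on (rect I J) q ->
  (forall u v, rect I J u v ->
     is_derive (fun t => p u t) v (a u v * p u v + b u v * q u v)) ->
  (forall u v, rect I J u v ->
     is_derive (fun s => q s v) u (c u v * p u v + d u v * q u v)) ->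
  (forall u, I u -> p u v0 = 0) -> (forall v, J v -> q u0 v = 0) ->
  forall u v, rect I J u v -> p u v = 0 /\ q u v = 0.
Proof.
  intros HI HJ [Hu0 Hv0] Ca Cb Cc Cd Cp Cq Hp Hq Hp0 Hq0 u1 v1 [Hu1 Hv1].
  assert (box : forall s t, between u0 u1 s -> between v0 v1 t -> rect I J s t).
  { intros s t Hs Ht. split.
    - now apply (open_interval_between I u0 u1).
    - now apply (open_interval_between J v0 v1). }
  destruct (cont2_bounded_box _ a u0 u1 v0 v1 Ca box) as (Ka & Pa & Ba).
  destruct (cont2_bounded_box _ b u0 u1 v0 v1 Cb box) as (Kb & Pb & Bb).
  destruct (cont2_bounded_box _ c u0 u1 v0 v1 Cc box) as (Kc & Pc & Bc).
  destruct (cont2_bounded_box _ d u0 u1 v0 v1 Cd box) as (Kd & Pd & Bd).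
  destruct (cont2_bounded_box _ p u0 u1 v0 v1 Cp box) as (Mp & Pp & Bp).
  destruct (cont2_bounded_box _ q u0 u1 v0 v1 Cq box) as (Mq & Pq & Bq).
  set (K := Ka + Kb + Kc + Kd). set (M := Mp + Mq).
  assert (HK : 0 < K) by (unfold K; lra). assert (HM : 0 < M) by (unfold M; lra).
  set (W s t := exp (4 * K * Rabs (s - u0)) * exp (4 * K * Rabs (t - v0))).
  assert (W1 : forall x y, 1 <= exp (4 * K * Rabs (x - y))).
  { intros x y. rewrite <- exp_0 at 1. apply exp_le_exp.
    apply Rmult_le_pos; [lra|apply Rabs_pos]. }
  assert (comb : forall f g x y S, Rabs f <= K -> Rabs g <= K ->
            Rabs x <= S -> Rabs y <= S ->
            Rabs (f * x + g * y) <= 2 * K * S).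
  { intros f g x y S Hf Hg Hx Hy.
    apply Rle_trans with (1 := Rabs_triang _ _). rewrite !Rabs_mult.
    assert (Rabs f * Rabs x <= K * S) by (apply Rmult_le_compat; auto using Rabs_pos).
    assert (Rabs g * Rabs y <= K * S) by (apply Rmult_le_compat; auto using Rabs_pos).
    lra. }
  assert (halve : forall n s t, between u0 u1 s -> between v0 v1 t ->
    Rabs (p s t) <= M * (1 / 2) ^ n * W s t /\
    Rabs (q s t) <= M * (1 / 2) ^ n * W s t).
  { induction n as [|n IH]; intros s t Hs Ht.
    - assert (1 <= W s t).
      { unfold W. rewrite <- (Rmult_1_l 1).
        apply Rmult_le_compat; auto; lra. }
      specialize (Bp s t Hs Ht). specialize (Bq s t Hs Ht).
      simpl. rewrite Rmult_1_r.
      assert (M * 1 <= M * W s t) by (apply Rmult_le_compat_l; lra).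
      unfold M in *. split; lra.
    - split.
      + replace (M * (1 / 2) ^ S n * W s t) with
          (2 * K * (M * (1 / 2) ^ n * exp (4 * K * Rabs (s - u0))) / (4 * K)
           * exp (4 * K * Rabs (t - v0)))
          by (unfold W; simpl; field; lra).
        apply (exp_weight_integral (fun t => p s t)
          (fun t => a s t * p s t + b s t * q s t) v0 t).
        * lra.
        * apply Hp0. now apply (open_interval_between I u0 u1).
        * intros y Hy. apply Hp. apply box; trivial.
          now apply (between_trans v0 v1 t).
        * intros y Hy.
          assert (Hy' : between v0 v1 y) by now apply (between_trans v0 v1 t).
          destruct (IH s y Hs Hy') as [Ep Eq].
          specialize (Ba s y Hs Hy'). specialize (Bb s y Hs Hy').
          rewrite Rmult_assoc, (Rmult_assoc (M * _)).
          apply comb; trivial; unfold K; lra.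
      + replace (M * (1 / 2) ^ S n * W s t) with
          (2 * K * (M * (1 / 2) ^ n * exp (4 * K * Rabs (t - v0))) / (4 * K)
           * exp (4 * K * Rabs (s - u0)))
          by (unfold W; simpl; field; lra).
        apply (exp_weight_integral (fun s => q s t)
          (fun s => c s t * p s t + d s t * q s t) u0 s).
        * lra.
        * apply Hq0. now apply (open_interval_between J v0 v1).
        * intros y Hy. apply Hq. apply box; trivial.
          now apply (between_trans u0 u1 s).
        * intros y Hy.
          assert (Hy' : between u0 u1 y) by now apply (between_trans u0 u1 s).
          destruct (IH y t Hy' Ht) as [Ep Eq].
          specialize (Bc y t Hy' Ht). specialize (Bd y t Hy' Ht).
          rewrite Rmult_assoc, (Rmult_assoc (M * _)),
            (Rmult_comm (exp (4 * K * Rabs (t - v0)))).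
          apply comb; trivial; unfold K; lra. }
  assert (zero : forall x C, 0 <= C -> (forall n, Rabs x <= C * (1 / 2) ^ n) -> x = 0).
  { intros x C HC Hx. destruct (Req_dec x 0) as [E|E]; trivial. exfalso.
    destruct (pow_lt_1_zero (1 / 2)) with (y := Rabs x / (C + 1)) as [N HN].
    - rewrite Rabs_right; lra.
    - apply Rdiv_lt_0_compat; [now apply Rabs_pos_lt|lra].
    - specialize (HN N (le_n N)). specialize (Hx N).
      rewrite Rabs_right in HN by (apply Rle_ge, pow_le; lra).
      apply (Rmult_lt_compat_l (C + 1)) in HN; [|lra].
      replace ((C + 1) * (Rabs x / (C + 1))) with (Rabs x) in HN by (field; lra).
      assert (0 <= (1 / 2) ^ N) by (apply pow_le; lra). lra. }
  assert (HW : 0 <= M * W u1 v1).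
  { apply Rmult_le_pos; [lra|]. unfold W. apply Rmult_le_pos; left; apply exp_pos. }
  split; apply (zero _ (M * W u1 v1) HW); intros n;
    destruct (halve n u1 v1 (between_end _ _) (between_end _ _)); lra.
Qed.

(** * Orthonormal frames *)

Definition coord (k : idx) (p : R4) : R :=
  match k with i1 => X1 p | i2 => X2 p | i3 => X3 p | i4 => X4 p end.

Definition vec (c : idx -> R) : R4 := (c i1, c i2, c i3, c i4).

Definition kron (i j : idx) : R :=
  match i, j with
  | i1, i1 | i2, i2 | i3, i3 | i4, i4 => 1
  | _, _ => 0
  end.

Lemma R4_ext p q : (forall k, coord k p = coord k q) -> p = q.
Proof.
  intros H. destruct p as [[[a b] c] d], q as [[[a' b'] c'] d'].
  assert (H1 := H i1). assert (H2 := H i2). assert (H3 := H i3).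
  assert (H4 := H i4). unfold coord, X1, X2, X3, X4 in *. simpl in *. congruence.
Qed.

Lemma coord_vec k c : coord k (vec c) = c k.
Proof. now destruct k. Qed.

Lemma dot_sum4 p q : dot p q = sum4 (fun k => coord k p * coord k q).
Proof. reflexivity. Qed.

(** The sums of the squares of the entries of [F F^T - 1] and of [F^T F - 1] are
    equal, so that both matrices vanish together. *)
Lemma orthonormal_columns_rows (F : idx -> idx -> R) :
  (forall k l, sum4 (fun i => F i k * F i l) = kron k l) ->
  forall i j, sum4 (fun k => F i k * F j k) = kron i j.
Proof.
  intros H.
  set (rowdef i j := (sum4 (fun k => F i k * F j k) - kron i j) ^ 2).
  set (coldef k l := (sum4 (fun i => F i k * F i l) - kron k l) ^ 2).
  assert (E : sum4 (fun i => sum4 (fun j => rowdef i j))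
              = sum4 (fun k => sum4 (fun l => coldef k l))).
  { unfold rowdef, coldef, sum4, kron. ring. }
  assert (Z : sum4 (fun k => sum4 (fun l => coldef k l)) = 0).
  { unfold coldef. rewrite (sum4_ext _ (fun _ => 0)).
    - unfold sum4. ring.
    - intros k. rewrite (sum4_ext _ (fun _ => 0)).
      + unfold sum4. ring.
      + intros l. rewrite H. ring. }
  rewrite Z in E. intros i j.
  assert (P : forall i j, 0 <= rowdef i j) by (intros; apply pow2_ge_0).
  assert (Q : forall i, 0 <= sum4 (fun j => rowdef i j)).
  { intros k. unfold sum4. assert (H1 := P k i1). assert (H2 := P k i2).
    assert (H3 := P k i3). assert (H4 := P k i4). lra. }
  assert (L1 := sum4_le_pos (fun i => sum4 (fun j => rowdef i j)) i Q).
  assert (L2 := sum4_le_pos (fun j => rowdef i j) j (P i)).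
  simpl in L1, L2. assert (L3 := P i j).
  assert (R : rowdef i j = 0) by lra. unfold rowdef in R.
  apply Rmult_integral in R. destruct R as [R|R]; lra.
Qed.

Lemma det4_mult (M : idx -> R4) p q r s :
  det4 (vec (fun i => dot (M i) p)) (vec (fun i => dot (M i) q))
       (vec (fun i => dot (M i) r)) (vec (fun i => dot (M i) s))
  = det4 (M i1) (M i2) (M i3) (M i4) * det4 p q r s.
Proof.
  destruct (M i1) as [[[a1 a2] a3] a4] eqn:E1.
  destruct (M i2) as [[[b1 b2] b3] b4] eqn:E2.
  destruct (M i3) as [[[c1 c2] c3] c4] eqn:E3.
  destruct (M i4) as [[[d1 d2] d3] d4] eqn:E4.
  destruct p as [[[p1 p2] p3] p4]. destruct q as [[[q1 q2] q3] q4].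
  destruct r as [[[r1 r2] r3] r4]. destruct s as [[[s1 s2] s3] s4].
  unfold vec, dot, det4, det2. rewrite E1, E2, E3, E4.
  unfold X1, X2, X3, X4. cbn [fst snd].
  ring.
Qed.

Lemma coord_plus k (p q : R4) : coord k (plus p q) = coord k p + coord k q.
Proof. now destruct k. Qed.

Lemma coord_minus k (p q : R4) : coord k (minus p q) = coord k p - coord k q.
Proof. now destruct k. Qed.

Lemma coord_scal k a (p : R4) : coord k (scal a p) = a * coord k p.
Proof. now destruct k. Qed.

Lemma coord_zero k : coord k (zero : R4) = 0.
Proof. now destruct k. Qed.

Definition orthonormal_columns (F : idx -> R4) : Prop :=
  forall k l, sum4 (fun i => coord k (F i) * coord l (F i)) = kron k l.

Lemma orthonormal_columns_dot F i j :
  orthonormal_columns F -> dot (F i) (F j) = kron i j.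
Proof.
  intros H. rewrite dot_sum4.
  apply (orthonormal_columns_rows (fun i k => coord k (F i))). exact H.
Qed.

Lemma orthonormal_dot_columns F :
  (forall i j, dot (F i) (F j) = kron i j) -> orthonormal_columns F.
Proof.
  intros H k l.
  apply (orthonormal_columns_rows (fun k i => coord k (F i))).
  intros i j. rewrite <- H. apply dot_sum4.
Qed.

Lemma orthonormal_expansion F (p : R4) k : orthonormal_columns F ->
  coord k p = sum4 (fun i => dot p (F i) * coord k (F i)).
Proof.
  intros H.
  transitivity (sum4 (fun l => coord l p *
                  sum4 (fun i => coord k (F i) * coord l (F i)))).
  - rewrite (sum4_ext _ (fun l => coord l p * kron k l)).
    + unfold sum4, kron. destruct k; ring.
    + intros l. now rewrite H.
  - rewrite (sum4_ext (fun i => dot p (F i) * _)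
      (fun i => sum4 (fun l => coord l p * coord l (F i)) * coord k (F i)))
      by (intros i; now rewrite dot_sum4).
    unfold sum4. ring.
Qed.

(** For orthonormal frames, with the vectors as rows, this is the rotation
    [F'^T F]. *)
Definition frame_map (F F' : idx -> R4) (q : R4) : R4 :=
  vec (fun k => sum4 (fun i => dot (F i) q * coord k (F' i))).

Lemma frame_map_norm F F' q :
  orthonormal_columns F -> orthonormal_columns F' ->
  dot (frame_map F F' q) (frame_map F F' q) = dot q q.
Proof.
  intros HF HF'. rewrite !dot_sum4. unfold frame_map.
  rewrite (sum4_ext (fun k => coord k (vec _) * _)
    (fun k => sum4 (fun i => dot (F i) q * coord k (F' i)) *
              sum4 (fun i => dot (F i) q * coord k (F' i))))
    by (intros k; now rewrite coord_vec).
  transitivity (sum4 (fun i => sum4 (fun j =>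
    dot (F i) q * dot (F j) q * dot (F' i) (F' j)))).
  { unfold dot, sum4, coord. ring. }
  transitivity (sum4 (fun i => dot (F i) q * dot (F i) q)).
  { rewrite (sum4_ext _ (fun i => sum4 (fun j =>
      dot (F i) q * dot (F j) q * kron i j))).
    - unfold sum4, kron. ring.
    - intros i. apply sum4_ext. intros j.
      now rewrite (orthonormal_columns_dot F' i j HF'). }
  transitivity (sum4 (fun k => sum4 (fun l => coord k q * coord l q *
    sum4 (fun i => coord k (F i) * coord l (F i))))).
  { unfold dot, sum4, coord. ring. }
  rewrite (sum4_ext _ (fun k => sum4 (fun l => coord k q * coord l q * kron k l))).
  - unfold sum4, kron. ring.
  - intros k. apply sum4_ext. intros l. now rewrite HF.
Qed.

Lemma det4_transpose (F : idx -> R4) :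
  det4 (vec (fun i => coord i1 (F i))) (vec (fun i => coord i2 (F i)))
       (vec (fun i => coord i3 (F i))) (vec (fun i => coord i4 (F i)))
  = det4 (F i1) (F i2) (F i3) (F i4).
Proof. unfold vec, det4, det2, coord, X1, X2, X3, X4. cbn [fst snd]. ring. Qed.

Lemma frame_map_det F F' p q r s :
  det4 (frame_map F F' p) (frame_map F F' q)
       (frame_map F F' r) (frame_map F F' s)
  = det4 (F' i1) (F' i2) (F' i3) (F' i4) *
    (det4 (F i1) (F i2) (F i3) (F i4) * det4 p q r s).
Proof.
  rewrite <- (det4_transpose F'), <- det4_mult.
  rewrite <- (det4_mult (fun k => match k with
    | i1 => vec (fun i => coord i1 (F' i)) | i2 => vec (fun i => coord i2 (F' i))
    | i3 => vec (fun i => coord i3 (F' i)) | i4 => vec (fun i => coord i4 (F' i))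
    end)).
  assert (E : forall x, frame_map F F' x = vec (fun k => dot (match k with
    | i1 => vec (fun i => coord i1 (F' i)) | i2 => vec (fun i => coord i2 (F' i))
    | i3 => vec (fun i => coord i3 (F' i)) | i4 => vec (fun i => coord i4 (F' i))
    end) (vec (fun i => dot (F i) x)))).
  { intros x. apply R4_ext. intros k. unfold frame_map. rewrite !coord_vec.
    rewrite dot_sum4. apply sum4_ext. intros i. rewrite coord_vec.
    destruct k; rewrite coord_vec; ring. }
  now rewrite !E.
Qed.

Definition frame_motion (z z' : R4) (F F' : idx -> R4) (p : R4) : R4 :=
  plus z' (frame_map F F' (minus p z)).

Lemma frame_motion_diff z z' F F' p q :
  minus (frame_motion z z' F F' p) (frame_motion z z' F F' q)
  = frame_map F F' (minus p q).
Proof.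
  apply R4_ext. intros k. unfold frame_motion.
  rewrite coord_minus, !coord_plus. unfold frame_map. rewrite !coord_vec.
  unfold sum4. rewrite !dot_sum4. unfold sum4. rewrite !coord_minus. ring.
Qed.

Lemma frame_motion_motion z z' F F' :
  orthonormal_columns F -> orthonormal_columns F' ->
  0 < det4 (F i1) (F i2) (F i3) (F i4) ->
  0 < det4 (F' i1) (F' i2) (F' i3) (F' i4) ->
  motion (frame_motion z z' F F').
Proof.
  intros HF HF' HD HD'. split.
  - intros p q. rewrite frame_motion_diff. unfold enorm.
    now rewrite frame_map_norm.
  - intros o p q r s Hpos. rewrite !frame_motion_diff.
    assert (E : forall x : R4, minus (plus o x) o = x).
    { intros x. apply R4_ext. intros k. rewrite coord_minus, coord_plus. ring. }
    rewrite !E, frame_map_det.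
    repeat apply Rmult_lt_0_compat; trivial.
Qed.

(** * Moving frames *)

Definition skew_on (D : R -> R -> Prop) (A : idx -> idx -> R -> R -> R) : Prop :=
  forall i j u v, D u v -> A i j u v = - A j i u v.

Definition moving_frame D (A B : idx -> idx -> R -> R -> R)
    (F : idx -> R -> R -> R4) : Prop :=
  forall i k u v, D u v ->
    is_derive (fun s => coord k (F i s v)) u
      (sum4 (fun j => A i j u v * coord k (F j u v))) /\
    is_derive (fun t => coord k (F i u t)) v
      (sum4 (fun j => B i j u v * coord k (F j u v))).

Lemma skew_bilinear_zero (A : idx -> idx -> R) (f g : idx -> R) :
  (forall i j, A i j = - A j i) ->
  sum4 (fun i => sum4 (fun j => A i j * f j) * g i
                 + f i * sum4 (fun j => A i j * g j)) = 0.
Proof.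
  intros H.
  assert (D : forall i, A i i = 0) by (intros i; specialize (H i i); lra).
  unfold sum4.
  rewrite !D, (H i2 i1), (H i3 i1), (H i4 i1), (H i3 i2), (H i4 i2), (H i4 i3).
  ring.
Qed.

(** The partial derivatives of [F^T F'] are [F^T (A^T + A) F'] and
    [F^T (B^T + B) F'], which vanish by skewness.  With [F' = F] this is the
    conservation of orthonormality; in general it says that the two frames differ
    by a fixed rotation. *)
Lemma moving_frame_transition I J A B F F' u0 v0 :
  is_open_interval I -> is_open_interval J -> rect I J u0 v0 ->
  skew_on (rect I J) A -> skew_on (rect I J) B ->
  moving_frame (rect I J) A B F -> moving_frame (rect I J) A B F' ->
  forall k l u v, rect I J u v ->
    sum4 (fun i => coord k (F i u v) * coord l (F' i u v))
    = sum4 (fun i => coord k (F i u0 v0) * coord l (F' i u0 v0)).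
Proof.
  intros HI HJ H0 SA SB HF HF' k l u v Huv.
  apply (rect_constant I J
    (fun u v => sum4 (fun i => coord k (F i u v) * coord l (F' i u v)))); trivial.
  clear u v Huv. intros u v Huv. split.
  - rewrite <- (skew_bilinear_zero (fun i j => A i j u v)
      (fun i => coord k (F i u v)) (fun i => coord l (F' i u v)))
      by (intros i j; now apply SA).
    apply (is_derive_sum4 (fun i s => coord k (F i s v) * coord l (F' i s v))).
    intros i. apply (derive_mult (fun s => coord k (F i s v))
                (fun s => coord l (F' i s v))).
    + now apply HF.
    + now apply HF'.
  - rewrite <- (skew_bilinear_zero (fun i j => B i j u v)
      (fun i => coord k (F i u v)) (fun i => coord l (F' i u v)))
      by (intros i j; now apply SB).
    apply (is_derive_sum4 (fun i t => coord k (F i u t) * coord l (F' i u t))).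
    intros i. apply (derive_mult (fun t => coord k (F i u t))
                (fun t => coord l (F' i u t))).
    + now apply HF.
    + now apply HF'.
Qed.

(** The derivative of the determinant is [tr A] times the determinant, and a skew
    matrix has trace zero. *)
Lemma is_derive_det4_skew (f : idx -> R -> R4) (A : idx -> idx -> R) t :
  (forall i j, A i j = - A j i) ->
  (forall i k, is_derive (fun s => coord k (f i s)) t
                 (sum4 (fun j => A i j * coord k (f j t)))) ->
  is_derive (fun s => det4 (f i1 s) (f i2 s) (f i3 s) (f i4 s)) t 0.
Proof.
  intros HA Hf.
  assert (D : forall i, A i i = 0) by (intros i; specialize (HA i i); lra).
  set (g i k s := coord k (f i s)).
  assert (Hg : forall i k, is_derive (g i k) t (sum4 (fun j => A i j * g j k t)))
    by exact Hf.
  apply (is_derive_ext (fun s =>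
      det2 (g i1 i1 s) (g i1 i2 s) (g i2 i1 s) (g i2 i2 s)
      * det2 (g i3 i3 s) (g i3 i4 s) (g i4 i3 s) (g i4 i4 s)
    - det2 (g i1 i1 s) (g i1 i3 s) (g i2 i1 s) (g i2 i3 s)
      * det2 (g i3 i2 s) (g i3 i4 s) (g i4 i2 s) (g i4 i4 s)
    + det2 (g i1 i1 s) (g i1 i4 s) (g i2 i1 s) (g i2 i4 s)
      * det2 (g i3 i2 s) (g i3 i3 s) (g i4 i2 s) (g i4 i3 s)
    + det2 (g i1 i2 s) (g i1 i3 s) (g i2 i2 s) (g i2 i3 s)
      * det2 (g i3 i1 s) (g i3 i4 s) (g i4 i1 s) (g i4 i4 s)
    - det2 (g i1 i2 s) (g i1 i4 s) (g i2 i2 s) (g i2 i4 s)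
      * det2 (g i3 i1 s) (g i3 i3 s) (g i4 i1 s) (g i4 i3 s)
    + det2 (g i1 i3 s) (g i1 i4 s) (g i2 i3 s) (g i2 i4 s)
      * det2 (g i3 i1 s) (g i3 i2 s) (g i4 i1 s) (g i4 i2 s))).
  { intros s. reflexivity. }
  clearbody g. clear Hf. unfold det2.
  assert (E : forall i k, Derive (g i k) t = sum4 (fun j => A i j * g j k t)).
  { intros i k. apply is_derive_unique, Hg. }
  auto_derive.
  - repeat split; eexists; apply Hg.
  - assert (E' : forall i k, Derive (fun x => g i k x) t
                   = sum4 (fun j => A i j * g j k t)) by exact E.
    rewrite !E'. unfold sum4. rewrite !D.
    rewrite (HA i2 i1), (HA i3 i1), (HA i4 i1), (HA i3 i2), (HA i4 i2), (HA i4 i3).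
    ring.
Qed.

Lemma moving_frame_det I J A B F u0 v0 :
  is_open_interval I -> is_open_interval J -> rect I J u0 v0 ->
  skew_on (rect I J) A -> skew_on (rect I J) B ->
  moving_frame (rect I J) A B F ->
  forall u v, rect I J u v ->
    det4 (F i1 u v) (F i2 u v) (F i3 u v) (F i4 u v)
    = det4 (F i1 u0 v0) (F i2 u0 v0) (F i3 u0 v0) (F i4 u0 v0).
Proof.
  intros HI HJ H0 SA SB HF u v Huv.
  apply (rect_constant I J
    (fun u v => det4 (F i1 u v) (F i2 u v) (F i3 u v) (F i4 u v))); trivial.
  clear u v Huv. intros u v Huv. split.
  - apply (is_derive_det4_skew (fun i s => F i s v) (fun i j => A i j u v)).
    + intros i j. now apply SA.
    + intros i k. now apply HF.
  - apply (is_derive_det4_skew (fun i t => F i u t) (fun i j => B i j u v)).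
    + intros i j. now apply SB.
    + intros i k. now apply HF.
Qed.

Definition smooth_vec (D : R -> R -> Prop) (z : R -> R -> R4) : Prop :=
  forall k, smooth_on D (fun u v => coord k (z u v)).

Lemma moving_frame_exists I J A B u0 v0 :
  is_open_interval I -> is_open_interval J -> rect I J u0 v0 ->
  (forall i j, smooth_on (rect I J) (A i j)) ->
  (forall i j, smooth_on (rect I J) (B i j)) ->
  skew_on (rect I J) A -> skew_on (rect I J) B ->
  (forall i j u v, rect I J u v ->
     dv (A i j) u v + sum4 (fun k => A i k u v * B k j u v)
     = du (B i j) u v + sum4 (fun k => B i k u v * A k j u v)) ->
  exists F, moving_frame (rect I J) A B F /\
    (forall i, smooth_vec (rect I J) (F i)) /\
    forall u v, rect I J u v ->
      orthonormal_columns (fun i => F i u v) /\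
      0 < det4 (F i1 u v) (F i2 u v) (F i3 u v) (F i4 u v).
Proof.
  intros HI HJ H0 HA HB SA SB flat.
  set (F := fun i u v =>
    vec (fun k => flat_solution A B u0 v0 (fun i => kron i k) i u v)).
  assert (C : forall i k u v, coord k (F i u v)
            = flat_solution A B u0 v0 (fun i => kron i k) i u v).
  { intros i k u v. apply coord_vec. }
  assert (start : forall i k, coord k (F i u0 v0) = kron i k).
  { intros i k. rewrite C.
    now apply (flat_solution_start I J A B u0 v0 HI HJ HA HB H0 (fun i => kron i k)). }
  assert (M : moving_frame (rect I J) A B F).
  { intros i k u v Huv. split.
    - apply (is_derive_ext (fun s =>
        flat_solution A B u0 v0 (fun i => kron i k) i s v)).
      { intros s. now rewrite C. }
      rewrite (sum4_ext _ (fun j => A i j u v *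
        flat_solution A B u0 v0 (fun i => kron i k) j u v))
        by (intros j; now rewrite C).
      now apply (flat_solution_derive_u I J).
    - apply (is_derive_ext (fun t =>
        flat_solution A B u0 v0 (fun i => kron i k) i u t)).
      { intros t. now rewrite C. }
      rewrite (sum4_ext _ (fun j => B i j u v *
        flat_solution A B u0 v0 (fun i => kron i k) j u v))
        by (intros j; now rewrite C).
      now apply (flat_solution_derive_v I J). }
  exists F. split; [exact M|]. split.
  - intros i k. apply (smooth_ext _
      (flat_solution A B u0 v0 (fun i => kron i k) i)).
    + now apply rect_open.
    + intros u v _. now rewrite C.
    + now apply flat_solution_smooth.
  - intros u v Huv. split.
    + intros k l.
      rewrite (moving_frame_transition I J A B F F u0 v0); trivial.
      rewrite (sum4_ext _ (fun i => kron i k * kron i l))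
        by (intros i; now rewrite !start).
      destruct k, l; unfold sum4, kron; ring.
    + rewrite (moving_frame_det I J A B F u0 v0); trivial.
      assert (E : forall i, F i u0 v0 = vec (kron i)).
      { intros i. apply R4_ext. intros k. now rewrite start, coord_vec. }
      rewrite !E. unfold vec, kron, det4, det2, X1, X2, X3, X4. simpl. lra.
Qed.

Definition skew_matrix (a12 a13 a14 a23 a24 a34 : R -> R -> R)
    (i j : idx) : R -> R -> R :=
  match i, j with
  | i1, i2 => a12 | i1, i3 => a13 | i1, i4 => a14
  | i2, i3 => a23 | i2, i4 => a24 | i3, i4 => a34
  | i2, i1 => fun u v => - a12 u v | i3, i1 => fun u v => - a13 u v
  | i4, i1 => fun u v => - a14 u v | i3, i2 => fun u v => - a23 u v
  | i4, i2 => fun u v => - a24 u v | i4, i3 => fun u v => - a34 u v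
  | _, _ => fun _ _ => 0
  end.

Lemma skew_matrix_skew D a12 a13 a14 a23 a24 a34 :
  skew_on D (skew_matrix a12 a13 a14 a23 a24 a34).
Proof. intros i j u v _. destruct i, j; simpl; ring. Qed.

Lemma skew_matrix_smooth D a12 a13 a14 a23 a24 a34 : open_plane D ->
  smooth_on D a12 -> smooth_on D a13 -> smooth_on D a14 ->
  smooth_on D a23 -> smooth_on D a24 -> smooth_on D a34 ->
  forall i j, smooth_on D (skew_matrix a12 a13 a14 a23 a24 a34 i j).
Proof.
  intros HD H12 H13 H14 H23 H24 H34 i j.
  destruct i, j; simpl; trivial; try (now apply smooth_const);
    now apply smooth_opp.
Qed.

Lemma du_opp f u v : du (fun u v => - f u v) u v = - du f u v.
Proof. apply (Derive_opp (fun s => f s v)). Qed.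

Lemma dv_opp f u v : dv (fun u v => - f u v) u v = - dv f u v.
Proof. apply (Derive_opp (fun t => f u t)). Qed.

Lemma du_const c u v : du (fun _ _ => c) u v = 0.
Proof. apply (Derive_const c u). Qed.

Lemma dv_const c u v : dv (fun _ _ => c) u v = 0.
Proof. apply (Derive_const c v). Qed.

Lemma du_mult D f g u v : smooth_on D f -> smooth_on D g -> D u v ->
  du (fun u v => f u v * g u v) u v = du f u v * g u v + f u v * du g u v.
Proof.
  intros Hf Hg Huv. apply (Derive_mult (fun s => f s v) (fun s => g s v)).
  - exists (du f u v). now apply (smooth_is_derive_u D).
  - exists (du g u v). now apply (smooth_is_derive_u D).
Qed.

Lemma dv_mult D f g u v : smooth_on D f -> smooth_on D g -> D u v ->
  dv (fun u v => f u v * g u v) u v = dv f u v * g u v + f u v * dv g u v.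
Proof.
  intros Hf Hg Huv. apply (Derive_mult (fun t => f u t) (fun t => g u t)).
  - exists (dv f u v). now apply (smooth_is_derive_v D).
  - exists (dv g u v). now apply (smooth_is_derive_v D).
Qed.

(** For skew matrices the defect of the zero-curvature equation is itself skew,
    so that its entries above the diagonal suffice. *)
Lemma skew_matrix_flat a12 a13 a14 a23 a24 a34 b12 b13 b14 b23 b24 b34 u v :
  dv a12 u v - a13 u v * b23 u v - a14 u v * b24 u v
    = du b12 u v - b13 u v * a23 u v - b14 u v * a24 u v ->
  dv a13 u v + a12 u v * b23 u v - a14 u v * b34 u v
    = du b13 u v + b12 u v * a23 u v - b14 u v * a34 u v ->
  dv a14 u v + a12 u v * b24 u v + a13 u v * b34 u v
    = du b14 u v + b12 u v * a24 u v + b13 u v * a34 u v ->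
  dv a23 u v - a12 u v * b13 u v - a24 u v * b34 u v
    = du b23 u v - b12 u v * a13 u v - b24 u v * a34 u v ->
  dv a24 u v - a12 u v * b14 u v + a23 u v * b34 u v
    = du b24 u v - b12 u v * a14 u v + b23 u v * a34 u v ->
  dv a34 u v - a13 u v * b14 u v - a23 u v * b24 u v
    = du b34 u v - b13 u v * a14 u v - b23 u v * a24 u v ->
  let A := skew_matrix a12 a13 a14 a23 a24 a34 in
  let B := skew_matrix b12 b13 b14 b23 b24 b34 in
  forall i j,
    dv (A i j) u v + sum4 (fun k => A i k u v * B k j u v)
    = du (B i j) u v + sum4 (fun k => B i k u v * A k j u v).
Proof.
  intros E12 E13 E14 E23 E24 E34 A B i j.
  destruct i, j; unfold A, B, sum4, skew_matrix;
    rewrite ?dv_opp, ?du_opp, ?dv_const, ?du_const; lra.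
Qed.

(** * The connection determined by the geometric functions *)

Section Connection.

Variables (nu1 nu2 lam mu phi psi : R -> R -> R).

(** The connection coefficients of the normal bundle along the parameter
    lines, obtained by solving two of the Codazzi equations. *)
Definition normal_conn_u (s t : R) : R :=
  2 * (lam s t / mu s t) * (du psi s t / psi s t)
  - (nu1 s t - nu2 s t) / mu s t * (dv phi s t / psi s t)
  + du lam s t / mu s t
  - dv nu1 s t / mu s t * (phi s t / psi s t).

Definition normal_conn_v (s t : R) : R :=
  2 * (lam s t / mu s t) * (dv phi s t / phi s t)
  + (nu1 s t - nu2 s t) / mu s t * (du psi s t / phi s t)
  - du nu2 s t / mu s t * (psi s t / phi s t)
  + dv lam s t / mu s t.

(** The coefficients of the derivatives of the frame [{x, y, b, l}] of a
    surface with [E = phi^2] and [G = psi^2]. *)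
Definition conn_u : idx -> idx -> R -> R -> R :=
  skew_matrix (fun u v => - (dv phi u v / psi u v))
    (fun u v => phi u v * nu1 u v) (fun _ _ => 0)
    (fun u v => phi u v * lam u v) (fun u v => phi u v * mu u v)
    normal_conn_u.

Definition conn_v : idx -> idx -> R -> R -> R :=
  skew_matrix (fun u v => du psi u v / phi u v)
    (fun u v => psi u v * lam u v) (fun u v => psi u v * mu u v)
    (fun u v => psi u v * nu2 u v) (fun _ _ => 0)
    normal_conn_v.

Variable D : R -> R -> Prop.
Hypothesis HD : open_plane D.
Hypotheses (Hnu1 : smooth_on D nu1) (Hnu2 : smooth_on D nu2)
  (Hlam : smooth_on D lam) (Hmu : smooth_on D mu)
  (Hphi : smooth_on D phi) (Hpsi : smooth_on D psi).
Hypotheses (Hmu0 : forall u v, D u v -> mu u v <> 0)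
  (Hphi0 : forall u v, D u v -> phi u v <> 0)
  (Hpsi0 : forall u v, D u v -> psi u v <> 0).

Lemma conn_u_smooth i j : smooth_on D (conn_u i j).
Proof.
  apply skew_matrix_smooth; trivial; unfold normal_conn_u; smooth; trivial.
Qed.

Lemma conn_v_smooth i j : smooth_on D (conn_v i j).
Proof.
  apply skew_matrix_smooth; trivial; unfold normal_conn_v; smooth; trivial.
Qed.

Hypothesis HTheta : forall u v, D u v -> Theta nu1 nu2 lam mu u v <> 0.
Hypothesis Hphiv : forall u v, D u v ->
  dv phi u v = f1 nu1 nu2 lam mu u v * phi u v + f2 nu1 nu2 lam mu u v * psi u v.
Hypothesis Hpsiu : forall u v, D u v ->
  du psi u v = f3 nu1 nu2 lam mu u v * phi u v + f4 nu1 nu2 lam mu u v * psi u v.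

Lemma du_sq f u v : smooth_on D f -> D u v ->
  du (sq f) u v = 2 * f u v * du f u v.
Proof.
  intros Hf Huv. unfold sq.
  transitivity (du (fun u v => f u v * f u v) u v).
  - apply (du_ext D); trivial. intros s t _. ring.
  - rewrite (du_mult D f f) by trivial. ring.
Qed.

Lemma dv_sq f u v : smooth_on D f -> D u v ->
  dv (sq f) u v = 2 * f u v * dv f u v.
Proof.
  intros Hf Huv. unfold sq.
  transitivity (dv (fun u v => f u v * f u v) u v).
  - apply (dv_ext D); trivial. intros s t _. ring.
  - rewrite (dv_mult D f f) by trivial. ring.
Qed.

Lemma du_sum_sq_sq u v : D u v ->
  du (fun s t => (lam s t ^ 2 + mu s t ^ 2) ^ 2) u v
  = 4 * (lam u v ^ 2 + mu u v ^ 2)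
    * (lam u v * du lam u v + mu u v * du mu u v).
Proof.
  intros Huv. change (du (sq (fun s t => lam s t ^ 2 + mu s t ^ 2)) u v =
    4 * (lam u v ^ 2 + mu u v ^ 2)
    * (lam u v * du lam u v + mu u v * du mu u v)).
  rewrite du_sq; trivial; [|smooth].
  replace (du (fun s t => lam s t ^ 2 + mu s t ^ 2) u v)
    with (du (sq lam) u v + du (sq mu) u v).
  - rewrite !du_sq by trivial. ring.
  - symmetry. apply (Derive_plus (fun s => lam s v ^ 2) (fun s => mu s v ^ 2)).
    + eexists. apply (smooth_is_derive_u D (sq lam)); trivial. smooth.
    + eexists. apply (smooth_is_derive_u D (sq mu)); trivial. smooth.
Qed.

Lemma dv_sum_sq_sq u v : D u v ->
  dv (fun s t => (lam s t ^ 2 + mu s t ^ 2) ^ 2) u v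
  = 4 * (lam u v ^ 2 + mu u v ^ 2)
    * (lam u v * dv lam u v + mu u v * dv mu u v).
Proof.
  intros Huv. change (dv (sq (fun s t => lam s t ^ 2 + mu s t ^ 2)) u v =
    4 * (lam u v ^ 2 + mu u v ^ 2)
    * (lam u v * dv lam u v + mu u v * dv mu u v)).
  rewrite dv_sq; trivial; [|smooth].
  replace (dv (fun s t => lam s t ^ 2 + mu s t ^ 2) u v)
    with (dv (sq lam) u v + dv (sq mu) u v).
  - rewrite !dv_sq by trivial. ring.
  - symmetry. apply (Derive_plus (fun t => lam u t ^ 2) (fun t => mu u t ^ 2)).
    + eexists. apply (smooth_is_derive_v D (sq lam)); trivial. smooth.
    + eexists. apply (smooth_is_derive_v D (sq mu)); trivial. smooth.
Qed.

(** The formulas for [f_1, ..., f_4] are the solution of the two remaining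
    Codazzi equations, which are linear in [phi_v] and [psi_u] with determinant
    proportional to [Theta]. *)
Lemma codazzi_algebra u v : D u v ->
  phi u v * nu1 u v * normal_conn_v u v
    = du psi u v * mu u v + psi u v * du mu u v
      + du psi u v * mu u v + psi u v * lam u v * normal_conn_u u v /\
  dv phi u v * mu u v + phi u v * dv mu u v + dv phi u v * mu u v
    + phi u v * lam u v * normal_conn_v u v
    = psi u v * nu2 u v * normal_conn_u u v.
Proof.
  intros Huv. unfold normal_conn_u, normal_conn_v.
  rewrite !Hphiv, !Hpsiu by trivial. unfold f1, f2, f3, f4.
  rewrite !du_sq, !dv_sq, du_sum_sq_sq, dv_sum_sq_sq by trivial.
  assert (T := HTheta u v Huv). unfold Theta in *.
  assert (M := Hmu0 u v Huv). assert (P := Hphi0 u v Huv).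
  assert (S := Hpsi0 u v Huv).
  generalize dependent (mu u v). generalize dependent (phi u v).
  generalize dependent (psi u v). generalize (nu1 u v) (nu2 u v) (lam u v).
  generalize (du lam u v) (dv lam u v) (du mu u v) (dv mu u v) (dv nu1 u v)
    (du nu2 u v).
  intros lu lv mu' mv nv nu n1 n2 l s S p P m T M.
  split; field; auto.
Qed.

Hypothesis Hgauss : forall u v, D u v ->
  nu1 u v * nu2 u v - (lam u v ^ 2 + mu u v ^ 2)
  = - (1 / (phi u v * psi u v)) *
    (dv (fun s t => f1 nu1 nu2 lam mu s t * (phi s t / psi s t)
                    + f2 nu1 nu2 lam mu s t) u v
     + du (fun s t => f3 nu1 nu2 lam mu s t
                    + f4 nu1 nu2 lam mu s t * (psi s t / phi s t)) u v).
Hypothesis Hricci : forall u v, D u v ->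
  phi u v * psi u v * (nu1 u v - nu2 u v) * mu u v
  = dv normal_conn_u u v - du normal_conn_v u v.

Lemma conn_flat i j u v : D u v ->
  dv (conn_u i j) u v + sum4 (fun k => conn_u i k u v * conn_v k j u v)
  = du (conn_v i j) u v + sum4 (fun k => conn_v i k u v * conn_u k j u v).
Proof.
  intros Huv.
  assert (M := Hmu0 u v Huv). assert (P := Hphi0 u v Huv).
  assert (S := Hpsi0 u v Huv).
  destruct (codazzi_algebra u v Huv) as [C14 C24].
  apply (skew_matrix_flat (fun u v => - (dv phi u v / psi u v))
    (fun u v => phi u v * nu1 u v) (fun _ _ => 0)
    (fun u v => phi u v * lam u v) (fun u v => phi u v * mu u v)
    normal_conn_u (fun u v => du psi u v / phi u v)
    (fun u v => psi u v * lam u v) (fun u v => psi u v * mu u v)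
    (fun u v => psi u v * nu2 u v) (fun _ _ => 0)
    normal_conn_v);
    rewrite ?du_const, ?dv_const, ?(du_mult D), ?(dv_mult D) by trivial.
  - rewrite dv_opp. assert (G := Hgauss u v Huv).
    rewrite (dv_ext D _ (fun u v => dv phi u v / psi u v)) in G; trivial.
    2:{ intros s t Hst. rewrite Hphiv by trivial. field. now apply Hpsi0. }
    rewrite (du_ext D _ (fun u v => du psi u v / phi u v)) in G; trivial.
    2:{ intros s t Hst. rewrite Hpsiu by trivial. field. now apply Hphi0. }
    match type of G with _ = _ * (?a + ?b) =>
      assert (G' : a + b = - (phi u v * psi u v)
         * (nu1 u v * nu2 u v - (lam u v ^ 2 + mu u v ^ 2)))
        by (rewrite G; field; auto) end.
    lra.
  - unfold normal_conn_u, normal_conn_v. field. auto.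
  - replace (du psi u v / phi u v * (phi u v * mu u v))
      with (du psi u v * mu u v) by (field; auto). lra.
  - unfold normal_conn_u, normal_conn_v. field. auto.
  - replace (- (dv phi u v / psi u v) * (psi u v * mu u v))
      with (- (dv phi u v * mu u v)) by (field; auto). lra.
  - assert (R := Hricci u v Huv). lra.
Qed.

End Connection.

(** * Frames adapted to a surface *)

Lemma smooth4_vec D z : smooth4_on D z <-> smooth_vec D z.
Proof.
  split.
  - intros (H1 & H2 & H3 & H4) []; assumption.
  - intros H. exact (conj (H i1) (conj (H i2) (conj (H i3) (H i4)))).
Qed.

Lemma coord_du4 k z u v :
  coord k (du4 z u v) = du (fun s t => coord k (z s t)) u v.
Proof. now destruct k. Qed.

Lemma coord_dv4 k z u v :
  coord k (dv4 z u v) = dv (fun s t => coord k (z s t)) u v.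
Proof. now destruct k. Qed.

Lemma smooth_vec_du4 D z : smooth_vec D z -> smooth_vec D (du4 z).
Proof.
  intros H []; apply smooth_du;
    [exact (H i1)|exact (H i2)|exact (H i3)|exact (H i4)].
Qed.

Lemma smooth_vec_dv4 D z : smooth_vec D z -> smooth_vec D (dv4 z).
Proof.
  intros H []; apply smooth_dv;
    [exact (H i1)|exact (H i2)|exact (H i3)|exact (H i4)].
Qed.

Lemma smooth_vec_dot D z w : open_plane D -> smooth_vec D z -> smooth_vec D w ->
  smooth_on D (fun u v => dot (z u v) (w u v)).
Proof.
  intros HD Hz Hw. unfold dot.
  apply smooth_plus; trivial;
    [apply smooth_plus; trivial; [apply smooth_plus; trivial|]|];
    apply smooth_mult; trivial;
    first [exact (Hz i1)|exact (Hz i2)|exact (Hz i3)|exact (Hz i4)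
          |exact (Hw i1)|exact (Hw i2)|exact (Hw i3)|exact (Hw i4)].
Qed.

Lemma smooth_vec_schwarz D z u v : open_plane D -> smooth_vec D z -> D u v ->
  dv4 (du4 z) u v = du4 (dv4 z) u v.
Proof.
  intros HD Hz Huv. apply R4_ext. intros k.
  rewrite coord_dv4, coord_du4.
  transitivity (dv (du (fun s t => coord k (z s t))) u v); [now destruct k|].
  rewrite (smooth_schwarz D) by trivial. now destruct k.
Qed.

Lemma dot_sym p q : dot p q = dot q p.
Proof. unfold dot. ring. Qed.

Lemma dot_plus_l (p q r : R4) : dot (plus p q) r = dot p r + dot q r.
Proof. rewrite !dot_sum4. unfold sum4. rewrite !coord_plus. ring. Qed.

Lemma dot_minus_l (p q r : R4) : dot (minus p q) r = dot p r - dot q r.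
Proof. rewrite !dot_sum4. unfold sum4. rewrite !coord_minus. ring. Qed.

Lemma dot_scal_l a (p r : R4) : dot (scal a p) r = a * dot p r.
Proof. rewrite !dot_sum4. unfold sum4. rewrite !coord_scal. ring. Qed.

Lemma dot_scal_r a (p r : R4) : dot r (scal a p) = a * dot r p.
Proof. rewrite dot_sym, dot_scal_l, dot_sym. reflexivity. Qed.

Lemma normal_part_dot z u v (w n : R4) :
  dot n (du4 z u v) = 0 -> dot n (dv4 z u v) = 0 ->
  dot (normal_part z u v w) n = dot w n.
Proof.
  intros Hu Hv. unfold normal_part.
  rewrite dot_minus_l, dot_plus_l, !dot_scal_l, !(dot_sym _ n), Hu, Hv. ring.
Qed.

Section Adapted.

Variables (D : R -> R -> Prop) (z : R -> R -> R4)
  (phi psi nu1 nu2 lam mu : R -> R -> R).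

(** [F] is the frame [x, y, b, l] of a surface with [sqrt E = phi] and
    [sqrt G = psi].  The geometric functions enter through the components of the
    second derivatives of [z], so that no quotient by [E] or [G] occurs. *)
Definition adapted_frame (F : idx -> R -> R -> R4) : Prop :=
  forall u v, D u v ->
    orthonormal_columns (fun i => F i u v) /\
    0 < det4 (F i1 u v) (F i2 u v) (F i3 u v) (F i4 u v) /\
    du4 z u v = scal (phi u v) (F i1 u v) /\
    dv4 z u v = scal (psi u v) (F i2 u v) /\
    dot (du4 (du4 z) u v) (F i3 u v) = phi u v ^ 2 * nu1 u v /\
    dot (du4 (du4 z) u v) (F i4 u v) = 0 /\
    dot (dv4 (du4 z) u v) (F i3 u v) = phi u v * psi u v * lam u v /\
    dot (dv4 (du4 z) u v) (F i4 u v) = phi u v * psi u v * mu u v /\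
    dot (dv4 (dv4 z) u v) (F i3 u v) = psi u v ^ 2 * nu2 u v /\
    dot (dv4 (dv4 z) u v) (F i4 u v) = 0.

Variable F : idx -> R -> R -> R4.
Hypothesis HF : adapted_frame F.
Hypothesis Hphi : forall u v, D u v -> 0 < phi u v.
Hypothesis Hpsi : forall u v, D u v -> 0 < psi u v.

Lemma adapted_dot i j u v : D u v -> dot (F i u v) (F j u v) = kron i j.
Proof.
  intros Huv. destruct (HF u v Huv) as [Ho _].
  exact (orthonormal_columns_dot (fun i => F i u v) i j Ho).
Qed.

Lemma adapted_forms u v : D u v ->
  formE z u v = phi u v ^ 2 /\ formF z u v = 0 /\ formG z u v = psi u v ^ 2 /\
  formW z u v = (phi u v * psi u v) ^ 2.
Proof.
  intros Huv. destruct (HF u v Huv) as (_ & _ & Eu & Ev & _).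
  unfold formW, formE, formF, formG. rewrite Eu, Ev.
  rewrite !dot_scal_l, !dot_scal_r, !adapted_dot by trivial.
  simpl kron. repeat split; ring.
Qed.

Lemma adapted_sqrt u v : D u v ->
  sqrt (formE z u v) = phi u v /\ sqrt (formG z u v) = psi u v /\
  sqrt (formW z u v) = phi u v * psi u v.
Proof.
  intros Huv. destruct (adapted_forms u v Huv) as (E & _ & G & W).
  assert (P := Hphi u v Huv). assert (S := Hpsi u v Huv).
  rewrite E, G, W. repeat split; apply sqrt_pow2; try lra.
  apply Rmult_le_pos; lra.
Qed.

Lemma adapted_normal_part u v (w : R4) : D u v ->
  normal_part z u v w = plus (scal (dot w (F i3 u v)) (F i3 u v))
                             (scal (dot w (F i4 u v)) (F i4 u v)).
Proof.
  intros Huv. destruct (HF u v Huv) as (Ho & _ & Eu & Ev & _).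
  destruct (adapted_forms u v Huv) as (E & Fz & G & W).
  assert (P := Hphi u v Huv). assert (S := Hpsi u v Huv).
  apply R4_ext. intros k. unfold normal_part.
  rewrite coord_minus, !coord_plus, !coord_scal, E, Fz, G, W, Eu, Ev.
  rewrite !dot_scal_r, !coord_scal.
  rewrite (orthonormal_expansion (fun i => F i u v) w k Ho). unfold sum4.
  field. lra.
Qed.

Lemma adapted_sff u v (X Y : R * R) : D u v ->
  sff z u v X Y = plus
    (scal (fst X * fst Y * (phi u v ^ 2 * nu1 u v)
           + (fst X * snd Y + snd X * fst Y) * (phi u v * psi u v * lam u v)
           + snd X * snd Y * (psi u v ^ 2 * nu2 u v)) (F i3 u v))
    (scal ((fst X * snd Y + snd X * fst Y) * (phi u v * psi u v * mu u v))
       (F i4 u v)).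
Proof.
  intros Huv.
  destruct (HF u v Huv) as (_ & _ & _ & _ & B1 & L1 & B2 & L2 & B3 & L3).
  unfold sff. rewrite adapted_normal_part by trivial.
  rewrite !dot_plus_l, !dot_scal_l, B1, L1, B2, L2, B3, L3.
  f_equal. f_equal. ring.
Qed.

Hypothesis Hz : smooth_vec D z.
Hypothesis HFs : forall i, smooth_vec D (F i).
Hypothesis Hmu0 : forall u v, D u v -> mu u v <> 0.
Hypothesis Hsum : forall u v, D u v -> nu1 u v + nu2 u v > 0.

Lemma adapted_normal_frame : normal_frame D z (F i3) (F i4).
Proof.
  split; [apply smooth4_vec, HFs|]. split; [apply smooth4_vec, HFs|].
  intros u v Huv. destruct (HF u v Huv) as (_ & _ & Eu & Ev & _).
  rewrite Eu, Ev, !dot_scal_r, !adapted_dot by trivial.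
  simpl kron. repeat split; ring.
Qed.

Lemma adapted_LMN u v : D u v ->
  formL z (F i3) (F i4) u v = 2 * phi u v ^ 2 * nu1 u v * mu u v /\
  formM z (F i3) (F i4) u v = 0 /\
  formN z (F i3) (F i4) u v = - (2 * psi u v ^ 2 * nu2 u v * mu u v).
Proof.
  intros Huv. destruct (adapted_sqrt u v Huv) as (_ & _ & W).
  assert (P := Hphi u v Huv). assert (S := Hpsi u v Huv).
  unfold formL, formM, formN. rewrite W, !adapted_sff by trivial.
  rewrite !dot_plus_l, !dot_scal_l, !adapted_dot by trivial.
  unfold e_u, e_v, kron. simpl fst. simpl snd.
  repeat split; field; lra.
Qed.

Lemma adapted_mean_curvature u v : D u v ->
  mean_curvature z u v = scal ((nu1 u v + nu2 u v) / 2) (F i3 u v).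
Proof.
  intros Huv. destruct (adapted_forms u v Huv) as (E & Fz & G & W).
  assert (P := Hphi u v Huv). assert (S := Hpsi u v Huv).
  apply R4_ext. intros k. unfold mean_curvature.
  rewrite !adapted_sff by trivial.
  rewrite E, Fz, G, W.
  repeat (rewrite coord_scal || rewrite coord_plus || rewrite coord_minus).
  unfold e_u, e_v. simpl fst. simpl snd. field. lra.
Qed.

Lemma adapted_unit_mean_curvature u v : D u v ->
  scal (/ enorm (mean_curvature z u v)) (mean_curvature z u v) = F i3 u v.
Proof.
  intros Huv. assert (S := Hsum u v Huv).
  rewrite adapted_mean_curvature by trivial. unfold enorm.
  rewrite dot_scal_l, dot_scal_r, adapted_dot by trivial. simpl kron.
  replace (_ * (_ * 1)) with (((nu1 u v + nu2 u v) / 2) ^ 2) by ring.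
  rewrite sqrt_pow2 by lra.
  apply R4_ext. intros k. rewrite !coord_scal. field. lra.
Qed.

Lemma adapted_geometric_functions : has_geometric_functions D z nu1 nu2 lam mu.
Proof.
  split; [split|split; [|split]].
  - now apply smooth4_vec.
  - intros u v Huv a b H.
    destruct (HF u v Huv) as (_ & _ & Eu & Ev & _). rewrite Eu, Ev in H.
    assert (P := Hphi u v Huv). assert (S := Hpsi u v Huv).
    assert (Z : forall i, dot (zero : R4) (F i u v) = 0).
    { intros i. rewrite dot_sum4. unfold sum4. rewrite !coord_zero. ring. }
    assert (Ha := Z i1). assert (Hb := Z i2). rewrite <- H in Ha, Hb.
    rewrite dot_plus_l, !dot_scal_l, !adapted_dot in Ha, Hb by trivial.
    simpl kron in Ha, Hb. split.
    + apply (Rmult_eq_reg_r (phi u v)); lra.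
    + apply (Rmult_eq_reg_r (psi u v)); lra.
  - exists (F i3), (F i4). split; [exact adapted_normal_frame|].
    intros u v Huv. destruct (adapted_forms u v Huv) as (E & Fz & G & W).
    destruct (adapted_LMN u v Huv) as (L & M & N).
    assert (P := Hphi u v Huv). assert (S := Hpsi u v Huv).
    unfold inv_kappa, inv_k. rewrite L, M, N, E, Fz, G, W.
    assert (K := Hmu0 u v Huv). assert (T := Hsum u v Huv).
    match goal with |- ?x > 0 =>
      replace x with ((mu u v * (nu1 u v + nu2 u v)) ^ 2) by (field; lra) end.
    apply pow2_gt_0. apply Rmult_integral_contrapositive_currified; lra.
  - exists (F i3), (F i4). split; [exact adapted_normal_frame|].
    intros u v Huv. split; [apply adapted_forms|apply adapted_LMN]; trivial.
  - exists (F i4). split; [apply smooth4_vec, HFs|].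
    intros u v Huv. cbv zeta.
    rewrite adapted_unit_mean_curvature by trivial.
    destruct (adapted_sqrt u v Huv) as (SE & SG & _). rewrite SE, SG.
    destruct (HF u v Huv) as (_ & Hdet & Eu & Ev & _). rewrite Eu, Ev.
    assert (P := Hphi u v Huv). assert (S := Hpsi u v Huv).
    assert (unit : forall a (p : R4), a <> 0 -> scal (/ a) (scal a p) = p).
    { intros a p Ha. apply R4_ext. intros k. rewrite !coord_scal. now field. }
    rewrite !unit by lra. split.
    + repeat split; trivial; now rewrite adapted_dot.
    + rewrite !adapted_sff by trivial. simpl fst. simpl snd.
      repeat split; apply R4_ext; intros k;
        rewrite ?coord_plus, !coord_scal; field; lra.
Qed.

End Adapted.

(** * The structure equations of a surface *)

Lemma is_derive_coord_u D z k u v : smooth_vec D z -> D u v ->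
  is_derive (fun s => coord k (z s v)) u (coord k (du4 z u v)).
Proof.
  intros Hz Huv. rewrite coord_du4. exact (smooth_is_derive_u D _ u v (Hz k) Huv).
Qed.

Lemma is_derive_coord_v D z k u v : smooth_vec D z -> D u v ->
  is_derive (fun t => coord k (z u t)) v (coord k (dv4 z u v)).
Proof.
  intros Hz Huv. rewrite coord_dv4. exact (smooth_is_derive_v D _ u v (Hz k) Huv).
Qed.

Lemma du_dot D p q u v : smooth_vec D p -> smooth_vec D q -> D u v ->
  du (fun u v => dot (p u v) (q u v)) u v
  = dot (du4 p u v) (q u v) + dot (p u v) (du4 q u v).
Proof.
  intros Hp Hq Huv. apply is_derive_unique. evar_last.
  - apply (is_derive_sum4 (fun k s => coord k (p s v) * coord k (q s v))).
    intros k. apply (derive_mult (fun s => coord k (p s v))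
                       (fun s => coord k (q s v))).
    + now apply (is_derive_coord_u D).
    + now apply (is_derive_coord_u D).
  - rewrite !dot_sum4. unfold sum4, plus, mult. simpl. ring.
Qed.

Lemma dv_dot D p q u v : smooth_vec D p -> smooth_vec D q -> D u v ->
  dv (fun u v => dot (p u v) (q u v)) u v
  = dot (dv4 p u v) (q u v) + dot (p u v) (dv4 q u v).
Proof.
  intros Hp Hq Huv. apply is_derive_unique. evar_last.
  - apply (is_derive_sum4 (fun k t => coord k (p u t) * coord k (q u t))).
    intros k. apply (derive_mult (fun t => coord k (p u t))
                       (fun t => coord k (q u t))).
    + now apply (is_derive_coord_v D).
    + now apply (is_derive_coord_v D).
  - rewrite !dot_sum4. unfold sum4, plus, mult. simpl. ring.
Qed.

Lemma du4_scal D (f : R -> R -> R) w z u v : open_plane D ->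
  smooth_on D f -> smooth_vec D w ->
  (forall u v, D u v -> z u v = scal (f u v) (w u v)) -> D u v ->
  du4 z u v = plus (scal (du f u v) (w u v)) (scal (f u v) (du4 w u v)).
Proof.
  intros HD Hf Hw Hz Huv. apply R4_ext. intros k.
  rewrite coord_plus, !coord_scal, !coord_du4.
  rewrite <- (du_mult D f (fun s t => coord k (w s t)) u v Hf (Hw k) Huv).
  apply (du_ext D); trivial. intros s t Hst. now rewrite Hz, coord_scal.
Qed.

Lemma dv4_scal D (f : R -> R -> R) w z u v : open_plane D ->
  smooth_on D f -> smooth_vec D w ->
  (forall u v, D u v -> z u v = scal (f u v) (w u v)) -> D u v ->
  dv4 z u v = plus (scal (dv f u v) (w u v)) (scal (f u v) (dv4 w u v)).
Proof.
  intros HD Hf Hw Hz Huv. apply R4_ext. intros k.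
  rewrite coord_plus, !coord_scal, !coord_dv4.
  rewrite <- (dv_mult D f (fun s t => coord k (w s t)) u v Hf (Hw k) Huv).
  apply (dv_ext D); trivial. intros s t Hst. now rewrite Hz, coord_scal.
Qed.

Lemma parseval F (p q : R4) : orthonormal_columns F ->
  dot p q = sum4 (fun i => dot p (F i) * dot q (F i)).
Proof.
  intros H. rewrite (dot_sum4 p q).
  rewrite (sum4_ext _ (fun k => sum4 (fun i => dot p (F i) * coord k (F i))
                                * coord k q))
    by (intros k; now rewrite (orthonormal_expansion F p k H)).
  rewrite (sum4_ext (fun i => dot p (F i) * dot q (F i))
    (fun i => dot p (F i) * sum4 (fun k => coord k q * coord k (F i))))
    by (intros i; now rewrite (dot_sum4 q)).
  unfold sum4. ring.
Qed.

(** Equality of the mixed second derivatives of [p], in components. *)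
Lemma mixed_derivative_components D p q u v : open_plane D ->
  smooth_vec D p -> smooth_vec D q -> D u v ->
  dv (fun u v => dot (du4 p u v) (q u v)) u v
  - du (fun u v => dot (dv4 p u v) (q u v)) u v
  = dot (du4 p u v) (dv4 q u v) - dot (dv4 p u v) (du4 q u v).
Proof.
  intros HD Hp Hq Huv.
  rewrite (dv_dot D (du4 p) q u v (smooth_vec_du4 D p Hp) Hq Huv).
  rewrite (du_dot D (dv4 p) q u v (smooth_vec_dv4 D p Hp) Hq Huv).
  rewrite (smooth_vec_schwarz D) by trivial. ring.
Qed.

Section Codazzi.

Variables (D : R -> R -> Prop) (z : R -> R -> R4)
  (phi psi nu1 nu2 lam mu : R -> R -> R) (F : idx -> R -> R -> R4).
Hypothesis HD : open_plane D.
Hypothesis HF : adapted_frame D z phi psi nu1 nu2 lam mu F.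
Hypotheses (Hphi : forall u v, D u v -> 0 < phi u v)
  (Hpsi : forall u v, D u v -> 0 < psi u v)
  (Hmu0 : forall u v, D u v -> mu u v <> 0).
Hypotheses (Sphi : smooth_on D phi) (Spsi : smooth_on D psi)
  (Snu1 : smooth_on D nu1) (Snu2 : smooth_on D nu2)
  (Slam : smooth_on D lam) (Smu : smooth_on D mu).
Hypotheses (Sz : smooth_vec D z) (SF : forall i, smooth_vec D (F i)).

(* the Maurer-Cartan forms of the frame *)
Let om_u i j u v := dot (du4 (F i) u v) (F j u v).
Let om_v i j u v := dot (dv4 (F i) u v) (F j u v).

Lemma om_u_skew i j u v : D u v -> om_u i j u v = - om_u j i u v.
Proof.
  intros Huv.
  assert (E : du (fun u v => dot (F i u v) (F j u v)) u v = 0).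
  { rewrite (du_ext D _ (fun _ _ => kron i j)); trivial.
    - apply du_const.
    - intros s t Hst. now apply (adapted_dot D z phi psi nu1 nu2 lam mu). }
  rewrite (du_dot D) in E; trivial. unfold om_u.
  rewrite (dot_sym (du4 (F j) u v)). lra.
Qed.

Lemma om_v_skew i j u v : D u v -> om_v i j u v = - om_v j i u v.
Proof.
  intros Huv.
  assert (E : dv (fun u v => dot (F i u v) (F j u v)) u v = 0).
  { rewrite (dv_ext D _ (fun _ _ => kron i j)); trivial.
    - apply dv_const.
    - intros s t Hst. now apply (adapted_dot D z phi psi nu1 nu2 lam mu). }
  rewrite (dv_dot D) in E; trivial. unfold om_v.
  rewrite (dot_sym (dv4 (F j) u v)). lra.
Qed.

Lemma adapted_second_derivatives j u v : D u v ->
  dot (du4 (du4 z) u v) (F j u v)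
    = du phi u v * kron i1 j + phi u v * om_u i1 j u v /\
  dot (dv4 (du4 z) u v) (F j u v)
    = dv phi u v * kron i1 j + phi u v * om_v i1 j u v /\
  dot (dv4 (du4 z) u v) (F j u v)
    = du psi u v * kron i2 j + psi u v * om_u i2 j u v /\
  dot (dv4 (dv4 z) u v) (F j u v)
    = dv psi u v * kron i2 j + psi u v * om_v i2 j u v.
Proof.
  intros Huv.
  assert (Eu : forall u v, D u v -> du4 z u v = scal (phi u v) (F i1 u v))
    by (intros; now apply HF).
  assert (Ev : forall u v, D u v -> dv4 z u v = scal (psi u v) (F i2 u v))
    by (intros; now apply HF).
  assert (K : forall i, dot (F i u v) (F j u v) = kron i j)
    by (intros i; now apply (adapted_dot D z phi psi nu1 nu2 lam mu)).
  repeat split.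
  - rewrite (du4_scal D phi (F i1)) by trivial.
    rewrite dot_plus_l, !dot_scal_l, K. reflexivity.
  - rewrite (dv4_scal D phi (F i1)) by trivial.
    rewrite dot_plus_l, !dot_scal_l, K. reflexivity.
  - rewrite (smooth_vec_schwarz D) by trivial.
    rewrite (du4_scal D psi (F i2)) by trivial.
    rewrite dot_plus_l, !dot_scal_l, K. reflexivity.
  - rewrite (dv4_scal D psi (F i2)) by trivial.
    rewrite dot_plus_l, !dot_scal_l, K. reflexivity.
Qed.

Lemma tangent_connection u v : D u v ->
  om_u i1 i2 u v = - (dv phi u v / psi u v) /\
  om_u i1 i3 u v = phi u v * nu1 u v /\ om_u i1 i4 u v = 0 /\
  om_u i2 i3 u v = phi u v * lam u v /\ om_u i2 i4 u v = phi u v * mu u v /\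
  om_v i1 i2 u v = du psi u v / phi u v /\
  om_v i1 i3 u v = psi u v * lam u v /\ om_v i1 i4 u v = psi u v * mu u v /\
  om_v i2 i3 u v = psi u v * nu2 u v /\ om_v i2 i4 u v = 0.
Proof.
  intros Huv. assert (P := Hphi u v Huv). assert (S := Hpsi u v Huv).
  destruct (HF u v Huv) as (_ & _ & _ & _ & B1 & L1 & B2 & L2 & B3 & L3).
  destruct (adapted_second_derivatives i1 u v Huv) as (_ & X1 & X2 & _).
  destruct (adapted_second_derivatives i2 u v Huv) as (_ & Y1 & Y2 & _).
  destruct (adapted_second_derivatives i3 u v Huv) as (b1 & b2 & b3 & b4).
  destruct (adapted_second_derivatives i4 u v Huv) as (l1 & l2 & l3 & l4).
  assert (N1 := om_u_skew i2 i1 u v Huv). assert (N2 := om_v_skew i1 i1 u v Huv).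
  assert (N3 := om_u_skew i2 i2 u v Huv).
  simpl kron in *.
  assert (eqp : forall a b, phi u v * a = phi u v * b -> a = b).
  { intros a b H. apply (Rmult_eq_reg_l (phi u v)); lra. }
  assert (eqs : forall a b, psi u v * a = psi u v * b -> a = b).
  { intros a b H. apply (Rmult_eq_reg_l (psi u v)); lra. }
  repeat split.
  - apply eqs. replace (psi u v * - (dv phi u v / psi u v)) with (- dv phi u v)
      by (field; lra). nra.
  - apply eqp. lra.
  - apply eqp. lra.
  - apply eqs. lra.
  - apply eqs. lra.
  - apply eqp. replace (phi u v * (du psi u v / phi u v)) with (du psi u v)
      by (field; lra). nra.
  - apply eqp. lra.
  - apply eqp. lra.
  - apply eqs. lra.
  - apply eqs. lra.
Qed.

(** The normal connection is read off from the mixed derivatives of [x] and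
    [y] in the direction of [b]; this is where [mu <> 0] is essential. *)
Lemma normal_connection u v : D u v ->
  om_u i3 i4 u v = normal_conn_u nu1 nu2 lam mu phi psi u v /\
  om_v i3 i4 u v = normal_conn_v nu1 nu2 lam mu phi psi u v.
Proof.
  intros Huv. assert (P := Hphi u v Huv). assert (S := Hpsi u v Huv).
  assert (M := Hmu0 u v Huv).
  destruct (tangent_connection u v Huv)
    as (u12 & u13 & u14 & u23 & u24 & v12 & v13 & v14 & v23 & v24).
  assert (u21 := om_u_skew i2 i1 u v Huv). assert (v21 := om_v_skew i2 i1 u v Huv).
  assert (u31 := om_u_skew i3 i1 u v Huv). assert (v31 := om_v_skew i3 i1 u v Huv).
  assert (u32 := om_u_skew i3 i2 u v Huv). assert (v32 := om_v_skew i3 i2 u v Huv).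
  assert (u11 := om_u_skew i1 i1 u v Huv). assert (v11 := om_v_skew i1 i1 u v Huv).
  assert (u22 := om_u_skew i2 i2 u v Huv). assert (v22 := om_v_skew i2 i2 u v Huv).
  assert (u33 := om_u_skew i3 i3 u v Huv). assert (v33 := om_v_skew i3 i3 u v Huv).
  assert (u11' : om_u i1 i1 u v = 0) by lra. assert (v11' : om_v i1 i1 u v = 0) by lra.
  assert (u22' : om_u i2 i2 u v = 0) by lra. assert (v22' : om_v i2 i2 u v = 0) by lra.
  assert (u33' : om_u i3 i3 u v = 0) by lra. assert (v33' : om_v i3 i3 u v = 0) by lra.
  assert (Ho : orthonormal_columns (fun i => F i u v)) by now apply HF.
  assert (C1 := mixed_derivative_components D (F i1) (F i3) u v HD (SF i1) (SF i3) Huv).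
  assert (C2 := mixed_derivative_components D (F i2) (F i3) u v HD (SF i2) (SF i3) Huv).
  rewrite (dv_ext D _ (fun u v => phi u v * nu1 u v)) in C1; trivial.
  2:{ intros s t Hst.
      destruct (tangent_connection s t Hst) as (_ & h & _).
      exact h. }
  rewrite (du_ext D _ (fun u v => psi u v * lam u v)) in C1; trivial.
  2:{ intros s t Hst.
      destruct (tangent_connection s t Hst) as (_ & _ & _ & _ & _ & _ & h & _).
      exact h. }
  rewrite (dv_ext D _ (fun u v => phi u v * lam u v)) in C2; trivial.
  2:{ intros s t Hst.
      destruct (tangent_connection s t Hst) as (_ & _ & _ & h & _).
      exact h. }
  rewrite (du_ext D _ (fun u v => psi u v * nu2 u v)) in C2; trivial.
  2:{ intros s t Hst.
      destruct (tangent_connection s t Hst) as (_ & _ & _ & _ & _ & _ & _ & _ & h & _).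
      exact h. }
  rewrite (dv_mult D), (du_mult D) in C1, C2 by trivial.
  rewrite (parseval _ (du4 (F i1) u v) (dv4 (F i3) u v) Ho),
    (parseval _ (dv4 (F i1) u v) (du4 (F i3) u v) Ho) in C1.
  rewrite (parseval _ (du4 (F i2) u v) (dv4 (F i3) u v) Ho),
    (parseval _ (dv4 (F i2) u v) (du4 (F i3) u v) Ho) in C2.
  unfold sum4 in C1, C2.
  change (dot (du4 (F ?i) u v) (F ?j u v)) with (om_u i j u v) in C1, C2.
  change (dot (dv4 (F ?i) u v) (F ?j u v)) with (om_v i j u v) in C1, C2.
  rewrite u11', v11', u12, v12, u32, v32, u23, v23, u14, v14, u33', v33', u13, v13
    in C1.
  rewrite u22', v22', u21, v21, u12, v12, u31, v31, u13, v13, u24, v24,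
    u33', v33', u23, v23 in C2.
  unfold normal_conn_u, normal_conn_v. split.
  - apply (Rmult_eq_reg_l (psi u v * mu u v)).
    2:{ apply Rmult_integral_contrapositive_currified; lra. }
    match goal with |- _ = ?r => replace r with
      (2 * lam u v * du psi u v - (nu1 u v - nu2 u v) * dv phi u v
       + psi u v * du lam u v - phi u v * dv nu1 u v) by (field; lra) end.
    assert (E1 : dv phi u v / psi u v * (psi u v * nu2 u v) = dv phi u v * nu2 u v)
      by (field; lra).
    assert (E2 : du psi u v / phi u v * (phi u v * lam u v) = du psi u v * lam u v)
      by (field; lra).
    lra.
  - apply (Rmult_eq_reg_l (phi u v * mu u v)).
    2:{ apply Rmult_integral_contrapositive_currified; lra. }
    match goal with |- _ = ?r => replace r with
      (2 * lam u v * dv phi u v + (nu1 u v - nu2 u v) * du psi u v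
       - psi u v * du nu2 u v + phi u v * dv lam u v) by (field; lra) end.
    assert (E1 : dv phi u v / psi u v * (psi u v * lam u v) = dv phi u v * lam u v)
      by (field; lra).
    assert (E2 : du psi u v / phi u v * (phi u v * nu1 u v) = du psi u v * nu1 u v)
      by (field; lra).
    lra.
Qed.

(** The frame of a surface is thus governed by [phi], [psi] and the geometric
    functions alone. *)
Lemma adapted_moving_frame :
  moving_frame D (conn_u nu1 nu2 lam mu phi psi) (conn_v nu1 nu2 lam mu phi psi) F.
Proof.
  assert (Eu : forall i j u v, D u v ->
            om_u i j u v = conn_u nu1 nu2 lam mu phi psi i j u v).
  { intros i j u v Huv.
    destruct (tangent_connection u v Huv)
      as (u12 & u13 & u14 & u23 & u24 & _).
    destruct (normal_connection u v Huv) as [u34 _].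
    assert (N := om_u_skew i j u v Huv). unfold conn_u.
    destruct i, j; simpl; lra. }
  assert (Ev : forall i j u v, D u v ->
            om_v i j u v = conn_v nu1 nu2 lam mu phi psi i j u v).
  { intros i j u v Huv.
    destruct (tangent_connection u v Huv)
      as (_ & _ & _ & _ & _ & v12 & v13 & v14 & v23 & v24).
    destruct (normal_connection u v Huv) as [_ v34].
    assert (N := om_v_skew i j u v Huv). unfold conn_v.
    destruct i, j; simpl; lra. }
  intros i k u v Huv.
  assert (Ho : orthonormal_columns (fun i => F i u v)) by now apply HF.
  split.
  - rewrite (sum4_ext _ (fun j => om_u i j u v * coord k (F j u v)))
      by (intros j; now rewrite Eu).
    unfold om_u. rewrite <- (orthonormal_expansion (fun i => F i u v)) by exact Ho.
    now apply (is_derive_coord_u D).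
  - rewrite (sum4_ext _ (fun j => om_v i j u v * coord k (F j u v)))
      by (intros j; now rewrite Ev).
    unfold om_v. rewrite <- (orthonormal_expansion (fun i => F i u v)) by exact Ho.
    now apply (is_derive_coord_v D).
Qed.

End Codazzi.

Lemma sff_dot z u v (X Y : R * R) (n : R4) :
  dot n (du4 z u v) = 0 -> dot n (dv4 z u v) = 0 ->
  dot (sff z u v X Y) n
  = fst X * fst Y * dot (du4 (du4 z) u v) n
    + (fst X * snd Y + snd X * fst Y) * dot (dv4 (du4 z) u v) n
    + snd X * snd Y * dot (dv4 (dv4 z) u v) n.
Proof.
  intros Hu Hv. unfold sff. rewrite normal_part_dot by trivial.
  now rewrite !dot_plus_l, !dot_scal_l.
Qed.

Definition geometric_frame (z l : R -> R -> R4) (i : idx) (u v : R) : R4 :=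
  match i with
  | i1 => scal (/ sqrt (formE z u v)) (du4 z u v)
  | i2 => scal (/ sqrt (formG z u v)) (dv4 z u v)
  | i3 => scal (/ enorm (mean_curvature z u v)) (mean_curvature z u v)
  | i4 => l u v
  end.

Lemma geometric_functions_adapted D z phi psi nu1 nu2 lam mu :
  has_geometric_functions D z nu1 nu2 lam mu ->
  (forall u v, D u v -> 0 < phi u v /\ 0 < psi u v) ->
  (forall u v, D u v ->
     sqrt (formE z u v) = phi u v /\ sqrt (formG z u v) = psi u v) ->
  exists l, smooth_vec D l /\
    adapted_frame D z phi psi nu1 nu2 lam mu (geometric_frame z l).
Proof.
  intros (_ & _ & _ & l & Hl & H) Hpos Hsq. exists l.
  split; [now apply smooth4_vec|].
  intros u v Huv. specialize (H u v Huv). cbv zeta in H.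
  destruct (Hsq u v Huv) as [SE SG]. destruct (Hpos u v Huv) as [P S].
  destruct H as (Hfr & Sxx & Sxy & Syy).
  assert (K : forall i j,
    dot (geometric_frame z l i u v) (geometric_frame z l j u v) = kron i j).
  { destruct Hfr as (h1 & h2 & h3 & h4 & h5 & h6 & h7 & h8 & h9 & h10 & _).
    intros [] []; simpl; trivial; rewrite dot_sym; trivial. }
  assert (Hdet : 0 < det4 (geometric_frame z l i1 u v)
    (geometric_frame z l i2 u v) (geometric_frame z l i3 u v)
    (geometric_frame z l i4 u v)) by apply Hfr.
  assert (scal_inv : forall a (p : R4), a <> 0 -> scal a (scal (/ a) p) = p).
  { intros a p Ha. apply R4_ext. intros k. rewrite !coord_scal. now field. }
  assert (Eu : du4 z u v = scal (phi u v) (geometric_frame z l i1 u v)).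
  { simpl. rewrite SE, scal_inv by lra. reflexivity. }
  assert (Ev : dv4 z u v = scal (psi u v) (geometric_frame z l i2 u v)).
  { simpl. rewrite SG, scal_inv by lra. reflexivity. }
  set (b := geometric_frame z l i3 u v) in *.
  change (scal (/ enorm (mean_curvature z u v)) (mean_curvature z u v)) with b in *.
  change (l u v) with (geometric_frame z l i4 u v) in *.
  set (m := geometric_frame z l i4 u v) in *.
  assert (nb : dot b (du4 z u v) = 0 /\ dot b (dv4 z u v) = 0).
  { rewrite Eu, Ev, !dot_scal_r. unfold b. rewrite !K. simpl. lra. }
  assert (nl : dot m (du4 z u v) = 0 /\ dot m (dv4 z u v) = 0).
  { rewrite Eu, Ev, !dot_scal_r. unfold m. rewrite !K. simpl. lra. }
  assert (bb : dot b b = 1) by apply (K i3 i3).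
  assert (mm : dot m m = 1) by apply (K i4 i4).
  assert (bm : dot b m = 0) by apply (K i3 i4).
  assert (mb : dot m b = 0) by apply (K i4 i3).
  rewrite SE, SG in *.
  assert (comp : forall X Y (w n : R4), sff z u v X Y = w ->
            dot (sff z u v X Y) n = dot w n) by (intros; congruence).
  assert (Xb := comp _ _ _ b Sxx). assert (Xl := comp _ _ _ m Sxx).
  assert (Yb := comp _ _ _ b Sxy). assert (Yl := comp _ _ _ m Sxy).
  assert (Zb := comp _ _ _ b Syy). assert (Zl := comp _ _ _ m Syy).
  rewrite sff_dot in Xb, Yb, Zb by tauto.
  rewrite sff_dot in Xl, Yl, Zl by tauto.
  rewrite dot_scal_l, bb in Xb. rewrite dot_scal_l, bm in Xl.
  rewrite dot_plus_l, !dot_scal_l, bb, mb in Yb.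
  rewrite dot_plus_l, !dot_scal_l, bm, mm in Yl.
  rewrite dot_scal_l, bb in Zb. rewrite dot_scal_l, bm in Zl.
  simpl fst in *. simpl snd in *.
  assert (solve2 : forall a b x y, a <> 0 -> b <> 0 ->
            / a * / b * x = y -> x = a * b * y).
  { intros a c x y Ha Hc <-. field. auto. }
  split; [now apply orthonormal_dot_columns|].
  split; [exact Hdet|]. split; [exact Eu|]. split; [exact Ev|].
  change (geometric_frame z l i3 u v) with b.
  change (geometric_frame z l i4 u v) with m.
  repeat split.
  - rewrite (solve2 (phi u v) (phi u v) 
      (dot (du4 (du4 z) u v) b) (nu1 u v)); lra.
  - rewrite (solve2 (phi u v) (phi u v) 
      (dot (du4 (du4 z) u v) m) 0); lra.
  - rewrite (solve2 (phi u v) (psi u v) 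
      (dot (dv4 (du4 z) u v) b) (lam u v)); lra.
  - rewrite (solve2 (phi u v) (psi u v) 
      (dot (dv4 (du4 z) u v) m) (mu u v)); lra.
  - rewrite (solve2 (psi u v) (psi u v) 
      (dot (dv4 (dv4 z) u v) b) (nu2 u v)); lra.
  - rewrite (solve2 (psi u v) (psi u v) 
      (dot (dv4 (dv4 z) u v) m) 0); lra.
Qed.

(** The field [b] is smooth because [(nu1 + nu2) b] is the sum of the normal
    parts of [z_uu / E] and [z_vv / G]. *)
Lemma adapted_frame_smooth D z phi psi nu1 nu2 lam mu F :
  open_plane D -> adapted_frame D z phi psi nu1 nu2 lam mu F ->
  smooth_vec D z -> smooth_vec D (F i4) ->
  smooth_on D phi -> smooth_on D psi -> smooth_on D nu1 -> smooth_on D nu2 ->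
  (forall u v, D u v -> 0 < phi u v) -> (forall u v, D u v -> 0 < psi u v) ->
  (forall u v, D u v -> nu1 u v + nu2 u v > 0) ->
  forall i, smooth_vec D (F i).
Proof.
  intros HD HF Sz Sl Sphi Spsi Snu1 Snu2 Pphi Ppsi Psum.
  assert (Nphi : forall u v, D u v -> phi u v <> 0).
  { intros u v H. specialize (Pphi u v H). lra. }
  assert (Npsi : forall u v, D u v -> psi u v <> 0).
  { intros u v H. specialize (Ppsi u v H). lra. }
  assert (Sx : smooth_vec D (F i1)).
  { intros k. apply (smooth_ext D (fun u v => coord k (du4 z u v) / phi u v)); trivial.
    - intros u v Huv. destruct (HF u v Huv) as (_ & _ & Eu & _).
      rewrite Eu, coord_scal. field. now apply Nphi.
    - apply smooth_div; trivial. now apply smooth_vec_du4. }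
  assert (Sy : smooth_vec D (F i2)).
  { intros k. apply (smooth_ext D (fun u v => coord k (dv4 z u v) / psi u v)); trivial.
    - intros u v Huv. destruct (HF u v Huv) as (_ & _ & _ & Ev & _).
      rewrite Ev, coord_scal. field. now apply Npsi.
    - apply smooth_div; trivial. now apply smooth_vec_dv4. }
  assert (Suu : smooth_vec D (du4 (du4 z))) by now repeat apply smooth_vec_du4.
  assert (Svv : smooth_vec D (dv4 (dv4 z))) by now repeat apply smooth_vec_dv4.
  assert (Sb : smooth_vec D (F i3)).
  { intros k.
    set (nrm := fun (w : R -> R -> R4) u v => coord k (w u v)
      - dot (w u v) (F i1 u v) * coord k (F i1 u v)
      - dot (w u v) (F i2 u v) * coord k (F i2 u v)).
    assert (Snrm : forall w, smooth_vec D w -> smooth_on D (nrm w)).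
    { intros w Sw. unfold nrm.
      repeat apply smooth_minus; trivial; try apply smooth_mult; trivial.
      - now apply smooth_vec_dot.
      - now apply smooth_vec_dot. }
    apply (smooth_ext D (fun u v =>
      (nrm (du4 (du4 z)) u v / phi u v ^ 2 + nrm (dv4 (dv4 z)) u v / psi u v ^ 2)
      / (nu1 u v + nu2 u v))); trivial.
    - intros u v Huv.
      destruct (HF u v Huv) as (Ho & _ & _ & _ & B1 & L1 & _ & _ & B3 & L3).
      unfold nrm.
      rewrite (orthonormal_expansion _ (du4 (du4 z) u v) k Ho),
        (orthonormal_expansion _ (dv4 (dv4 z) u v) k Ho).
      unfold sum4. rewrite B1, L1, B3, L3.
      specialize (Pphi u v Huv). specialize (Ppsi u v Huv).
      specialize (Psum u v Huv). field. lra.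
    - apply smooth_div; trivial.
      + intros u v Huv. specialize (Psum u v Huv). lra.
      + apply smooth_plus; trivial; apply smooth_div; trivial;
          try (now apply Snrm); try (now apply smooth_pow);
          intros u v Huv; apply pow_nonzero; auto.
      + now apply smooth_plus. }
  intros []; trivial.
Qed.

(** * Canonical parameters and the Cauchy problem *)

(** Logarithmic integration of [h' = g h] for an [h] of unknown sign: the product
    with [e^(-int g)] is constant. *)
Lemma integrating_factor J (h g : R -> R) a x :
  is_open_interval J -> J a -> J x ->
  (forall t, J t -> is_derive h t (g t * h t)) ->
  (forall t, J t -> continuous g t) ->
  h x * exp (- RInt g a x) = h a.
Proof.
  intros HJ Ha Hx Hh Hg.
  transitivity (h a * exp (- RInt g a a)).
  2:{ rewrite RInt_point. change (h a * exp (- 0) = h a).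
      rewrite Ropp_0, exp_0. ring. }
  apply (derive_zero_const (fun t => h t * exp (- RInt g a t))).
  intros t Ht. assert (Jt := open_interval_between J a x t HJ Ha Hx Ht).
  assert (Hi := is_derive_RInt_interval J g a t HJ Hg Ha Jt).
  assert (He : is_derive (fun t => exp (- RInt g a t)) t
                 (- g t * exp (- RInt g a t))).
  { apply (is_derive_comp (K := R_AbsRing) (V := R_NormedModule) exp
             (fun t => - RInt g a t) t (exp (- RInt g a t)) (- g t)).
    - apply is_derive_exp.
    - apply (is_derive_opp (K := R_AbsRing) (V := R_NormedModule)). exact Hi. }
  evar_last.
  - apply (derive_mult h (fun t => exp (- RInt g a t)) t _ _
      (Hh t Jt) He).
  - change (@eq R (g t * h t * exp (- RInt g a t)
                   + h t * (- g t * exp (- RInt g a t))) 0). ring.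
Qed.

(** On the initial lines both unknowns of the Cauchy problem solve the same
    linear equation and are therefore proportional. *)
Lemma initial_line_ratio J (h k p q : R -> R) c a :
  is_open_interval J -> J a ->
  (forall t, J t -> is_derive h t ((c * p t + q t) * h t)) ->
  (forall t, J t -> is_derive k t (p t * h t + q t * k t)) ->
  (forall t, J t -> continuous q t) -> h a = c * k a ->
  forall x, J x -> h x = c * k x.
Proof.
  intros HJ Ha Hh Hk Hq E x Hx.
  assert (Z : (h x - c * k x) * exp (- RInt q a x) = h a - c * k a).
  { apply (integrating_factor J (fun t => h t - c * k t)); trivial.
    intros t Ht. evar_last.
    - apply (derive_minus h
               (fun t => c * k t)); [now apply Hh|].
      apply (is_derive_scal k t c). now apply Hk.
    - change (@eq R ((c * p t + q t) * h t - c * (p t * h t + q t * k t))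
                (q t * (h t - c * k t))). ring. }
  rewrite E, Rminus_diag in Z. apply Rmult_integral in Z.
  destruct Z as [Z|Z]; [lra|]. assert (P := exp_pos (- RInt q a x)). lra.
Qed.

Lemma nonvanishing_positive J (h : R -> R) a x :
  is_open_interval J -> J a -> J x ->
  (forall t, J t -> continuous h t) -> (forall t, J t -> h t <> 0) ->
  0 < h a -> 0 < h x.
Proof.
  intros HJ Ha Hx Hc Hn Hpos.
  destruct (Rtotal_order (h x) 0) as [L|[E|G]]; trivial; exfalso.
  2:{ now apply (Hn x Hx). }
  assert (Jt : forall t, between a x t -> J t).
  { intros t. now apply (open_interval_between J a x). }
  destruct (Rtotal_order a x) as [M|[M|M]].
  - destruct (IVT_interv (fun t => - h t) a x) as (t & Ht & Zt); try lra.
    + intros t Ht. apply continuity_pt_continuous.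
      apply (continuous_opp (V := R_NormedModule)). apply Hc, Jt.
      unfold between. rewrite Rmin_left, Rmax_right; lra.
    + apply (Hn t); [|lra]. apply Jt.
      unfold between. rewrite Rmin_left, Rmax_right; lra.
  - rewrite M in Hpos. lra.
  - destruct (IVT_interv h x a) as (t & Ht & Zt); try lra.
    + intros t Ht. apply continuity_pt_continuous. apply Hc, Jt.
      unfold between. rewrite Rmin_right, Rmax_left; lra.
    + apply (Hn t); [|lra]. apply Jt.
      unfold between. rewrite Rmin_right, Rmax_left; lra.
Qed.

Lemma is_derive_exp_RInt J (g : R -> R) a x b :
  is_open_interval J -> J a -> J x -> (forall t, J t -> continuous g t) ->
  is_derive (fun t => exp (RInt g a t + b)) x (g x * exp (RInt g a x + b)).
Proof.
  intros HJ Ha Hx Hg.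
  apply (is_derive_comp (K := R_AbsRing) (V := R_NormedModule) exp
           (fun t => RInt g a t + b) x (exp (RInt g a x + b)) (g x)).
  - apply is_derive_exp.
  - evar_last.
    + apply (derive_plus
               (fun t => RInt g a t) (fun _ => b)).
      * now apply (is_derive_RInt_interval J).
      * apply (derive_const).
    + apply Rplus_0_r.
Qed.

Lemma f_smooth D nu1 nu2 lam mu : open_plane D ->
  smooth_on D nu1 -> smooth_on D nu2 -> smooth_on D lam -> smooth_on D mu ->
  (forall u v, D u v -> Theta nu1 nu2 lam mu u v <> 0) ->
  smooth_on D (f1 nu1 nu2 lam mu) /\ smooth_on D (f2 nu1 nu2 lam mu) /\
  smooth_on D (f3 nu1 nu2 lam mu) /\ smooth_on D (f4 nu1 nu2 lam mu).
Proof.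
  intros HD H1 H2 Hl Hm HT.
  assert (ST : smooth_on D (Theta nu1 nu2 lam mu)) by (unfold Theta; smooth).
  repeat split; unfold f1, f2, f3, f4; smooth;
    first [exact HT|intros; lra].
Qed.

Section Cauchy.

Variables (I J : R -> Prop) (nu1 nu2 lam mu : R -> R -> R) (u0 v0 c1 c2 : R).
Hypotheses (HI : is_open_interval I) (HJ : is_open_interval J).
Hypothesis H0 : rect I J u0 v0.
Let U := rect I J.
Hypotheses (Hnu1 : smooth_on U nu1) (Hnu2 : smooth_on U nu2)
  (Hlam : smooth_on U lam) (Hmu : smooth_on U mu).
Hypothesis HTheta : forall u v, U u v -> Theta nu1 nu2 lam mu u v <> 0.

Let F1 := f1 nu1 nu2 lam mu.
Let F2 := f2 nu1 nu2 lam mu.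
Let F3 := f3 nu1 nu2 lam mu.
Let F4 := f4 nu1 nu2 lam mu.
Let c := exp (c2 - c1).
Let g1 u := exp (RInt (fun s => c * F3 s v0 + F4 s v0) u0 u - c1).
Let g2 v := exp (RInt (fun t => F1 u0 t + 1 / c * F2 u0 t) v0 v - c2).

Variables (phi psi : R -> R -> R).
Hypotheses (Hphi : smooth_on U phi) (Hpsi : smooth_on U psi).
Hypotheses (Hphi0 : forall u v, U u v -> phi u v <> 0)
  (Hpsi0 : forall u v, U u v -> psi u v <> 0).
Hypothesis Hphiv : forall u v, U u v ->
  dv phi u v = F1 u v * phi u v + F2 u v * psi u v.
Hypothesis Hpsiu : forall u v, U u v ->
  du psi u v = F3 u v * phi u v + F4 u v * psi u v.
Hypothesis Hphig : forall u, I u -> phi u v0 = g1 u.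
Hypothesis Hpsig : forall v, J v -> psi u0 v = g2 v.

Let HU : open_plane U := rect_open I J HI HJ.

Lemma f_cont2 :
  cont2_on U F1 /\ cont2_on U F2 /\ cont2_on U F3 /\ cont2_on U F4.
Proof.
  destruct (f_smooth U nu1 nu2 lam mu) as (S1 & S2 & S3 & S4); trivial.
  repeat split; now apply smooth_cont2.
Qed.

Lemma c_pos : 0 < c.
Proof. apply exp_pos. Qed.

Lemma solution_positive u v : U u v -> 0 < phi u v /\ 0 < psi u v.
Proof.
  intros [Hu Hv]. split.
  - apply (nonvanishing_positive J (fun t => phi u t) v0 v); trivial.
    + apply H0.
    + intros t Ht. apply (cont2_continuous_v U); [now apply smooth_cont2|now split].
    + intros t Ht. apply Hphi0. now split.
    + rewrite Hphig by trivial. apply exp_pos.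
  - apply (nonvanishing_positive I (fun s => psi s v) u0 u); trivial.
    + apply H0.
    + intros s Hs. apply (cont2_continuous_u U psi); [now apply smooth_cont2|now split].
    + intros s Hs. apply Hpsi0. now split.
    + rewrite Hpsig by trivial. apply exp_pos.
Qed.

Lemma continuous_initial_u s : I s -> continuous (fun s => c * F3 s v0 + F4 s v0) s.
Proof.
  intros Hs. destruct f_cont2 as (_ & _ & C3 & C4).
  apply (cont2_continuous_u U (fun u v => c * F3 u v + F4 u v) s v0).
  - apply cont2_plus; trivial. apply cont2_mult; trivial. apply cont2_const.
  - split; trivial. apply H0.
Qed.

Lemma continuous_initial_v t : J t -> continuous (fun t => F1 u0 t + 1 / c * F2 u0 t) t.
Proof.
  intros Ht. destruct f_cont2 as (C1 & C2 & _ & _).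
  apply (cont2_continuous_v U (fun u v => F1 u v + 1 / c * F2 u v)).
  - apply cont2_plus; trivial. apply cont2_mult; trivial. apply cont2_const.
  - split; trivial. apply H0.
Qed.

Lemma initial_corner : phi u0 v0 = exp (- c1) /\ psi u0 v0 = exp (- c2).
Proof.
  rewrite Hphig, Hpsig by apply H0. unfold g1, g2. rewrite !RInt_point.
  split; f_equal; unfold zero; simpl; ring.
Qed.

Lemma corner_ratio : exp (- c1) = c * exp (- c2).
Proof. unfold c. rewrite <- exp_plus. f_equal. ring. Qed.

Lemma ratio_v0 u : I u -> phi u v0 = c * psi u v0.
Proof.
  destruct H0 as [Hu0 Hv0].
  apply (initial_line_ratio I (fun u => phi u v0) (fun u => psi u v0)
           (fun s => F3 s v0) (fun s => F4 s v0) c u0); trivial.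
  - intros t Ht.
    apply (is_derive_ext_loc g1).
    + generalize (open_interval_open I t HI Ht). apply filter_imp.
      intros s Hs. symmetry. now apply Hphig.
    + rewrite Hphig by trivial.
      apply (is_derive_exp_RInt I (fun s => c * F3 s v0 + F4 s v0)); trivial.
      intros s Hs. now apply continuous_initial_u.
  - intros t Ht. rewrite <- Hpsiu by now split.
    apply (smooth_is_derive_u U); trivial. now split.
  - intros t Ht. apply (cont2_continuous_u U F4); [apply f_cont2|now split].
  - destruct initial_corner as [-> ->]. apply corner_ratio.
Qed.

Lemma ratio_u0 v : J v -> phi u0 v = c * psi u0 v.
Proof.
  destruct H0 as [Hu0 Hv0]. assert (P := c_pos). intros Hv.
  enough (E : psi u0 v = 1 / c * phi u0 v) by (rewrite E; field; lra).
  revert v Hv.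
  apply (initial_line_ratio J (fun v => psi u0 v) (fun v => phi u0 v)
           (fun t => F2 u0 t) (fun t => F1 u0 t) (1 / c) v0); trivial.
  - intros t Ht.
    apply (is_derive_ext_loc g2).
    + generalize (open_interval_open J t HJ Ht). apply filter_imp.
      intros s Hs. symmetry. now apply Hpsig.
    + rewrite Hpsig by trivial. rewrite (Rplus_comm (1 / c * F2 u0 t)).
      apply (is_derive_exp_RInt J (fun t => F1 u0 t + 1 / c * F2 u0 t)); trivial.
      intros s Hs. now apply continuous_initial_v.
  - intros t Ht. rewrite Rplus_comm, <- Hphiv by now split.
    apply (smooth_is_derive_v U); trivial. now split.
  - intros t Ht. apply (cont2_continuous_v U F1); [apply f_cont2|now split].
  - destruct initial_corner as [-> ->]. rewrite corner_ratio. field. lra.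
Qed.

(** For a surface with [sqrt E = phi] and [sqrt G = psi] the integrands of
    [Phi] and [Psi] are the logarithmic derivatives of [phi] and [psi], and the
    integrals telescope. *)
Lemma solution_canonical z :
  (forall u v, U u v ->
     sqrt (formE z u v) = phi u v /\ sqrt (formG z u v) = psi u v) ->
  forall u v, U u v ->
    Phi z nu1 nu2 lam mu u0 v0 c1 u v = 1 /\
    Psi z nu1 nu2 lam mu u0 v0 c2 u v = 1.
Proof.
  intros Hz u v Huv.
  destruct f_cont2 as (C1 & C2 & C3 & C4). destruct H0 as [Hu0 Hv0].
  destruct Huv as [Hu Hv].
  assert (Ipsi : cont2_on U (fun u v => / psi u v))
    by (apply cont2_inv; trivial; now apply smooth_cont2).
  assert (Iphi : cont2_on U (fun u v => / phi u v))
    by (apply cont2_inv; trivial; now apply smooth_cont2).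
  set (G12 u v := F1 u v + F2 u v * (psi u v / phi u v)).
  set (G34 u v := F3 u v * (phi u v / psi u v) + F4 u v).
  assert (C12 : cont2_on U G12).
  { apply cont2_plus; trivial. apply cont2_mult; trivial.
    apply (cont2_mult U psi (fun u v => / phi u v)); trivial.
    now apply smooth_cont2. }
  assert (C34 : cont2_on U G34).
  { apply cont2_plus; trivial. apply cont2_mult; trivial.
    apply (cont2_mult U phi (fun u v => / psi u v)); trivial.
    now apply smooth_cont2. }
  assert (R12 : forall x, I x -> forall y, J y ->
    RInt (fun t => f12 z nu1 nu2 lam mu x t) v0 y = RInt (fun t => G12 x t) v0 y).
  { intros x Hx y Hy. apply (RInt_ext (V := R_CompleteNormedModule)).
    intros t Ht. destruct (Hz x t) as [E G].
    { split; trivial. apply (open_interval_between J v0 y); trivial.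
      unfold between. lra. }
    unfold f12. now rewrite E, G. }
  assert (R34 : forall y, J y -> forall x, I x ->
    RInt (fun s => f34 z nu1 nu2 lam mu s y) u0 x = RInt (fun s => G34 s y) u0 x).
  { intros y Hy x Hx. apply (RInt_ext (V := R_CompleteNormedModule)).
    intros s Hs. destruct (Hz s y) as [E G].
    { split; trivial. apply (open_interval_between I u0 x); trivial.
      unfold between. lra. }
    unfold f34. now rewrite E, G. }
  assert (L12 : forall x y, I x -> J y ->
    phi x y * exp (- RInt (fun t => G12 x t) v0 y) = phi x v0).
  { intros x y Hx Hy.
    apply (integrating_factor J (fun t => phi x t) (fun t => G12 x t)); trivial.
    - intros t Ht. assert (Uxt : U x t) by now split.
      replace (G12 x t * phi x t) with (dv phi x t)
        by (rewrite Hphiv by trivial; unfold G12; field; now apply Hphi0).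
      now apply (smooth_is_derive_v U).
    - intros t Ht. apply (cont2_continuous_v U); trivial. now split. }
  assert (L34 : forall x y, I x -> J y ->
    psi x y * exp (- RInt (fun s => G34 s y) u0 x) = psi u0 y).
  { intros x y Hx Hy.
    apply (integrating_factor I (fun s => psi s y) (fun s => G34 s y)); trivial.
    - intros s Hs. assert (Usy : U s y) by now split.
      replace (G34 s y * psi s y) with (du psi s y)
        by (rewrite Hpsiu by trivial; unfold G34; field; now apply Hpsi0).
      now apply (smooth_is_derive_u U).
    - intros s Hs. apply (cont2_continuous_u U G34); trivial. now split. }
  destruct initial_corner as [I1 I2].
  destruct (Hz u v) as [E G]; [now split|].
  assert (P := c_pos).
  unfold Phi, Psi. rewrite E, G, !R12, !R34 by trivial. unfold Rminus.
  rewrite !exp_plus. split.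
  - rewrite <- !Rmult_assoc, L12, ratio_v0 by trivial.
    rewrite (Rmult_assoc c), L34, I2 by trivial.
    unfold c. rewrite <- !exp_plus.
    replace (c2 - c1 + - c2 + c1) with 0 by ring. apply exp_0.
  - rewrite <- !Rmult_assoc, L34 by trivial.
    assert (E2 := ratio_u0 v Hv).
    assert (E3 := L12 u0 v Hu0 Hv). rewrite I1, E2 in E3.
    apply (Rmult_eq_reg_l c); [|lra].
    rewrite <- !Rmult_assoc, E3. unfold c. rewrite <- !exp_plus.
    rewrite Rmult_1_r. f_equal. ring.
Qed.

(** Conversely [Phi = Psi = 1] says that [sqrt E] and [sqrt G] solve the Cauchy
    problem of [phi] and [psi]. *)
Lemma canonical_solution z : smooth_vec U z ->
  (forall u v, U u v ->
    Phi z nu1 nu2 lam mu u0 v0 c1 u v = 1 /\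
    Psi z nu1 nu2 lam mu u0 v0 c2 u v = 1) ->
  forall u v, U u v ->
     sqrt (formE z u v) = phi u v /\ sqrt (formG z u v) = psi u v.
Proof.
  intros Sz Hcan.
  destruct f_cont2 as (C1 & C2 & C3 & C4). assert (H0' := H0).
  destruct H0' as [Hu0 Hv0].
  set (e u v := sqrt (formE z u v)). set (g u v := sqrt (formG z u v)).
  set (G12 := f12 z nu1 nu2 lam mu). set (G34 := f34 z nu1 nu2 lam mu).
  assert (Ee : forall u v, U u v -> e u v =
    exp (RInt (fun t => G12 u t) v0 v + (RInt (fun s => G34 s v0) u0 u - c1))).
  { intros u v Huv. destruct (Hcan u v Huv) as [H _]. unfold Phi in H.
    fold (e u v) in H. fold G12 G34 in H.
    replace (RInt (fun t => G12 u t) v0 v + (RInt (fun s => G34 s v0) u0 u - c1))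
      with (- (- RInt (fun t => G12 u t) v0 v - RInt (fun s => G34 s v0) u0 u + c1))
      by ring.
    rewrite exp_Ropp.
    match type of H with _ * exp ?x = _ => assert (Q := exp_pos x) end.
    apply (Rmult_eq_reg_r (exp (- RInt (fun t => G12 u t) v0 v
              - RInt (fun s => G34 s v0) u0 u + c1))); [|lra].
    rewrite H. field. lra. }
  assert (Eg : forall u v, U u v -> g u v =
    exp (RInt (fun s => G34 s v) u0 u + (RInt (fun t => G12 u0 t) v0 v - c2))).
  { intros u v Huv. destruct (Hcan u v Huv) as [_ H]. unfold Psi in H.
    fold (g u v) in H. fold G12 G34 in H.
    replace (RInt (fun s => G34 s v) u0 u + (RInt (fun t => G12 u0 t) v0 v - c2))
      with (- (- RInt (fun s => G34 s v) u0 u - RInt (fun t => G12 u0 t) v0 v + c2))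
      by ring.
    rewrite exp_Ropp.
    match type of H with _ * exp ?x = _ => assert (Q := exp_pos x) end.
    apply (Rmult_eq_reg_r (exp (- RInt (fun s => G34 s v) u0 u
              - RInt (fun t => G12 u0 t) v0 v + c2))); [|lra].
    rewrite H. field. lra. }
  assert (Pe : forall u v, U u v -> e u v <> 0).
  { intros u v H. rewrite Ee by trivial.
    match goal with |- exp ?x <> _ => assert (Q := exp_pos x) end. lra. }
  assert (Pg : forall u v, U u v -> g u v <> 0).
  { intros u v H. rewrite Eg by trivial.
    match goal with |- exp ?x <> _ => assert (Q := exp_pos x) end. lra. }
  assert (Csqrt : forall f, smooth_on U f -> cont2_on U (fun u v => sqrt (f u v))).
  { intros f Hf u v Huv.
    apply (continuous_comp (fun p : R * R => f (fst p) (snd p)) sqrt).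
    - now apply (smooth_cont2 U f Hf).
    - apply continuous_sqrt. }
  assert (Ce : cont2_on U e).
  { apply Csqrt. apply smooth_vec_dot; trivial; now apply smooth_vec_du4. }
  assert (Cg : cont2_on U g).
  { apply Csqrt. apply smooth_vec_dot; trivial; now apply smooth_vec_dv4. }
  assert (C12 : cont2_on U G12).
  { apply (cont2_plus U F1); trivial. apply (cont2_mult U F2); trivial.
    apply (cont2_mult U g (fun u v => / e u v)); trivial. now apply cont2_inv. }
  assert (C34 : cont2_on U G34).
  { apply cont2_plus; trivial. apply (cont2_mult U F3); trivial.
    apply (cont2_mult U e (fun u v => / g u v)); trivial. now apply cont2_inv. }
  assert (De : forall u v, U u v ->
    is_derive (fun t => e u t) v (F1 u v * e u v + F2 u v * g u v)).
  { intros u v [Hu Hv].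
    apply (is_derive_ext_loc (fun t => exp (RInt (fun t => G12 u t) v0 t
             + (RInt (fun s => G34 s v0) u0 u - c1)))).
    - generalize (open_interval_open J v HJ Hv). apply filter_imp.
      intros t Ht. symmetry. apply Ee. now split.
    - assert (Huv : U u v) by now split.
      replace (F1 u v * e u v + F2 u v * g u v) with (G12 u v * e u v)
        by (unfold G12, f12; fold (e u v) (g u v) F1 F2; field; now apply Pe).
      rewrite Ee by trivial.
      apply (is_derive_exp_RInt J (fun t => G12 u t)); trivial.
      intros t Ht. apply (cont2_continuous_v U); trivial. now split. }
  assert (Dg : forall u v, U u v ->
    is_derive (fun s => g s v) u (F3 u v * e u v + F4 u v * g u v)).
  { intros u v [Hu Hv].
    apply (is_derive_ext_loc (fun s => exp (RInt (fun s => G34 s v) u0 s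
             + (RInt (fun t => G12 u0 t) v0 v - c2)))).
    - generalize (open_interval_open I u HI Hu). apply filter_imp.
      intros s Hs. symmetry. apply Eg. now split.
    - assert (Huv : U u v) by now split.
      replace (F3 u v * e u v + F4 u v * g u v) with (G34 u v * g u v)
        by (unfold G34, f34; fold (e u v) (g u v) F3 F4; field; now apply Pg).
      rewrite Eg by trivial.
      apply (is_derive_exp_RInt I (fun s => G34 s v)); trivial.
      intros s Hs. apply (cont2_continuous_u U G34); trivial. now split. }
  assert (ptz : forall (f : R -> R) a, RInt f a a = 0)
    by (intros f a; exact (RInt_point (V := R_CompleteNormedModule) a f)).
  assert (Pc := c_pos).
  assert (rv0 : forall s, I s -> e s v0 / g s v0 = c).
  { intros s Hs. rewrite Ee, Eg by (split; trivial). rewrite !ptz.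
    unfold c, Rdiv. rewrite <- exp_Ropp, <- exp_plus. f_equal. ring. }
  assert (ru0 : forall t, J t -> g u0 t / e u0 t = 1 / c).
  { intros t Ht. rewrite Ee, Eg by (split; trivial). rewrite !ptz.
    unfold c, Rdiv. rewrite Rmult_1_l, <- !exp_Ropp, <- exp_plus. f_equal. ring. }
  assert (ev0 : forall u, I u -> e u v0 - phi u v0 = 0).
  { intros u Hu. rewrite Hphig by trivial.
    rewrite Ee by (split; trivial). rewrite ptz. unfold g1.
    rewrite (RInt_ext (V := R_CompleteNormedModule) (fun s => G34 s v0)
               (fun s => c * F3 s v0 + F4 s v0)).
    - rewrite Rplus_0_l. ring.
    - intros s Hs. unfold G34, f34. fold (e s v0) (g s v0) F3 F4.
      rewrite rv0; [apply Rplus_eq_compat_r, Rmult_comm|].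
      apply (open_interval_between I u0 u); trivial. unfold between. lra. }
  assert (gu0 : forall v, J v -> g u0 v - psi u0 v = 0).
  { intros v Hv. rewrite Hpsig by trivial.
    rewrite Eg by (split; trivial). rewrite ptz. unfold g2.
    rewrite (RInt_ext (V := R_CompleteNormedModule) (fun t => G12 u0 t)
               (fun t => F1 u0 t + 1 / c * F2 u0 t)).
    - rewrite Rplus_0_l. ring.
    - intros t Ht. unfold G12, f12. fold (e u0 t) (g u0 t) F1 F2.
      rewrite ru0; [apply Rplus_eq_compat_l, Rmult_comm|].
      apply (open_interval_between J v0 v); trivial. unfold between. lra. }
  assert (Cm : forall f h, cont2_on U f -> smooth_on U h ->
            cont2_on U (fun u v => f u v - h u v)).
  { intros f h Hf Hh. apply (cont2_plus U f (fun u v => - h u v)); trivial.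
    apply smooth_cont2. now apply smooth_opp. }
  intros u v Huv.
  destruct (goursat_unique I J F1 F2 F3 F4 (fun u v => e u v - phi u v)
    (fun u v => g u v - psi u v) u0 v0) with (u := u) (v := v) as [Z1 Z2]; trivial.
  - now apply Cm.
  - now apply Cm.
  - intros x y Hxy. evar_last.
    + apply (derive_minus
               (fun t => e x t) (fun t => phi x t)).
      * now apply De.
      * now apply (smooth_is_derive_v U).
    + change (@eq R (F1 x y * e x y + F2 x y * g x y - dv phi x y)
        (F1 x y * (e x y - phi x y) + F2 x y * (g x y - psi x y))).
      rewrite Hphiv by trivial. ring.
  - intros x y Hxy. evar_last.
    + apply (derive_minus
               (fun s => g s y) (fun s => psi s y)).
      * now apply Dg.
      * now apply (smooth_is_derive_u U).
    + change (@eq R (F3 x y * e x y + F4 x y * g x y - du psi x y)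
        (F3 x y * (e x y - phi x y) + F4 x y * (g x y - psi x y))).
      rewrite Hpsiu by trivial. ring.
  - unfold e, g in *. lra.
Qed.

End Cauchy.

(** * The fundamental theorem *)

Lemma frame_map_frame F F' j : orthonormal_columns F ->
  frame_map F F' (F j) = F' j.
Proof.
  intros HF. apply R4_ext. intros k. unfold frame_map. rewrite coord_vec.
  rewrite (sum4_ext _ (fun i => kron i j * coord k (F' i)))
    by (intros i; now rewrite (orthonormal_columns_dot F i j HF)).
  unfold sum4, kron. destruct j; ring.
Qed.

Lemma frame_map_scal F F' a (q : R4) :
  frame_map F F' (scal a q) = scal a (frame_map F F' q).
Proof.
  apply R4_ext. intros k. unfold frame_map. rewrite coord_scal, !coord_vec.
  unfold sum4. rewrite !dot_scal_r. ring.
Qed.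

Lemma frame_map_transition F F' G G' q :
  (forall l k, sum4 (fun i => coord l (F i) * coord k (F' i))
               = sum4 (fun i => coord l (G i) * coord k (G' i))) ->
  frame_map F F' q = frame_map G G' q.
Proof.
  intros H.
  assert (E : forall F F', frame_map F F' q = vec (fun k =>
    sum4 (fun l => sum4 (fun i => coord l (F i) * coord k (F' i)) * coord l q))).
  { clear. intros F F'. apply R4_ext. intros k. unfold frame_map.
    rewrite !coord_vec. unfold sum4. rewrite !dot_sum4. unfold sum4. ring. }
  rewrite !E. apply R4_ext. intros k. rewrite !coord_vec.
  apply sum4_ext. intros l. now rewrite H.
Qed.

Lemma is_derive_frame_motion z z' F F' (q : R -> R4) (q' : R4) t k :
  (forall l, is_derive (fun s => coord l (q s)) t (coord l q')) ->
  is_derive (fun s => coord k (frame_motion z z' F F' (q s))) t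
            (coord k (frame_map F F' q')).
Proof.
  intros Hq.
  apply (is_derive_ext (fun s => coord k z' + sum4 (fun i => coord k (F' i) *
    sum4 (fun l => coord l (F i) * (coord l (q s) - coord l z))))).
  { intros s. unfold frame_motion, frame_map. rewrite coord_plus, coord_vec.
    apply Rplus_eq_compat_l. apply sum4_ext. intros i.
    rewrite dot_sum4, Rmult_comm. apply Rmult_eq_compat_r. apply sum4_ext.
    intros l. now rewrite coord_minus. }
  evar_last.
  - apply (derive_plus
             (fun _ => coord k z')).
    + apply (derive_const).
    + apply (is_derive_sum4 (fun i s => coord k (F' i) *
        sum4 (fun l => coord l (F i) * (coord l (q s) - coord l z)))).
      intros i.
      apply (is_derive_scal (fun s =>
        sum4 (fun l => coord l (F i) * (coord l (q s) - coord l z)))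
        t (coord k (F' i))).
      apply (is_derive_sum4 (fun l s => coord l (F i) * (coord l (q s) - coord l z))).
      intros l.
      apply (is_derive_scal (fun s => coord l (q s) - coord l z) t (coord l (F i))).
      apply (derive_minus
               (fun s => coord l (q s)) (fun _ => coord l z)).
      * apply Hq.
      * apply (derive_const).
  - unfold frame_map. rewrite coord_vec.
    change (@eq R (0 + sum4 (fun i => coord k (F' i) *
        sum4 (fun l => coord l (F i) * (coord l q' - 0))))
      (sum4 (fun i => dot (F i) q' * coord k (F' i)))).
    unfold sum4. rewrite !dot_sum4. unfold sum4. ring.
Qed.

(** Two surfaces whose adapted frames have the same connection coefficients
    differ by the motion that matches the frames at one point. *)
Lemma congruent_surfaces I J z z' phi psi A B F F' u0 v0 :
  is_open_interval I -> is_open_interval J -> rect I J u0 v0 ->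
  skew_on (rect I J) A -> skew_on (rect I J) B ->
  smooth_vec (rect I J) z -> smooth_vec (rect I J) z' ->
  moving_frame (rect I J) A B F -> moving_frame (rect I J) A B F' ->
  (forall u v, rect I J u v ->
     orthonormal_columns (fun i => F i u v) /\
     0 < det4 (F i1 u v) (F i2 u v) (F i3 u v) (F i4 u v) /\
     du4 z u v = scal (phi u v) (F i1 u v) /\
     dv4 z u v = scal (psi u v) (F i2 u v)) ->
  (forall u v, rect I J u v ->
     orthonormal_columns (fun i => F' i u v) /\
     0 < det4 (F' i1 u v) (F' i2 u v) (F' i3 u v) (F' i4 u v) /\
     du4 z' u v = scal (phi u v) (F' i1 u v) /\
     dv4 z' u v = scal (psi u v) (F' i2 u v)) ->
  exists T, motion T /\ forall u v, rect I J u v -> z' u v = T (z u v).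
Proof.
  intros HI HJ H0 SA SB Sz Sz' MF MF' HF HF'.
  set (F0 := fun i => F i u0 v0). set (F0' := fun i => F' i u0 v0).
  set (T := frame_motion (z u0 v0) (z' u0 v0) F0 F0').
  exists T. split.
  { destruct (HF u0 v0 H0) as (O & P & _). destruct (HF' u0 v0 H0) as (O' & P' & _).
    now apply frame_motion_motion. }
  assert (rot : forall j u v, rect I J u v -> frame_map F0 F0' (F j u v) = F' j u v).
  { intros j u v Huv.
    rewrite (frame_map_transition F0 F0' (fun i => F i u v) (fun i => F' i u v)).
    - apply (frame_map_frame (fun i => F i u v) (fun i => F' i u v)). now apply HF.
    - intros l k. symmetry.
      now apply (moving_frame_transition I J A B F F' u0 v0). }
  intros u v Huv. apply R4_ext. intros k.
  enough (E : coord k (z' u v) - coord k (T (z u v))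
              = coord k (z' u0 v0) - coord k (T (z u0 v0))).
  { assert (Z : coord k (T (z u0 v0)) = coord k (z' u0 v0)).
    { unfold T, frame_motion, frame_map. rewrite coord_plus, coord_vec.
      rewrite (sum4_ext _ (fun _ => 0)).
      - unfold sum4. ring.
      - intros i. rewrite dot_sum4. unfold sum4. rewrite !coord_minus. ring. }
    lra. }
  apply (rect_constant I J
    (fun u v => coord k (z' u v) - coord k (T (z u v)))); trivial.
  clear u v Huv. intros u v Huv.
  destruct (HF u v Huv) as (_ & _ & Eu & Ev).
  destruct (HF' u v Huv) as (_ & _ & Eu' & Ev'). split.
  - evar_last.
    + apply (derive_minus
               (fun s => coord k (z' s v)) (fun s => coord k (T (z s v)))).
      * now apply (is_derive_coord_u (rect I J)).
      * apply (is_derive_frame_motion _ _ _ _ (fun s => z s v) (du4 z u v)).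
        intros l. now apply (is_derive_coord_u (rect I J)).
    + rewrite Eu, Eu', frame_map_scal, rot by trivial. apply Rminus_diag.
  - evar_last.
    + apply (derive_minus
               (fun t => coord k (z' u t)) (fun t => coord k (T (z u t)))).
      * now apply (is_derive_coord_v (rect I J)).
      * apply (is_derive_frame_motion _ _ _ _ (fun t => z u t) (dv4 z u v)).
        intros l. now apply (is_derive_coord_v (rect I J)).
    + rewrite Ev, Ev', frame_map_scal, rot by trivial. apply Rminus_diag.
Qed.

(** The surface is recovered from its moving frame by integrating
    [z_u = phi x], [z_v = psi y]; this is possible because the first two rows of
    the connection are torsion free. *)
Lemma surface_of_moving_frame I J phi psi nu1 nu2 lam mu F u0 v0 :
  is_open_interval I -> is_open_interval J -> rect I J u0 v0 ->
  smooth_on (rect I J) phi -> smooth_on (rect I J) psi ->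
  (forall u v, rect I J u v -> phi u v <> 0) ->
  (forall u v, rect I J u v -> psi u v <> 0) ->
  (forall i, smooth_vec (rect I J) (F i)) ->
  moving_frame (rect I J) (conn_u nu1 nu2 lam mu phi psi)
    (conn_v nu1 nu2 lam mu phi psi) F ->
  (forall u v, rect I J u v -> orthonormal_columns (fun i => F i u v) /\
     0 < det4 (F i1 u v) (F i2 u v) (F i3 u v) (F i4 u v)) ->
  exists z, smooth_vec (rect I J) z /\
    adapted_frame (rect I J) z phi psi nu1 nu2 lam mu F.
Proof.
  intros HI HJ H0 Sphi Spsi Nphi Npsi SF MF HF.
  assert (HD := rect_open I J HI HJ).
  set (P k u v := phi u v * coord k (F i1 u v)).
  set (Q k u v := psi u v * coord k (F i2 u v)).
  assert (SP : forall k, smooth_on (rect I J) (P k)).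
  { intros k. apply smooth_mult; trivial. apply SF. }
  assert (SQ : forall k, smooth_on (rect I J) (Q k)).
  { intros k. apply smooth_mult; trivial. apply SF. }
  assert (dFu : forall i u v, rect I J u v -> du4 (F i) u v = vec (fun k =>
    sum4 (fun j => conn_u nu1 nu2 lam mu phi psi i j u v * coord k (F j u v)))).
  { intros i u v Huv. apply R4_ext. intros k. rewrite coord_vec, coord_du4.
    apply is_derive_unique. now apply MF. }
  assert (dFv : forall i u v, rect I J u v -> dv4 (F i) u v = vec (fun k =>
    sum4 (fun j => conn_v nu1 nu2 lam mu phi psi i j u v * coord k (F j u v)))).
  { intros i u v Huv. apply R4_ext. intros k. rewrite coord_vec, coord_dv4.
    apply is_derive_unique. now apply MF. }
  assert (closed : forall k u v, rect I J u v -> dv (P k) u v = du (Q k) u v).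
  { intros k u v Huv. unfold P, Q.
    rewrite (dv_mult (rect I J) phi (fun u v => coord k (F i1 u v)))
      by (trivial; apply SF).
    rewrite (du_mult (rect I J) psi (fun u v => coord k (F i2 u v)))
      by (trivial; apply SF).
    rewrite <- coord_dv4, <- coord_du4, dFv, dFu, !coord_vec by trivial.
    unfold conn_u, conn_v, sum4. simpl. field. auto. }
  set (z u v := vec (fun k => path_primitive (P k) (Q k) u0 v0 u v)).
  assert (Sz : smooth_vec (rect I J) z).
  { intros k. apply (smooth_ext _ (path_primitive (P k) (Q k) u0 v0)); trivial.
    - intros u v _. unfold z. now rewrite coord_vec.
    - apply path_primitive_smooth; trivial. apply closed. }
  assert (zu : forall u v, rect I J u v -> du4 z u v = scal (phi u v) (F i1 u v)).
  { intros u v Huv. apply R4_ext. intros k. rewrite coord_du4, coord_scal.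
    apply is_derive_unique.
    apply (is_derive_ext (fun s => path_primitive (P k) (Q k) u0 v0 s v)).
    - intros s. unfold z. now rewrite coord_vec.
    - apply (path_primitive_derive_u I J (P k) (Q k)); trivial. apply closed. }
  assert (zv : forall u v, rect I J u v -> dv4 z u v = scal (psi u v) (F i2 u v)).
  { intros u v Huv. apply R4_ext. intros k. rewrite coord_dv4, coord_scal.
    apply is_derive_unique.
    apply (is_derive_ext (fun t => path_primitive (P k) (Q k) u0 v0 u t)).
    - intros t. unfold z. now rewrite coord_vec.
    - apply (path_primitive_derive_v I J (P k) (Q k)); trivial. }
  exists z. split; trivial. intros u v Huv.
  destruct (HF u v Huv) as [Ho Hdet].
  assert (K : forall i j, dot (F i u v) (F j u v) = kron i j)
    by (intros i j; now apply (orthonormal_columns_dot (fun i => F i u v))).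
  assert (comb : forall (a : idx -> R) (m : idx),
    dot (vec (fun k => sum4 (fun j => a j * coord k (F j u v)))) (F m u v) = a m).
  { intros a m.
    transitivity (sum4 (fun j => a j * dot (F j u v) (F m u v))).
    - rewrite dot_sum4.
      rewrite (sum4_ext _ (fun k => sum4 (fun j => a j * coord k (F j u v))
                                    * coord k (F m u v)))
        by (intros k; now rewrite coord_vec).
      rewrite (sum4_ext (fun j => a j * _) (fun j => a j *
        sum4 (fun k => coord k (F j u v) * coord k (F m u v))))
        by (intros j; now rewrite dot_sum4).
      unfold sum4. ring.
    - rewrite (sum4_ext _ (fun j => a j * kron j m)) by (intros j; now rewrite K).
      unfold sum4, kron. destruct m; ring. }
  assert (zuu : forall m, dot (du4 (du4 z) u v) (F m u v)
    = du phi u v * kron i1 m + phi u v * conn_u nu1 nu2 lam mu phi psi i1 m u v).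
  { intros m. rewrite (du4_scal (rect I J) phi (F i1)) by trivial.
    now rewrite dot_plus_l, !dot_scal_l, K, dFu, comb. }
  assert (zuv : forall m, dot (dv4 (du4 z) u v) (F m u v)
    = dv phi u v * kron i1 m + phi u v * conn_v nu1 nu2 lam mu phi psi i1 m u v).
  { intros m. rewrite (dv4_scal (rect I J) phi (F i1)) by trivial.
    now rewrite dot_plus_l, !dot_scal_l, K, dFv, comb. }
  assert (zvv : forall m, dot (dv4 (dv4 z) u v) (F m u v)
    = dv psi u v * kron i2 m + psi u v * conn_v nu1 nu2 lam mu phi psi i2 m u v).
  { intros m. rewrite (dv4_scal (rect I J) psi (F i2)) by trivial.
    now rewrite dot_plus_l, !dot_scal_l, K, dFv, comb. }
  rewrite !zuu, !zuv, !zvv. unfold conn_u, conn_v. simpl.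
  repeat split; auto; ring.
Qed.

Theorem theorem4p1
  (D : R -> R -> Prop) (nu1 nu2 lam mu : R -> R -> R)
  (HD : plane_domain D)
  (Hnu1 : smooth_on D nu1) (Hnu2 : smooth_on D nu2)
  (Hlam : smooth_on D lam) (Hmu : smooth_on D mu)
  (Hmu0 : forall u v, D u v -> mu u v <> 0)
  (Hsum : forall u v, D u v -> nu1 u v + nu2 u v > 0)
  (HTheta : forall u v, D u v -> Theta nu1 nu2 lam mu u v <> 0)
  (u0 v0 : R) (H0 : D u0 v0) (c1 c2 : R)
  (I J : R -> Prop) (HI : is_open_interval I) (HJ : is_open_interval J)
  (HU : forall u v, rect I J u v -> D u v) (HU0 : rect I J u0 v0)
  (phi psi : R -> R -> R)
  (Hphi : smooth_on (rect I J) phi) (Hpsi : smooth_on (rect I J) psi)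
  (Hphi0 : forall u v, rect I J u v -> phi u v <> 0)
  (Hpsi0 : forall u v, rect I J u v -> psi u v <> 0) :
  let c := exp (c2 - c1) in
  let f1 := f1 nu1 nu2 lam mu in
  let f2 := f2 nu1 nu2 lam mu in
  let f3 := f3 nu1 nu2 lam mu in
  let f4 := f4 nu1 nu2 lam mu in
  let g1 := fun u => exp (RInt (fun s => c * f3 s v0 + f4 s v0) u0 u - c1) in
  let g2 := fun v => exp (RInt (fun t => f1 u0 t + 1 / c * f2 u0 t) v0 v - c2) in
  (forall u v, rect I J u v -> dv phi u v = f1 u v * phi u v + f2 u v * psi u v) ->
  (forall u v, rect I J u v -> du psi u v = f3 u v * phi u v + f4 u v * psi u v) ->
  (forall u, I u -> phi u v0 = g1 u) ->
  (forall v, J v -> psi u0 v = g2 v) ->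
  (forall u v, rect I J u v ->
     nu1 u v * nu2 u v - (lam u v ^ 2 + mu u v ^ 2)
     = - (1 / (phi u v * psi u v)) *
       (dv (fun s t => f1 s t * (phi s t / psi s t) + f2 s t) u v
        + du (fun s t => f3 s t + f4 s t * (psi s t / phi s t)) u v)) ->
  (forall u v, rect I J u v ->
     phi u v * psi u v * (nu1 u v - nu2 u v) * mu u v
     = dv (fun s t =>
             2 * (lam s t / mu s t) * (du psi s t / psi s t)
             - (nu1 s t - nu2 s t) / mu s t * (dv phi s t / psi s t)
             + du lam s t / mu s t
             - dv nu1 s t / mu s t * (phi s t / psi s t)) u v
       - du (fun s t =>
             2 * (lam s t / mu s t) * (dv phi s t / phi s t)
             + (nu1 s t - nu2 s t) / mu s t * (du psi s t / phi s t)
             - du nu2 s t / mu s t * (psi s t / phi s t)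
             + dv lam s t / mu s t) u v) ->
  (exists z : R -> R -> R4,
     canonical_principal_parameters (rect I J) z nu1 nu2 lam mu u0 v0 c1 c2) /\
  (forall z z' : R -> R -> R4,
     canonical_principal_parameters (rect I J) z nu1 nu2 lam mu u0 v0 c1 c2 ->
     canonical_principal_parameters (rect I J) z' nu1 nu2 lam mu u0 v0 c1 c2 ->
     exists T : R4 -> R4, motion T /\
       forall u v, rect I J u v -> z' u v = T (z u v)).
Proof.
  intros c f1' f2' f3' f4' g1 g2 Hphiv Hpsiu Hphig Hpsig Hgauss Hricci.
  assert (HR := rect_open I J HI HJ).
  assert (Snu1 := smooth_sub D (rect I J) nu1 HU Hnu1).
  assert (Snu2 := smooth_sub D (rect I J) nu2 HU Hnu2).
  assert (Slam := smooth_sub D (rect I J) lam HU Hlam).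
  assert (Smu := smooth_sub D (rect I J) mu HU Hmu).
  assert (Nmu : forall u v, rect I J u v -> mu u v <> 0) by auto.
  assert (Psum : forall u v, rect I J u v -> nu1 u v + nu2 u v > 0) by auto.
  assert (NT : forall u v, rect I J u v -> Theta nu1 nu2 lam mu u v <> 0) by auto.
  assert (pos : forall u v, rect I J u v -> 0 < phi u v /\ 0 < psi u v).
  { now apply (solution_positive I J nu1 nu2 lam mu u0 v0 c1 c2). }
  assert (Pphi : forall u v, rect I J u v -> 0 < phi u v) by (intros; now apply pos).
  assert (Ppsi : forall u v, rect I J u v -> 0 < psi u v) by (intros; now apply pos).
  split.
  - destruct (moving_frame_exists I J (conn_u nu1 nu2 lam mu phi psi)
      (conn_v nu1 nu2 lam mu phi psi) u0 v0) as (F & MF & SF & OF); trivial.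
    + now apply conn_u_smooth.
    + now apply conn_v_smooth.
    + apply skew_matrix_skew.
    + apply skew_matrix_skew.
    + intros i j u v. now apply (conn_flat nu1 nu2 lam mu phi psi (rect I J)).
    + destruct (surface_of_moving_frame I J phi psi nu1 nu2 lam mu F u0 v0)
        as (z & Sz & HF); trivial.
      exists z. split.
      * now apply (adapted_geometric_functions (rect I J) z phi psi nu1 nu2 lam mu F).
      * intros u v Huv. split; [now apply NT|].
        apply (solution_canonical I J nu1 nu2 lam mu u0 v0 c1 c2 HI HJ HU0
          Snu1 Snu2 Slam Smu NT phi psi); trivial.
        intros s t Hst.
        destruct (adapted_sqrt (rect I J) z phi psi nu1 nu2 lam mu F
          HF Pphi Ppsi s t Hst)
          as (E & G & _).
        now split.
  - assert (frame : forall z,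
      canonical_principal_parameters (rect I J) z nu1 nu2 lam mu u0 v0 c1 c2 ->
      smooth_vec (rect I J) z /\ exists F,
        adapted_frame (rect I J) z phi psi nu1 nu2 lam mu F /\
        moving_frame (rect I J) (conn_u nu1 nu2 lam mu phi psi)
          (conn_v nu1 nu2 lam mu phi psi) F).
    { intros z [HG HC].
      assert (Sz : smooth_vec (rect I J) z).
      { apply smooth4_vec. apply HG. }
      split; trivial.
      destruct (geometric_functions_adapted (rect I J) z phi psi nu1 nu2 lam mu)
        as (l & Sl & HF); trivial.
      { apply (canonical_solution I J nu1 nu2 lam mu u0 v0 c1 c2 HI HJ HU0
          Snu1 Snu2 Slam Smu NT phi psi); trivial.
        intros u v Huv. now apply HC. }
      exists (geometric_frame z l). split; trivial.
      apply (adapted_moving_frame (rect I J) z); trivial.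
      now apply (adapted_frame_smooth (rect I J) z phi psi nu1 nu2 lam mu). }
    intros z z' Hz Hz'.
    destruct (frame z Hz) as (Sz & F & HF & MF).
    destruct (frame z' Hz') as (Sz' & F' & HF' & MF').
    apply (congruent_surfaces I J z z' phi psi (conn_u nu1 nu2 lam mu phi psi)
      (conn_v nu1 nu2 lam mu phi psi) F F' u0 v0); trivial.
    + apply skew_matrix_skew.
    + apply skew_matrix_skew.
    + intros u v Huv. destruct (HF u v Huv) as (a1 & a2 & a3 & a4 & _). auto.
    + intros u v Huv. destruct (HF' u v Huv) as (a1 & a2 & a3 & a4 & _). auto.
Qed.
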